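(* Let $|q|<1$ and $|\rho|<1$. (i) For all integers $i,j,m,k\ge 0$ with $i+j\ne m+k$, $$\int_{S(q)\times S(q)}Q_{i,j}(x,y|\rho,q)\,Q_{m,k}(x,y|\rho,q)\,f_{2D}(x,y|\rho,q)\,dx\,dy=0,$$ and, for integers $n,j,k$ with $0\le j,k\le n$, $$\int_{S(q)\times S(q)}Q_{n-j,j}(x,y|\rho,q)\,Q_{n-k,k}(x,y|\rho,q)\,f_{2D}(x,y|\rho,q)\,dx\,dy$$ $$=(-1)^{k-j}\frac{\rho^{k-j}q^{\binom{k-j}{2}}[j]_q!\,[n-j]_q!}{(\rho^2;q)_n}\sum_{s=0}^{j}q^{s(s-1)+ns}\binom{k}{k-j+s}_q\binom{n-j+s}{s}_q\rho^{2s}\left(\rho^2q^{n-j+s};q\right)_{j-s}.$$ (ii) For $x,y\in S(q)$ and real $t,s$ with $(1-q)t^2<1$ and $(1-q)s^2<1$, $$\sum_{n,m\ge 0}\frac{t^ns^m}{[n]_q!\,[m]_q!}Q_{n,m}(x,y|\rho,q)=\frac{f_{bN}(x|t,q)\,f_{bN}(y|s,q)}{f_{2D}(x,y|\rho,q)}\sum_{k\ge 0}\frac{\rho^k}{[k]_q!}H_k(x|t,q)\,H_k(y|s,q),$$ where at points at which $f_N(x|q)f_N(y|q)=0$ the quotient is understood after cancelling the common factor $f_N(x|q)f_N(y|q)$, i.e. as $\varphi_H(x|t,q)\varphi_H(y|s,q)/\gamma_{0,0}(x,y|\rho,q)$. The formulae in (i) and (ii) also hold for $q=1$ (with $|\rho|<1$).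 (iii) For all $x,y\in\mathbb{R}$ and all integers $i,j,m\ge 0$, $$Q_{i,j}(x,y|\rho q^m,q)\prod_{l=0}^{m-1}\omega\!\left(\tfrac{x\sqrt{1-q}}{2},\tfrac{y\sqrt{1-q}}{2}\,\Big|\,\rho q^{l}\right)=(\rho^2;q)_{2m}\sum_{k=0}^{m}(-1)^k\binom{m}{k}_q q^{\binom{k}{2}}(1-q)^k\rho^kQ_{i+k,j+k}(x,y|\rho,q).$$ In particular, for every integer $n\ge 0$, $$\prod_{j=0}^{n-1}\omega\!\left(\tfrac{x\sqrt{1-q}}{2},\tfrac{y\sqrt{1-q}}{2}\,\Big|\,\rho q^{j}\right)=(\rho^2;q)_{2n}\sum_{k=0}^{n}(-1)^k\binom{n}{k}_q q^{\binom{k}{2}}(1-q)^k\rho^kQ_{k,k}(x,y|\rho,q)$$ and $$q^{\binom{n}{2}}\rho^n(1-q)^nQ_{n,n}(x,y|\rho,q)=\sum_{k=0}^{n}(-1)^kq^{\binom{n-k}{2}}\binom{n}{k}_q\frac{\prod_{j=0}^{k-1}\omega\!\left(\tfrac{x\sqrt{1-q}}{2},\tfrac{y\sqrt{1-q}}{2}\,\Big|\,\rho q^{j}\right)}{(\rho^2;q)_{2k}},$$ where empty products equal $1$.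
   Context: All parameters $q,\rho$ are real, $-1<q\le 1$, and $0^0=1$. Put $[0]_q=0$, $[n]_q=1+q+\dots+q^{n-1}$, $[n]_q!=\prod_{j=1}^n[j]_q$, $[0]_q!=1$; $\binom{n}{k}_q=\frac{[n]_q!}{[n-k]_q!\,[k]_q!}$ for $n\ge k\ge 0$ and $0$ otherwise; $\binom{r}{2}=r(r-1)/2$; $(a;q)_0=1$, $(a;q)_n=\prod_{j=0}^{n-1}(1-aq^j)$, and, for $|q|<1$, $(a;q)_\infty=\prod_{j\ge 0}(1-aq^j)$. Let $S(q)=\left[-\frac{2}{\sqrt{1-q}},\frac{2}{\sqrt{1-q}}\right]$ if $|q|<1$ and $S(1)=\mathbb{R}$. The $q$-Hermite polynomials are defined by $H_{-1}(x|q)=0$, $H_0(x|q)=1$, $H_{n+1}(x|q)=xH_n(x|q)-[n]_qH_{n-1}(x|q)$ for $n\ge 0$. The big $q$-Hermite polynomials with parameter $a\in\mathbb{R}$ are defined by $H_{-1}(x|a,q)=0$, $H_0(x|a,q)=1$, $H_{n+1}(x|a,q)=(x-aq^n)H_n(x|a,q)-[n]_qH_{n-1}(x|a,q)$ for $n\ge 0$. The (rescaled) Al-Salam--Chihara polynomials are defined by $P_0(x|y,\rho,q)=1$, $P_1(x|y,\rho,q)=x-\rho y$ and, for $n\ge 1$, $P_{n+1}(x|y,\rho,q)=(x-\rho yq^n)P_n(x|y,\rho,q)-[n]_q(1-\rho^2q^{n-1})P_{n-1}(x|y,\rho,q)$. $\omega(x,y|\rho)=(1-\rho^2)^2-4\rho(1+\rho^2)xy+4\rho^2(x^2+y^2)$.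 For $|\rho|<1$, $x,y\in S(q)$ and integers $i,j\ge 0$ let $\gamma_{i,j}(x,y|\rho,q)=\sum_{n\ge 0}\frac{\rho^n}{[n]_q!}H_{n+i}(x|q)H_{n+j}(y|q)$. The polynomials $Q_{i,j}(x,y|\rho,q)$ (of degree $i+j$ in $x,y$) are those satisfying $\gamma_{i,j}(x,y|\rho,q)=Q_{i,j}(x,y|\rho,q)\,\gamma_{0,0}(x,y|\rho,q)$ for all $x,y\in S(q)$; they are given explicitly, for all $x,y\in\mathbb{R}$, by $$Q_{i,j}(x,y|\rho,q)=\sum_{s=0}^{j}(-1)^s q^{\binom{s}{2}}\binom{j}{s}_q\rho^s H_{j-s}(y|q)\,\frac{P_{i+s}(x|y,\rho,q)}{(\rho^2;q)_{i+s}}.$$ Densities: for $|q|<1$ and $x,y\in S(q)$, $$f_N(x|q)=\frac{\sqrt{(1-q)(4-(1-q)x^2)}\,(q;q)_\infty}{2\pi}\prod_{j=1}^{\infty}\left((1+q^j)^2-(1-q)x^2q^j\right),$$ $$f_{CN}(x|y,\rho,q)=f_N(x|q)\frac{(\rho^2;q)_\infty}{\prod_{j=0}^{\infty}\omega\!\left(\frac{x\sqrt{1-q}}{2},\frac{y\sqrt{1-q}}{2}\,\big|\,\rho q^j\right)};$$ for $q=1$, $f_N(x|1)=\frac{1}{\sqrt{2\pi}}e^{-x^2/2}$ and $f_{CN}(x|y,\rho,1)=\frac{1}{\sqrt{2\pi(1-\rho^2)}}\exp\left(-\frac{(x-\rho y)^2}{2(1-\rho^2)}\right)$. In all cases $f_{2D}(x,y|\rho,q)=f_{CN}(x|y,\rho,q)f_N(y|q)$;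 one has $f_{2D}(x,y|\rho,q)=\gamma_{0,0}(x,y|\rho,q)f_N(x|q)f_N(y|q)$. For $(1-q)t^2<1$ and $x\in S(q)$ let $\varphi_H(x|t,q)=\sum_{n\ge 0}\frac{t^n}{[n]_q!}H_n(x|q)$ (which equals $\prod_{j\ge 0}\left(1-(1-q)xtq^j+(1-q)t^2q^{2j}\right)^{-1}$ for $|q|<1$ and $\exp(xt-t^2/2)$ for $q=1$), and $f_{bN}(x|t,q)=f_N(x|q)\varphi_H(x|t,q)$.
   Formalization: In the second formula of (i) the exponent s(s-1)+ns is corrected to s(s-1)+s(k-j); the printed one fails for n=j=k=1, q≠1, ρ≠0. The powers of q and ρ in front are moved inside the sum so that they make sense for k<j when q or ρ is 0. *)

(* Defs.v *)
From HB Require Import structures.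
From mathcomp Require Import all_boot all_order all_algebra.
From mathcomp Require Import all_classical all_reals all_analysis.

Set Implicit Arguments.
Unset Strict Implicit.
Unset Printing Implicit Defensive.

Import Order.TTheory GRing.Theory Num.Theory.
Import numFieldNormedType.Exports.

Local Open Scope classical_set_scope.
Local Open Scope ring_scope.

Section QDefs.
Context {R : realType}.
Implicit Types (q rho a t s x y : R).

Definition qint q (n : nat) : R := \sum_(i < n) q ^+ i.

Definition qfact q (n : nat) : R := \prod_(1 <= j < n.+1) qint q j.

(* The arguments are integers because the lower one may be negative; a
   truncated difference of naturals would give 1 there instead of 0. *)
Definition qbinom q (n k : int) : R :=
  if 0 <= k <= n then qfact q `|n| / (qfact q `|(n - k)%R| * qfact q `|k|)
  else 0.

(* r (r - 1) / 2, a nonnegative integer also when r < 0 *)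
Definition binom2 (r : int) : int := (r * (r - 1) %/ 2)%Z.

Definition qpoch a q (n : nat) : R := \prod_(j < n) (1 - a * q ^+ j).

Definition qpoch_oo a q : R := limn (qpoch a q).

Definition qsupp q : set R :=
  if q == 1 then setT
  else `[- (2 / Num.sqrt (1 - q)), 2 / Num.sqrt (1 - q)]%classic.

(* In the two recursions below, the inner [else 0] is the term of index -1. *)
Fixpoint qHermite q (n : nat) x : R :=
  if n is m.+1 then
    x * qHermite q m x
    - qint q m * (if m is p.+1 then qHermite q p x else 0)
  else 1.

Fixpoint big_qHermite q a (n : nat) x : R :=
  if n is m.+1 then
    (x - a * q ^+ m) * big_qHermite q a m x
    - qint q m * (if m is p.+1 then big_qHermite q a p x else 0)
  else 1.

Definition omega x y rho : R :=
  (1 - rho ^+ 2) ^+ 2 - 4 * rho * (1 + rho ^+ 2) * x * y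
  + 4 * rho ^+ 2 * (x ^+ 2 + y ^+ 2).

Definition omega_q q rho x y : R :=
  omega (x * Num.sqrt (1 - q) / 2) (y * Num.sqrt (1 - q) / 2) rho.

Definition qgamma q rho (i j : nat) x y : R :=
  limn (series (fun n => rho ^+ n / qfact q n
                         * qHermite q (n + i) x * qHermite q (n + j) y)).

(* The defining property of the polynomial Q_{i,j}. Since qsupp q is infinite
   and gamma_{0,0} does not vanish on qsupp q `*` qsupp q when `|rho| < 1, at
   most one polynomial has it. The outer variable of p stands for x and the
   inner one for y. *)
Definition is_Qpoly q rho (i j : nat) (p : {poly {poly R}}) : Prop :=
  forall x y, x \in qsupp q -> y \in qsupp q ->
    qgamma q rho i j x y = p.[x%:P].[y] * qgamma q rho 0 0 x y.

Definition Qpoly q rho (i j : nat) : {poly {poly R}} :=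
  xget 0 [set p | is_Qpoly q rho i j p].

Definition Q q rho (i j : nat) x y : R := (Qpoly q rho i j).[x%:P].[y].

Definition f_N q x : R :=
  if q == 1 then expR (- (x ^+ 2 / 2)) / Num.sqrt (2 * pi)
  else Num.sqrt ((1 - q) * (4 - (1 - q) * x ^+ 2)) * qpoch_oo q q / (2 * pi)
       * limn (fun n => \prod_(1 <= j < n.+1)
                  ((1 + q ^+ j) ^+ 2 - (1 - q) * x ^+ 2 * q ^+ j)).

Definition f_CN q rho x y : R :=
  if q == 1 then
    expR (- ((x - rho * y) ^+ 2 / (2 * (1 - rho ^+ 2))))
    / Num.sqrt (2 * pi * (1 - rho ^+ 2))
  else f_N q x * (qpoch_oo (rho ^+ 2) q
         / limn (fun n => \prod_(j < n) omega_q q (rho * q ^+ j) x y)).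

Definition f_2D q rho x y : R := f_CN q rho x y * f_N q y.

Definition phi_H q t x : R :=
  limn (series (fun n => t ^+ n / qfact q n * qHermite q n x)).

Definition f_bN q t x : R := f_N q x * phi_H q t x.

(* f_bN(x|t) f_bN(y|s) / f_2D(x,y|rho); where f_N(x) f_N(y) = 0 this factor is
   cancelled, using f_2D = gamma_{0,0} f_N f_N. *)
Definition density_quotient q rho t s x y : R :=
  if f_N q x * f_N q y == 0 then
    phi_H q t x * phi_H q s y / qgamma q rho 0 0 x y
  else f_bN q t x * f_bN q s y / f_2D q rho x y.

(* The absolutely convergent double series with terms u n m has sum l; by
   absolute convergence the sum can be computed along square partial sums. *)
Definition has_double_sum (u : nat -> nat -> R) (l : R) : Prop :=
  summable [set: nat * nat] (fun p => (u p.1 p.2)%:E) /\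
  (fun N => \sum_(n < N) \sum_(m < N) u n m) @ \oo --> l.

(* F is Lebesgue integrable on qsupp q `*` qsupp q, with integral c *)
Definition has_integral2 q (F : R -> R -> R) (c : R) : Prop :=
  let D := (qsupp q `*` qsupp q : set (measurableTypeR R * measurableTypeR R)) in
  let mu := (@lebesgue_measure R \x @lebesgue_measure R)%E in
  mu.-integrable D (fun z => (F z.1 z.2)%:E) /\
  (\int[mu]_(z in D) (F z.1 z.2)%:E = c%:E)%E.

End QDefs.

(* Main.v *)
Require Import Defs.
From HB Require Import structures.
From mathcomp Require Import all_boot all_order all_algebra.
From mathcomp Require Import all_classical all_reals all_analysis.
From mathcomp Require Import measurable_realfun.
From mathcomp Require Import ring lra zify.

Set Implicit Arguments.
Unset Strict Implicit.
Unset Printing Implicit Defensive.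

Import Order.TTheory GRing.Theory Num.Theory.
Import numFieldNormedType.Exports.

Local Open Scope classical_set_scope.
Local Open Scope ring_scope.

(** Everything is derived from the series gamma_(i,j). The recurrence of the
    q-Hermite polynomials in x and in y gives two recurrences of gamma
    ([gamma_recl], [gamma_recr]) which have polynomial coefficients. Solving them
    expresses gamma_(i,j) as a polynomial times gamma_00 ([gamma_Qfun]). As
    gamma_00 does not vanish on the support, this polynomial is Q_(i,j) ([QE]).
    That gamma_00 does not vanish, and that gamma_00 f_N f_N = f_2D ([f_2DE]),
    follows from Mehler's formula. For |q| < 1 the relation between gamma_00 at
    rho and at rho q is iterated, which yields an infinite product ([q_Mehler]);
    for q = 1 the same relation [gamma11] becomes a differential equation in rho
    ([Mehler_q1]). All series converge absolutely since H_n(x) grows at most like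
    r^n times the square root of [n]!, for every r > 1 and every x in the support,
    the end points included ([big_qHermite_growth]).

    Integrals. In the integral of Q_(i,j) Q_(m,k) f_2D the product of Q_(i,j) and
    gamma_00 is gamma_(i,j), and gamma_(i,j) is integrated term by term against
    H_a(x) H_b(y): by orthogonality of the H_n only the first term survives when
    a + b <= i + j ([has_int_gamma]). Hence the integral vanishes for
    m + k < i + j, and for m + k = i + j it is [i]! [j]! times the coefficient of
    x^i y^j in Q_(m,k) ([has_int_gamma_Q]). The coefficients of top degree obey
    the recursions of Q_(m,k) without their lower terms, and are computed with
    Gaussian binomials ([Qtop_closed_form]).

    Orthogonality of the H_n for f_N reduces to the vanishing of the integrals of
    H_n f_N for n > 0, because multiplication by x is symmetric
    ([favard_moments]). For q = 1 the function H_n f_N is a derivative. For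
    |q| < 1 the density is the semicircle density times a product; the finite
    form of the Jacobi triple product ([triple_product_finite]) expands the
    truncated products in the Chebyshev polynomials U_(2k), which are orthogonal
    for the semicircle density. Letting the truncation grow gives the integrals
    of U_m f_N, and the recursions of H_n and U_m then give those of H_n U_m f_N
    ([moments_vanish]).

    Generating function. The sum over n, m of t^n s^m gamma_(n,m) / ([n]! [m]!) is
    an absolutely convergent triple series ([triple_majorant]). For a fixed index
    k of gamma its sum is rho^k / [k]! times two sums over n and m, namely
    phi_H(x|t) H_k(x|t) and phi_H(y|s) H_k(y|s) ([phi_big_qHermite]); Tannery's
    theorem ([series_dominated_cvg]) gives the result.

    Dilation of rho. Since q^n = 1 - (1 - q) [n], gamma_(i,j) at rho q is
    gamma_(i,j) - (1 - q) rho gamma_(i+1,j+1) at rho ([gamma_qscale]); iterating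
    this relation, or its inverse, gives the identities on the support. Both sides
    being polynomials, they extend to all real x and y ([bipolyfun_eq_qsupp]). *)

(** * Gaussian binomial coefficients *)

Section QNumbers.
Context {R : realType}.
Implicit Types (q : R) (m n k : nat).

Lemma qint0 q : qint q 0 = 0. Proof. by rewrite /qint big_ord0. Qed.

Lemma qintSr q n : qint q n.+1 = qint q n + q ^+ n.
Proof. by rewrite /qint big_ord_recr. Qed.

Lemma qintS q n : qint q n.+1 = 1 + q * qint q n.
Proof.
rewrite /qint big_ord_recl expr0 mulr_sumr; congr (_ + _).
by apply: eq_bigr => i _; rewrite -exprS.
Qed.

Lemma qint1 q : qint q 1 = 1.
Proof. by rewrite qintS qint0 mulr0 addr0. Qed.

Lemma qintD q m n : qint q (m + n) = qint q m + q ^+ m * qint q n.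
Proof.
elim: n => [|n IH]; first by rewrite addn0 qint0 mulr0 addr0.
by rewrite addnS !qintSr IH exprD; ring.
Qed.

Lemma qint_geom q n : (1 - q) * qint q n = 1 - q ^+ n.
Proof.
elim: n => [|n IH]; first by rewrite qint0 mulr0 subrr.
by rewrite qintSr mulrDr IH exprSr; ring.
Qed.

Lemma qint_at1 n : qint 1 n = n%:R :> R.
Proof.
elim: n => [|n IH]; first by rewrite qint0.
by rewrite qintSr IH expr1n natr1.
Qed.

Lemma qint_gt0 q n : -1 < q <= 1 -> 0 < qint q n.+1.
Proof.
move=> /andP[q1 q2]; have [->|qN1] := eqVneq q 1; first by rewrite qint_at1 ltr0n.
have qlt1 : q < 1 by rewrite lt_neqAle qN1.
rewrite -(pmulr_rgt0 _ (_ : 0 < 1 - q)) ?subr_gt0// qint_geom subr_gt0.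
apply: le_lt_trans (ler_norm _) _; rewrite normrX.
by rewrite exprn_ilt1 ?normr_ge0// ltr_norml q1.
Qed.

Lemma qint_ge0 q n : -1 < q <= 1 -> 0 <= qint q n.
Proof. by case: n => [|n] hq; rewrite ?qint0// ltW// qint_gt0. Qed.

Lemma qfact0 q : qfact q 0 = 1. Proof. by rewrite /qfact big_nil. Qed.

Lemma qfactS q n : qfact q n.+1 = qfact q n * qint q n.+1.
Proof. by rewrite /qfact big_nat_recr. Qed.

Lemma qfact_gt0 q n : -1 < q <= 1 -> 0 < qfact q n.
Proof.
move=> hq; elim: n => [|n IH]; first by rewrite qfact0.
by rewrite qfactS mulr_gt0// qint_gt0.
Qed.

Lemma qfact_neq0 q n : -1 < q <= 1 -> qfact q n != 0.
Proof. by move=> hq; rewrite gt_eqF// qfact_gt0. Qed.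

(** Gaussian binomials, defined through Pascal's rule so that they are
    available without dividing by q-factorials. *)
Fixpoint gbin q n k : R :=
  if k is k'.+1 then
    if n is n'.+1 then gbin q n' k + q ^+ (n' - k') * gbin q n' k' else 0
  else 1.

Lemma gbin0 q n : gbin q n 0 = 1. Proof. by case: n. Qed.

Lemma gbinS q n k :
  gbin q n.+1 k.+1 = gbin q n k.+1 + q ^+ (n - k) * gbin q n k.
Proof. by []. Qed.

Arguments gbin : simpl never.

Lemma gbin_small q n k : (n < k)%N -> gbin q n k = 0.
Proof.
elim: n k => [|n IH] [|k]// nk.
by rewrite gbinS !IH ?mulr0 ?addr0// ltnS ltnW.
Qed.

Lemma gbin_fact q n k : (k <= n)%N ->
  gbin q n k * (qfact q (n - k) * qfact q k) = qfact q n.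
Proof.
elim: n k => [|n IH] [|k] kn; rewrite ?gbin0 ?qfact0 ?subn0 ?mulr1 ?mul1r//.
rewrite gbinS subSS [qfact q n.+1]qfactS.
have -> : qint q n.+1 = qint q (n - k) + q ^+ (n - k) * qint q k.+1.
  by rewrite -qintD addnS subnK.
rewrite ltnS in kn; have := IH _ kn.
have [kn'|nk] := ltnP k n.
  have := IH _ kn'; rewrite -(subnSK kn') [qfact _ (n - k.+1).+1]qfactS.
  rewrite [qfact _ k.+1]qfactS => e1 e2.
  rewrite mulrDl [RHS]mulrDr -{1}e1 -e2; ring.
have -> : k = n by apply/eqP; rewrite eqn_leq kn.
rewrite subnn (gbin_small _ (ltnSn n)) qint0 qfactS !expr0 => E; rewrite -[in RHS]E; ring.
Qed.

Lemma gbinE q n k : -1 < q <= 1 -> (k <= n)%N ->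
  gbin q n k = qfact q n / (qfact q (n - k) * qfact q k).
Proof.
move=> hq kn; rewrite -(gbin_fact q kn) mulfK// mulf_neq0// qfact_neq0//.
Qed.

Lemma qbinom_gbin q n k : -1 < q <= 1 -> qbinom q n k = gbin q n k.
Proof.
move=> hq; rewrite /qbinom le0z_nat lez_nat /=; case: leqP => [kn|nk].
  by rewrite gbinE// subzn// !absz_nat.
by rewrite gbin_small.
Qed.

Lemma qbinom_lt0 q n (k : int) : k < 0 -> qbinom q n k = 0.
Proof. by move=> k0; rewrite /qbinom leNgt k0. Qed.

(** Pascal's rule with the weights q^C(k, 2) absorbed. *)
Lemma gbin_weight q n k :
  q ^+ 'C(k.+1, 2) * gbin q n.+1 k.+1
  = q ^+ 'C(k.+1, 2) * gbin q n k.+1 + q ^+ n * (q ^+ 'C(k, 2) * gbin q n k).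
Proof.
rewrite gbinS mulrDr; congr (_ + _); have [kn|nk] := leqP k n; last first.
  by rewrite gbin_small ?mulr0.
rewrite !mulrA -!exprD binS bin1; congr (q ^+ _ * _); lia.
Qed.

(** Writing S_n(g) for the sum of (-1)^k q^C(k, 2) (n choose k) g(k), this says
    S_(n+1)(g) = S_n(g) - q^n S_n(g o S): a family obeying the same recursion in
    n is therefore expanded by such sums. *)
Lemma gbin_sum_recr q n (g : nat -> R) :
  \sum_(k < n.+2) (-1) ^+ k * (q ^+ 'C(k, 2) * gbin q n.+1 k) * g k
  = \sum_(k < n.+1) (-1) ^+ k * (q ^+ 'C(k, 2) * gbin q n k) * g k
    - q ^+ n * \sum_(k < n.+1) (-1) ^+ k * (q ^+ 'C(k, 2) * gbin q n k)
        * g k.+1.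
Proof.
rewrite big_ord_recl /= gbin0.
under eq_bigr => i _ do rewrite /bump /= add1n gbin_weight mulrDr mulrDl.
rewrite big_split /= addrA; congr (_ + _); last first.
  rewrite mulr_sumr -sumrN; apply: eq_bigr => i _; rewrite exprS; ring.
by rewrite big_ord_recr /= (gbin_small _ (ltnSn n)) !(mulr0, mul0r) addr0
  [RHS]big_ord_recl /= gbin0.
Qed.

End QNumbers.

Arguments gbin : simpl never.

(** * Growth of the big q-Hermite polynomials *)

Section Growth.
Context {R : realType}.
Implicit Types (q rho a x r : R) (n k : nat).

(** A two-term recursion whose coefficients converge to those of a recursion
    with characteristic roots of modulus less than 1 (b is the squared modulus)
    has bounded solutions: a positive definite quadratic form in two successive
    values is eventually nonincreasing. The boundary case A^2 = 4b of a double
    root is included, which is why the form is shifted by eta. *)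
Lemma recursion_bounded (u al be : nat -> R) (A b : R) :
  al @ \oo --> A -> be @ \oo --> b -> 0 < b < 1 -> A ^+ 2 <= 4 * b ->
  (forall n, u n.+2 = al n * u n.+1 - be n * u n) ->
  exists2 C, 0 <= C & forall n, `|u n| <= C.
Proof.
move=> alA beb /andP[b0 b1] Ab uE.
(* With V the quadratic form below, V n - V n.+1 is the quadratic form in
   u n.+1 and u n whose coefficients are p n, t n and s n. *)
pose eta := (1 - b) ^+ 2 / 2.
pose p n := 1 - b - eta - al n * al n + A * al n.
pose s n := b + eta - be n * be n.
pose t n := - A + 2 * al n * be n - A * be n.
have eta0 : 0 < eta by rewrite divr_gt0// exprn_gt0// subr_gt0.
have pl : p @ \oo --> 1 - b - eta - A * A + A * A.
  apply: cvgD; last exact: cvgMl_tmp.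
  by apply: cvgB; [exact: cvg_cst|exact: cvgM].
have sl : s @ \oo --> b + eta - b * b.
  by apply: cvgB; [exact: cvg_cst|exact: cvgM].
have tl : t @ \oo --> - A + 2 * A * b - A * b.
  apply: cvgB; last exact: cvgMl_tmp.
  apply: cvgD; first exact: cvg_cst.
  by apply: cvgM => //; exact: cvgMl_tmp.
have dl : (fun n => 4 * p n * s n - t n * t n) @ \oo -->
   4 * (1 - b - eta - A * A + A * A) * (b + eta - b * b)
   - (- A + 2 * A * b - A * b) * (- A + 2 * A * b - A * b).
  by apply: cvgB; apply: cvgM => //; exact: cvgMl_tmp.
have plim : 0 < 1 - b - eta - A * A + A * A by rewrite /eta; nra.
have dlim : 0 < 4 * (1 - b - eta - A * A + A * A) * (b + eta - b * b)
   - (- A + 2 * A * b - A * b) * (- A + 2 * A * b - A * b).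
  have e1 : (1 - b) ^+ 2 = 2 * eta by rewrite /eta; field.
  have : A ^+ 2 * (1 - b) ^+ 2 <= 4 * b * (1 - b) ^+ 2.
    by rewrite ler_wpM2r// sqr_ge0.
  have : 0 < eta * eta by rewrite mulr_gt0.
  nra.
have [N _ HN] : \forall n \near \oo, 0 < p n /\ 0 < 4 * p n * s n - t n * t n.
  near=> n; split; near: n; [exact: (cvgr_gt _ pl)|exact: (cvgr_gt _ dl)].
pose V n := u n.+1 ^+ 2 - A * u n.+1 * u n + (b + eta) * u n ^+ 2.
have V_ge n : eta * u n ^+ 2 <= V n.
  rewrite -subr_ge0 (_ : _ - _ = (u n.+1 - A / 2 * u n) ^+ 2
      + (b - A ^+ 2 / 4) * u n ^+ 2); last by rewrite /V; field.
  rewrite addr_ge0 ?sqr_ge0// mulr_ge0 ?sqr_ge0//; lra.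
have V_dec n : (N <= n)%N -> V n.+1 <= V n.
  move=> /HN [p0 d0]; have p4 : 0 < 4 * p n by rewrite mulr_gt0.
  rewrite -subr_ge0 -(pmulr_rge0 _ p4).
  have -> : 4 * p n * (V n - V n.+1) = (2 * p n * u n.+1 + t n * u n) ^+ 2
      + (4 * p n * s n - t n * t n) * u n ^+ 2.
    by rewrite /V /p /s /t uE; ring.
  by rewrite addr_ge0 ?sqr_ge0// mulr_ge0 ?sqr_ge0// ltW.
have V_le n : (N <= n)%N -> V n <= V N.
  move=> /subnK <-; elim: (n - N)%N => [|m IH]; first by rewrite add0n.
  by rewrite addSn (le_trans _ IH)// V_dec// leq_addl.
have VN0 : 0 <= V N by apply: le_trans (V_ge N); rewrite mulr_ge0 ?sqr_ge0// ltW.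
have S0 : 0 <= \sum_(k < N) `|u k| by apply: sumr_ge0.
exists (\sum_(k < N) `|u k| + (1 + V N / eta)) => [|n].
  by rewrite addr_ge0// addr_ge0// divr_ge0// ltW.
have [nN|Nn] := ltnP n N.
  rewrite (bigD1 (Ordinal nN))//= -addrA lerDl addr_ge0//; first exact: sumr_ge0.
  by rewrite addr_ge0// divr_ge0// ltW.
rewrite ler_wpDl//; have : u n ^+ 2 <= V N / eta.
  by rewrite ler_pdivlMr// mulrC (le_trans (V_ge n))// V_le.
rewrite -real_normK ?num_real//; have := normr_ge0 (u n); nra.
Unshelve. all: by end_near. Qed.

Lemma cvg_lim_eq (u : nat -> R) (l l' : R) :
  l = l' -> u @ \oo --> l -> u @ \oo --> l'.
Proof. by move=> ->. Qed.

Lemma cvg_qpow q : -1 < q -> q < 1 -> (fun n => q ^+ n) @ \oo --> (0 : R).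
Proof. by move=> q1 q2; apply: cvg_expr; rewrite ltr_norml q1. Qed.

Lemma cvg_qpowS q : -1 < q -> q < 1 -> (fun n => q ^+ n.+1) @ \oo --> (0 : R).
Proof. by move=> q1 q2; rewrite (@cvg_shiftS _ (fun n => q ^+ n)); exact: cvg_qpow. Qed.

Lemma cvg_qint_inv q : -1 < q <= 1 ->
  (fun n => (qint q n.+1)^-1) @ \oo --> 1 - q.
Proof.
move=> /andP[q1 q2]; have [->|qN1] := eqVneq q 1.
  under eq_fun do rewrite qint_at1.
  by rewrite subrr; exact: cvg_harmonic.
have qlt1 : q < 1 by rewrite lt_neqAle qN1.
have e n : (qint q n.+1)^-1 = (1 - q) / (1 - q ^+ n.+1).
  by rewrite -qint_geom invfM mulrA mulfV ?mul1r// subr_eq0 eq_sym.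
under eq_fun do rewrite e.
apply: (@cvg_lim_eq _ ((1 - q) * (1 - 0)^-1)); first by rewrite subr0 invr1 mulr1.
apply: cvgMl_tmp; apply: cvgV; first by rewrite subr0 oner_neq0.
by apply: cvgB; [exact: cvg_cst|exact: cvg_qpowS].
Qed.

Lemma cvg_sqrt_qint_inv q : -1 < q <= 1 ->
  (fun n => Num.sqrt (qint q n.+1)^-1) @ \oo --> Num.sqrt (1 - q).
Proof.
move=> hq; apply: continuous_cvg; first exact: sqrt_continuous.
exact: cvg_qint_inv.
Qed.

Lemma cvg_qpow_qint q : -1 < q <= 1 ->
  (fun n => q ^+ n / qint q n.+1) @ \oo --> (0 : R).
Proof.
move=> hq; have /andP[q1 q2] := hq; have [q_1|qN1] := eqVneq q 1.
  apply: (@cvg_lim_eq _ (1 - q)); first by rewrite q_1 subrr.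
  rewrite (_ : (fun n => _) = (fun n => (qint q n.+1)^-1)).
    exact: cvg_qint_inv.
  by apply/funext => n; rewrite q_1 expr1n mul1r.
have qlt1 : q < 1 by rewrite lt_neqAle qN1.
by apply: (cvg_lim_eq (mul0r (1 - q))); apply: cvgM; [exact: cvg_qpow|exact: cvg_qint_inv].
Qed.

Lemma cvg_qint_ratio q : -1 < q <= 1 ->
  (fun n => qint q n / qint q n.+1) @ \oo --> (1 : R).
Proof.
move=> hq; rewrite (_ : (fun n => _) = (fun n => 1 - q ^+ n / qint q n.+1)).
  apply: (cvg_lim_eq (subr0 1)); apply: cvgB; first exact: cvg_cst.
  exact: cvg_qpow_qint.
apply/funext => n; have := qint_gt0 n hq; rewrite qintSr => /lt0r_neq0 H.
by rewrite -[X in X - _](mulfV H) -mulrBl addrK.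
Qed.

Lemma in_qsupp q x : q <= 1 -> (x \in qsupp q) = ((1 - q) * x ^+ 2 <= 4).
Proof.
move=> q1; rewrite /qsupp; case: eqP => [->|/eqP qN1].
  by rewrite subrr mul0r ler0n; apply/mem_set.
have q0 : 0 < 1 - q by rewrite subr_gt0 lt_neqAle qN1.
have k0 : 0 < Num.sqrt (1 - q) by rewrite sqrtr_gt0.
have -> : (1 - q) * x ^+ 2 = (Num.sqrt (1 - q) * x) ^+ 2.
  by rewrite exprMn sqr_sqrtr// ltW.
have -> y : (y ^+ 2 <= 4 :> R) = (`|y| <= 2).
  rewrite ler_norml; apply/idP/andP => [H|[H1 H2]]; last by nra.
  by split; rewrite leNgt; apply/negP => H1; nra.
rewrite ler_norml [_ * x]mulrC -(ler_pdivrMr _ _ k0) -(ler_pdivlMr _ _ k0) mulNr.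
by apply/idP/idP => [/set_mem|H]; rewrite /= ?in_itv//; apply/mem_set; rewrite /= in_itv.
Qed.

Lemma big_qHermite0 q a x : big_qHermite q a 0 x = 1. Proof. by []. Qed.

Lemma big_qHermite1 q a x : big_qHermite q a 1 x = x - a.
Proof. by rewrite /= qint0 mul0r subr0 expr0 !mulr1. Qed.

Lemma big_qHermiteS q a n x : big_qHermite q a n.+2 x =
  (x - a * q ^+ n.+1) * big_qHermite q a n.+1 x
  - qint q n.+1 * big_qHermite q a n x.
Proof. by []. Qed.

Lemma qHermiteE q n x : qHermite q n x = big_qHermite q 0 n x.
Proof.
suff: qHermite q n x = big_qHermite q 0 n x /\
      qHermite q n.+1 x = big_qHermite q 0 n.+1 x by case.
elim: n => [|n [IH1 IH2]]; first by rewrite big_qHermite1 /= qint0; split=> //; ring.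
split=> //; rewrite big_qHermiteS -IH1 -IH2 mul0r subr0.
by [].
Qed.

(** The recursion in the normalization h_k / (r^k sqrt [k]!) has coefficients
    with limits x sqrt(1-q) / r and 1 / r^2, also when q = 1; on the support
    x^2 (1-q) <= 4, so its solutions are bounded. *)
Lemma big_qHermite_growth q a x r : -1 < q <= 1 -> x \in qsupp q -> 1 < r ->
  exists2 C, 0 <= C &
  forall n, `|big_qHermite q a n x| <= C * (r ^+ n * Num.sqrt (qfact q n)).
Proof.
move=> hq; have /andP[q1 q2] := hq; rewrite in_qsupp// => xS r1.
have r0 : 0 < r by rewrite (lt_trans ltr01).
pose w n := r ^+ n * Num.sqrt (qfact q n).
have w0 n : 0 < w n by rewrite mulr_gt0 ?exprn_gt0// sqrtr_gt0 qfact_gt0.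
have wS n : w n.+1 = w n * (r * Num.sqrt (qint q n.+1)).
  rewrite /w qfactS sqrtrM ?ltW ?qfact_gt0// exprSr; ring.
pose u n := big_qHermite q a n x / w n.
pose al n := (x - a * q ^+ n.+1) * Num.sqrt (qint q n.+2)^-1 / r.
pose be n := Num.sqrt (qint q n.+1 / qint q n.+2) / r ^+ 2.
have alA : al @ \oo --> x * Num.sqrt (1 - q) / r.
  apply: cvgMr_tmp.
  have sq : (fun n => Num.sqrt (qint q n.+2)^-1) @ \oo --> Num.sqrt (1 - q).
    rewrite (@cvg_shiftS _ (fun n => Num.sqrt (qint q n.+1)^-1)).
    exact: cvg_sqrt_qint_inv.
  have [q_1|qN1] := eqVneq q 1.
    apply: (@cvg_lim_eq _ ((x - a) * Num.sqrt (1 - q))).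
      by rewrite q_1 subrr sqrtr0 !mulr0.
    apply: cvgM => //; rewrite q_1.
    by under eq_fun do rewrite expr1n mulr1; exact: cvg_cst.
  apply: cvgM => //; apply: (@cvg_lim_eq _ (x - a * 0)).
    by rewrite mulr0 subr0.
  apply: cvgB; first exact: cvg_cst.
  by apply: cvgMl_tmp; apply: cvg_qpowS => //; rewrite lt_neqAle qN1.
have beb : be @ \oo --> (r ^+ 2)^-1.
  apply: (cvg_lim_eq (mul1r _)); apply: cvgMr_tmp; rewrite -sqrtr1.
  apply: continuous_cvg; first exact: sqrt_continuous.
  rewrite (@cvg_shiftS _ (fun n => qint q n / qint q n.+1)).
  exact: cvg_qint_ratio.
have b01 : 0 < (r ^+ 2)^-1 < 1.
  by rewrite invr_gt0 exprn_gt0//= invf_lt1 ?exprn_gt0// exprn_egt1.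
have Ab : (x * Num.sqrt (1 - q) / r) ^+ 2 <= 4 * (r ^+ 2)^-1.
  rewrite exprMn exprVn ler_wpM2r ?invr_ge0 ?exprn_ge0 ?(ltW r0)//.
  by rewrite exprMn sqr_sqrtr ?subr_ge0// mulrC.
have uE n : u n.+2 = al n * u n.+1 - be n * u n.
  rewrite /u /al /be big_qHermiteS !wS.
  have s1 := qint_gt0 n hq; have s2 := qint_gt0 n.+1 hq.
  rewrite sqrtrM ?ltW// !sqrtrV ?ltW//.
  set s := Num.sqrt (qint q n.+2); set t := Num.sqrt (qint q n.+1).
  have s0 : s != 0 by rewrite gt_eqF// sqrtr_gt0.
  have t0 : t != 0 by rewrite gt_eqF// sqrtr_gt0.
  have w'0 : w n != 0 by rewrite gt_eqF.
  have r'0 : r != 0 by rewrite gt_eqF.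
  have -> : qint q n.+1 = t * t by rewrite -expr2 sqr_sqrtr// ltW.
  by field; rewrite w'0 r'0 s0 t0.
have [C C0 HC] := recursion_bounded alA beb b01 Ab uE.
exists C => // n; have := HC n; rewrite /u normf_div (gtr0_norm (w0 n)).
by rewrite ler_pdivrMr.
Qed.

Lemma qHermite_growth q x r : -1 < q <= 1 -> x \in qsupp q -> 1 < r ->
  exists2 C, 0 <= C &
  forall n, `|qHermite q n x| <= C * (r ^+ n * Num.sqrt (qfact q n)).
Proof.
move=> hq xS r1; have [C C0 HC] := big_qHermite_growth 0 hq xS r1.
by exists C => // n; rewrite qHermiteE.
Qed.

End Growth.

Arguments qHermite : simpl never.
Arguments big_qHermite : simpl never.

(** * Real series *)

Section Series.
Context {R : realType}.
Implicit Types (u v : nat -> R) (c : R).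

(** Absolute convergence of a real series. *)
Definition abs_cvg u := cvgn (series (fun n => `|u n|)).

Lemma abs_cvg_cvg u : abs_cvg u -> cvgn (series u).
Proof. exact: normed_cvg. Qed.

Lemma abs_cvg_le u v : (forall n, `|u n| <= v n) -> cvgn (series v) -> abs_cvg u.
Proof.
move=> uv; apply: series_le_cvg => n //; exact: le_trans (uv n).
Qed.

Lemma abs_cvgZ c u : abs_cvg u -> abs_cvg (fun n => c * u n).
Proof.
move=> cu; rewrite /abs_cvg; under eq_fun do rewrite normrM.
exact: (is_cvg_seriesZ cu).
Qed.

Lemma seriesDE u v : series (fun n => u n + v n) = series u + series v.
Proof. exact: (seriesD u v). Qed.

Lemma seriesZE c u : series (fun n => c * u n) = c *: series u.
Proof. exact: (seriesZ u c). Qed.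

Lemma lim_seriesDE u v : cvgn (series u) -> cvgn (series v) ->
  limn (series (fun n => u n + v n)) = limn (series u) + limn (series v).
Proof. exact: lim_seriesD. Qed.

Lemma lim_seriesZE c u : cvgn (series u) ->
  limn (series (fun n => c * u n)) = c * limn (series u).
Proof. exact: lim_seriesZ. Qed.

Lemma seriesSl u n : series u n.+1 = u 0%N + series (fun k => u k.+1) n.
Proof. by rewrite /series /= big_nat_recl. Qed.

Lemma cvg_series_shift u : cvgn (series (fun n => u n.+1)) -> cvgn (series u).
Proof.
move=> cu; apply/cvg_ex; exists (u 0%N + limn (series (fun n => u n.+1))).
rewrite -(@cvg_shiftS _ (series u)).
rewrite (_ : (fun n => _) = (fun n => u 0%N + series (fun k => u k.+1) n)).
  by apply: cvgD => //; exact: cvg_cst.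
by apply/funext => n; rewrite seriesSl.
Qed.

Lemma cvg_series_shiftV u : cvgn (series u) -> cvgn (series (fun n => u n.+1)).
Proof.
move=> cu; apply/cvg_ex; exists (limn (series u) - u 0%N).
rewrite (_ : series _ = (fun n => series u n.+1 - u 0%N)).
  apply: cvgB; last exact: cvg_cst.
  by rewrite (@cvg_shiftS _ (series u)).
by apply/funext => n; rewrite seriesSl addrC addKr.
Qed.

Lemma lim_series_shift u : cvgn (series u) ->
  limn (series u) = u 0%N + limn (series (fun n => u n.+1)).
Proof.
move=> cu; apply: cvg_lim => //.
rewrite -(@cvg_shiftS _ (series u)).
rewrite (_ : (fun n => _) = (fun n => u 0%N + series (fun k => u k.+1) n)).
  by apply: cvgD; [exact: cvg_cst|exact: cvg_series_shiftV].
by apply/funext => n; rewrite seriesSl.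
Qed.

Lemma lim_series_norm_le u : abs_cvg u ->
  `|limn (series u)| <= limn (series (fun n => `|u n|)).
Proof. by move=> cu; exact: lim_series_norm. Qed.

Lemma series_le_lim u n : (forall k, 0 <= u k) -> cvgn (series u) ->
  series u n <= limn (series u).
Proof. by move=> u0 cu; apply: nondecreasing_cvgn_le => //; exact: nondecreasing_series. Qed.

(** The ratio test, for ratios c n defined also where u n vanishes. *)
Lemma ratio_test u (c : nat -> R) (l : R) : (forall n, 0 <= u n) ->
  (forall n, u n.+1 = c n * u n) -> c @ \oo --> l -> l < 1 -> cvgn (series u).
Proof.
move=> u0 uS cl l1; pose k := Num.max (1 / 2) ((l + 1) / 2).
have k0 : 0 < k by rewrite lt_max; apply/orP; left; lra.
have k1 : k < 1 by rewrite gt_max; apply/andP; split; lra.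
have lk : l < k by rewrite lt_max; apply/orP; right; lra.
have [N _ HN] : \forall n \near \oo, c n < k by exact: (cvgr_lt l cl).
have uk n : 0 <= u n / k ^+ n by rewrite divr_ge0// exprn_ge0// ltW.
pose C := \sum_(n < N.+1) u n / k ^+ n.
have C0 : 0 <= C by apply: sumr_ge0.
have uC n : u n <= C * k ^+ n.
  have small m : (m <= N)%N -> u m <= C * k ^+ m.
    rewrite -ltnS => mN; rewrite -ler_pdivrMr ?exprn_gt0//.
    by rewrite /C (bigD1 (Ordinal mN))//= lerDl sumr_ge0.
  elim: n => [|n IH]; first exact: small.
  have [|Nn] := leqP n.+1 N; first exact: small.
  rewrite uS exprS mulrCA; apply: le_trans (_ : k * u n <= _).
    by rewrite ler_wpM2r// ltW// HN.
  by rewrite ler_wpM2l// ltW.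
apply: (@series_le_cvg _ _ (geometric C k)) => //.
  by move=> n; rewrite mulr_ge0// exprn_ge0// ltW.
by apply: is_cvg_geometric_series; rewrite gtr0_norm.
Qed.

(** A power series with absolutely summable coefficients u, evaluated at t n,
    tends to its constant term when t n tends to 0. *)
Lemma pow_series_cvg0 u (t : nat -> R) : abs_cvg u -> t @ \oo --> 0 ->
  (\forall n \near \oo, `|t n| <= 1) ->
  (fun n => limn (series (fun k => t n ^+ k * u k))) @ \oo --> u 0%N.
Proof.
move=> cu t0 t1.
pose M := limn (series (fun k => `|u k.+1|)).
have cu1 : cvgn (series (fun k => `|u k.+1|)).
  exact: (@cvg_series_shiftV (fun k => `|u k|)).
have bnd n : `|t n| <= 1 ->
    `|limn (series (fun k => t n ^+ k * u k)) - u 0%N| <= `|t n| * M.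
  move=> tn.
  have ca : abs_cvg (fun k => t n ^+ k * u k).
    apply: abs_cvg_le cu => k; rewrite normrM normrX ler_piMl//.
    by rewrite exprn_ile1.
  have cb : abs_cvg (fun k => t n ^+ k * u k.+1).
    apply: abs_cvg_le cu1 => k; rewrite normrM normrX ler_piMl//.
    by rewrite exprn_ile1.
  rewrite lim_series_shift; last exact: abs_cvg_cvg.
  rewrite expr0 mul1r addrC addKr.
  under eq_fun do rewrite exprS -mulrA.
  rewrite lim_seriesZE; last exact: abs_cvg_cvg.
  rewrite normrM ler_wpM2l//; apply: le_trans (lim_series_norm_le cb) _.
  apply: lim_series_le => // k; rewrite normrM normrX ler_piMl//.
  by rewrite exprn_ile1.
have tM : (fun n => `|t n| * M) @ \oo --> 0.
  apply: (@cvg_lim_eq _ _ (`|0| * M)); first by rewrite normr0 mul0r.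
  by apply: cvgMr_tmp; exact: cvg_norm.
apply/subr_cvg0; apply: (@squeeze_cvgr _ _ _ _ (fun n => - (`|t n| * M)) (fun n => `|t n| * M)) => //.
  near=> n; rewrite -ler_norml bnd//; near: n; exact: t1.
by apply: (cvg_lim_eq (oppr0 _)); exact: cvgN.
Unshelve. all: by end_near. Qed.

End Series.

(** * The bivariate series gamma and their recurrences *)

Section Gamma.
Context {R : realType}.
Implicit Types (q rho x y r : R) (n k i j : nat).

Lemma qHermite0 q x : qHermite q 0 x = 1. Proof. by []. Qed.

Lemma qHermite1 q x : qHermite q 1 x = x.
Proof. by rewrite qHermiteE big_qHermite1 subr0. Qed.

Lemma qHermiteS q n x :
  qHermite q n.+1 x = x * qHermite q n x - qint q n * qHermite q n.-1 x.
Proof.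
case: n => [|n]; first by rewrite qHermite1 qint0 mul0r subr0 mulr1.
by rewrite !qHermiteE big_qHermiteS mul0r subr0.
Qed.

Lemma cvg_qint_ratio_addn q i : -1 < q <= 1 ->
  (fun n => qint q (n + i).+1 / qint q n.+1) @ \oo --> (1 : R).
Proof.
move=> hq; elim: i => [|i IH].
  apply: (@cvg_lim_eq _ _ 1) => //.
  rewrite (_ : (fun n => _) = cst 1); first exact: cvg_cst.
  by apply/funext => n; rewrite addn0 divff// gt_eqF// qint_gt0.
apply: (@cvg_lim_eq _ _ (1^-1 * 1)); first by rewrite invr1 mulr1.
rewrite (_ : (fun n => _) = (fun n => (qint q (n + i).+1 / qint q (n + i).+2)^-1
   * (qint q (n + i).+1 / qint q n.+1))).
  apply: cvgM => //; apply: cvgV; first exact: oner_neq0.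
  rewrite (@cvg_shiftn i _ (fun n => qint q n.+1 / qint q n.+2)).
  rewrite (@cvg_shiftS _ (fun n => qint q n / qint q n.+1)).
  exact: cvg_qint_ratio.
apply/funext => n; rewrite addnS; field.
by rewrite !gt_eqF// qint_gt0.
Qed.

Lemma exists_radius (c : R) : 0 <= c -> c < 1 -> exists2 r, 1 < r & c * r ^+ 2 < 1.
Proof.
move=> c0 c1; exists ((3 - c) / 2); first by lra.
rewrite -subr_gt0 (_ : _ - _ = (1 - c) ^+ 2 * (4 - c) / 4); last by field.
by rewrite divr_gt0// mulr_gt0 ?exprn_gt0//; lra.
Qed.

(** The majorant for gamma_(i,j): c = |rho| r^2 with r > 1 comes from the
    pointwise growth of the q-Hermite polynomials, c = |rho| from their L2
    norms. *)
Lemma gamma_majorant_cvg q (c : R) i j : -1 < q <= 1 -> 0 <= c -> c < 1 ->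
  cvgn (series (fun n => c ^+ n * (Num.sqrt (qfact q (n + i))
     * Num.sqrt (qfact q (n + j))) / qfact q n)).
Proof.
move=> hq c0 c1.
have f0 n : 0 < qfact q n by exact: qfact_gt0.
pose c' n := c * (Num.sqrt (qint q (n + i).+1 / qint q n.+1)
   * Num.sqrt (qint q (n + j).+1 / qint q n.+1)).
apply: (@ratio_test _ _ c' c) => //.
- move=> n; apply: divr_ge0; last exact: ltW.
  by rewrite mulr_ge0 ?exprn_ge0// mulr_ge0 ?sqrtr_ge0.
- move=> n; rewrite /c' !addSn !qfactS exprS.
  have d0 := qint_gt0 n hq.
  rewrite !(sqrtrM _ (ltW (f0 _))) !sqrtrM ?(ltW (qint_gt0 _ hq))// !sqrtrV ?ltW//.
  set s := Num.sqrt (qint q n.+1).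
  have s0 : s != 0 by rewrite gt_eqF// sqrtr_gt0.
  have -> : qint q n.+1 = s * s by rewrite -expr2 sqr_sqrtr// ltW.
  by field; rewrite s0 (qfact_neq0 _ hq).
- apply: (@cvg_lim_eq _ _ (c * (1 * 1))); first by rewrite !mulr1.
  apply: cvgMl_tmp; apply: cvgM; rewrite -[1]sqrtr1; (apply: continuous_cvg;
    [exact: sqrt_continuous|exact: cvg_qint_ratio_addn]).
Qed.

(** The terms of the series gamma_(i,j). *)
Definition gamma_term q rho i j x y n : R :=
  rho ^+ n / qfact q n * qHermite q (n + i) x * qHermite q (n + j) y.

Lemma qgammaE q rho i j x y :
  qgamma q rho i j x y = limn (series (gamma_term q rho i j x y)).
Proof. by []. Qed.

Section Fixed.
Context (q : R) (hq : -1 < q <= 1).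

Let q_le1 : q <= 1. Proof. by case/andP: hq. Qed.
Let fact_neq0 n : qfact q n != 0. Proof. exact: qfact_neq0. Qed.

Lemma gamma_abs_cvg rho i j x y : `|rho| < 1 ->
  x \in qsupp q -> y \in qsupp q -> abs_cvg (gamma_term q rho i j x y).
Proof.
move=> hr xS yS; have [r r1 hrr] := exists_radius (normr_ge0 rho) hr.
have [C C0 HC] := qHermite_growth hq xS r1.
have [D D0 HD] := qHermite_growth hq yS r1.
have r0 : 0 < r by rewrite (lt_trans ltr01).
apply: (@abs_cvg_le _ _ (fun n => (C * D * r ^+ i * r ^+ j) *
  ((`|rho| * r ^+ 2) ^+ n * (Num.sqrt (qfact q (n + i))
     * Num.sqrt (qfact q (n + j))) / qfact q n))); last first.
  rewrite seriesZE; apply: is_cvgZl_tmp; apply: gamma_majorant_cvg => //.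
  by rewrite mulr_ge0// exprn_ge0// ltW.
move=> n; have f0 : 0 < qfact q n by exact: qfact_gt0.
rewrite /gamma_term !normrM normfV normrX (gtr0_norm f0).
apply: le_trans (_ : `|rho| ^+ n / qfact q n
    * (C * (r ^+ (n + i) * Num.sqrt (qfact q (n + i))))
    * (D * (r ^+ (n + j) * Num.sqrt (qfact q (n + j)))) <= _).
  have p0 : 0 <= `|rho| ^+ n / qfact q n.
    by rewrite divr_ge0 ?exprn_ge0// ltW.
  apply: ler_pM => //; first by rewrite mulr_ge0.
  by rewrite ler_wpM2l.
rewrite le_eqVlt; apply/orP; left; apply/eqP.
by rewrite exprMn !exprD expr2 exprMn; ring.
Qed.

Lemma gamma_cvg rho i j x y : `|rho| < 1 ->
  x \in qsupp q -> y \in qsupp q -> cvgn (series (gamma_term q rho i j x y)).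
Proof. by move=> *; apply: abs_cvg_cvg; exact: gamma_abs_cvg. Qed.

Lemma qgammaC rho i j x y : qgamma q rho i j x y = qgamma q rho j i y x.
Proof.
rewrite /qgamma; congr (limn (series _)); apply/funext => n.
by rewrite mulrAC.
Qed.

(** As [n] / [n]! = 1 / [n-1]!, the factor [n] shifts both indices by one. *)
Lemma gamma_shift rho i j x y : `|rho| < 1 ->
  x \in qsupp q -> y \in qsupp q ->
  series (fun n => qint q n * gamma_term q rho i j x y n) @ \oo
    --> rho * qgamma q rho i.+1 j.+1 x y.
Proof.
move=> hr xS yS; set u := (fun n => _).
have uS : (fun n => u n.+1) = (fun n => rho * gamma_term q rho i.+1 j.+1 x y n).
  apply/funext => n; rewrite /u /gamma_term !addSnnS exprS qfactS.
  have := qint_gt0 n hq => /lt0r_neq0 ?; field.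
  by apply/andP.
have cu : cvgn (series u).
  apply: cvg_series_shift; rewrite uS seriesZE; apply: is_cvgZl_tmp.
  exact: gamma_cvg.
suff <- : limn (series u) = rho * qgamma q rho i.+1 j.+1 x y by [].
rewrite lim_series_shift// uS lim_seriesZE; last exact: gamma_cvg.
by rewrite /u qint0 mul0r add0r.
Qed.

(** The recurrence of H_(n+i)(x), with [n+i] split as [i] + q^i [n]. *)
Lemma gamma_recl rho i j x y : `|rho| < 1 ->
  x \in qsupp q -> y \in qsupp q ->
  qgamma q rho i.+1 j x y = x * qgamma q rho i j x y
    - qint q i * qgamma q rho i.-1 j x y
    - q ^+ i * rho * qgamma q rho i j.+1 x y.
Proof.
move=> hr xS yS; rewrite {1}/qgamma; apply: cvg_lim => //.
pose v n := qint q n * (rho ^+ n / qfact q n * qHermite q (n + i).-1 x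
  * qHermite q (n + j) y).
have vc : series v @ \oo --> rho * qgamma q rho i j.+1 x y.
  have vS : (fun n => v n.+1) = (fun n => rho * gamma_term q rho i j.+1 x y n).
    apply/funext => n; rewrite /v /gamma_term addSn addSnnS exprS qfactS.
    have := qint_gt0 n hq => /lt0r_neq0 ?; field.
    by apply/andP.
  have cv : cvgn (series v).
    apply: cvg_series_shift; rewrite vS seriesZE; apply: is_cvgZl_tmp.
    exact: gamma_cvg.
  suff <- : limn (series v) = rho * qgamma q rho i j.+1 x y by [].
  rewrite lim_series_shift// vS lim_seriesZE; last exact: gamma_cvg.
  by rewrite /v qint0 mul0r add0r.
have e n : gamma_term q rho i.+1 j x y n = x * gamma_term q rho i j x y n
   + ((- qint q i) * gamma_term q rho i.-1 j x y n + (- q ^+ i) * v n).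
  rewrite /gamma_term /v addnS qHermiteS addnC qintD.
  case: i {vc v} => [|i]; first by rewrite qint0 addn0 /= expr0; ring.
  by rewrite addSn /= [(i + n)%N]addnC; ring.
rewrite (_ : series _ = series (fun n => x * gamma_term q rho i j x y n
   + ((- qint q i) * gamma_term q rho i.-1 j x y n + (- q ^+ i) * v n))); last first.
  by congr series; apply/funext.
rewrite !seriesDE !seriesZE.
apply: (@cvg_lim_eq _ _ (x * qgamma q rho i j x y
   + ((- qint q i) * qgamma q rho i.-1 j x y
      + (- q ^+ i) * (rho * qgamma q rho i j.+1 x y)))); first by ring.
apply: cvgD; first by apply: cvgZl_tmp; exact: gamma_cvg.
apply: cvgD; last exact: cvgZl_tmp.
by apply: cvgZl_tmp; exact: gamma_cvg.
Qed.

Lemma gamma_recr rho i j x y : `|rho| < 1 ->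
  x \in qsupp q -> y \in qsupp q ->
  qgamma q rho i j.+1 x y = y * qgamma q rho i j x y
    - qint q j * qgamma q rho i j.-1 x y
    - q ^+ j * rho * qgamma q rho i.+1 j x y.
Proof. by move=> hr xS yS; rewrite qgammaC gamma_recl// !(qgammaC rho _ i) (qgammaC rho _ i.+1). Qed.

(** From q^n = 1 - (1 - q) [n]. *)
Lemma gamma_qscale rho i j x y : `|rho| < 1 ->
  x \in qsupp q -> y \in qsupp q ->
  qgamma q (rho * q) i j x y
  = qgamma q rho i j x y - (1 - q) * rho * qgamma q rho i.+1 j.+1 x y.
Proof.
move=> hr xS yS; apply: cvg_lim => //.
rewrite (_ : series _ = series (fun n => gamma_term q rho i j x y n
   + (- (1 - q)) * (qint q n * gamma_term q rho i j x y n))).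
  rewrite seriesDE seriesZE -mulrA -mulNr.
  apply: cvgD; first exact: gamma_cvg.
  by apply: cvgZl_tmp; exact: gamma_shift.
congr series; apply/funext => n.
rewrite mulrA mulNr qint_geom mulNr /gamma_term exprMn; ring.
Qed.

End Fixed.
End Gamma.

(** * The polynomial quotients, and gamma_00 in product form for |q| < 1 *)

Section InfiniteProducts.
Context {R : realType}.
Implicit Types (u : nat -> R) (a q : R).

Lemma norm_prod1D_le u (v : nat -> R) n : (forall j, `|u j| <= v j) ->
  cvgn (series v) -> `|\prod_(j < n) (1 + u j)| <= expR (limn (series v)).
Proof.
move=> uv cv; apply: (@le_trans _ _ (expR (series v n))).
  rewrite /series /= big_mkord expR_sum normr_prod.
  apply: ler_prod => i _; rewrite normr_ge0/=.
  apply: le_trans (ler_normD _ _) _; rewrite normr1.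
  by apply: le_trans (expR_ge1Dx _); rewrite lerD2l.
by rewrite ler_expR series_le_lim// => j; exact: le_trans (uv j).
Qed.

Lemma infinite_product_cvg u : abs_cvg u ->
  cvgn (fun n => \prod_(j < n) (1 + u j)).
Proof.
move=> cu; set P := (fun n => _); pose K := expR (limn (series (fun n => `|u n|))).
have PK n : `|P n| <= K by exact: norm_prod1D_le.
(* The partial products are the partial sums of the series of P k * u k. *)
have PE : P = (fun n => 1 + series (fun k => P k * u k) n).
  apply/funext; elim=> [|n IH]; first by rewrite /P /series /= big_ord0 big_nil addr0.
  by rewrite seriesSr addrA -IH {1}/P big_ord_recr /= -/(P n) mulrDr mulr1.
rewrite PE; apply: is_cvgD; first exact: is_cvg_cst.
apply: abs_cvg_cvg; apply: (@abs_cvg_le _ _ (fun n => K * `|u n|)).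
  by move=> n; rewrite normrM ler_wpM2r.
by rewrite seriesZE; exact: is_cvgZl_tmp.
Qed.

(** The inverse factors are again of the form 1 + v j with v absolutely
    summable, so the product has an inverse. *)
Lemma infinite_product_neq0 u : abs_cvg u -> (forall n, 1 + u n != 0) ->
  limn (fun n => \prod_(j < n) (1 + u j)) != 0.
Proof.
move=> cu u0; pose v n := - u n / (1 + u n).
have u_0 : u @ \oo --> 0 by apply: cvg_series_cvg_0; exact: abs_cvg_cvg.
have : (fun n => (1 + u n)^-1) @ \oo --> ((1 + 0)^-1 : R).
  apply: cvgV; first by rewrite addr0 oner_neq0.
  by apply: cvgD => //; exact: cvg_cst.
move=> /cvgP /cvg_seq_bounded [M [_ HM]].
have [M1 M1b] : exists M1, forall n, `|(1 + u n)^-1| <= M1.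
  by exists (M + 1) => n; apply: (HM (M + 1)) => //; rewrite ltrDl.
have cv : abs_cvg v.
  apply: (@abs_cvg_le _ _ (fun n => M1 * `|u n|)).
    by move=> n; rewrite /v normrM normrN mulrC ler_wpM2r.
  by rewrite seriesZE; exact: is_cvgZl_tmp.
have cP := infinite_product_cvg cu; have cQ := infinite_product_cvg cv.
apply/eqP => P0.
have : (fun n => \prod_(j < n) (1 + u j) * \prod_(j < n) (1 + v j)) @ \oo
    --> 0 * limn (fun n => \prod_(j < n) (1 + v j)).
  by rewrite -P0; exact: cvgM.
rewrite (_ : (fun n => _) = cst 1); last first.
  apply/funext => n; rewrite -big_split /=; apply: big1 => i _.
  by rewrite /v; field.
move=> /(cvg_lim (@Rhausdorff R)); rewrite lim_cst// mul0r => /eqP.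
by rewrite oner_eq0.
Qed.

Lemma qpow_abs_cvg a q : `|q| < 1 -> abs_cvg (fun j => - (a * q ^+ j)).
Proof.
move=> q1; apply: (@abs_cvg_le _ _ (geometric `|a| `|q|)).
  by move=> n; rewrite normrN normrM normrX.
by apply: is_cvg_geometric_series; rewrite normr_id.
Qed.

Lemma qpoch_cvg a q : `|q| < 1 -> qpoch a q @ \oo --> qpoch_oo a q.
Proof. by move=> q1; exact: infinite_product_cvg (@qpow_abs_cvg a q q1). Qed.

Lemma qpoch_factor_neq0 a q n : `|q| <= 1 -> `|a| < 1 -> 1 - a * q ^+ n != 0.
Proof.
move=> q1 a1; rewrite subr_eq0; apply/eqP => e.
have : `|a * q ^+ n| < 1.
  rewrite normrM normrX; apply: le_lt_trans a1.
  by rewrite ler_piMr// exprn_ile1.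
by rewrite -e normr1 ltxx.
Qed.

Lemma qpoch_oo_neq0 a q : `|q| < 1 -> `|a| < 1 -> qpoch_oo a q != 0.
Proof.
move=> q1 a1; apply: (infinite_product_neq0 (@qpow_abs_cvg a q q1)) => n.
by apply: qpoch_factor_neq0 => //; exact: ltW.
Qed.

Lemma qpoch0 a q : qpoch a q 0 = 1. Proof. by rewrite /qpoch big_ord0. Qed.

Lemma qpochS a q n : qpoch a q n.+1 = qpoch a q n * (1 - a * q ^+ n).
Proof. by rewrite /qpoch big_ord_recr. Qed.

Lemma qpoch_neq0 a q n : `|q| <= 1 -> `|a| < 1 -> qpoch a q n != 0.
Proof.
by move=> q1 a1; apply/prodf_neq0 => i _; exact: qpoch_factor_neq0.
Qed.

End InfiniteProducts.

Section QuotientPolynomials.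
Context {R : realType}.
Implicit Types (q rho x y : R) (n k i j : nat).

(** The polynomials Q_(i,0), which are the Al-Salam--Chihara polynomials divided
    by (rho^2; q)_i; x is the outer variable and y the inner one. *)
Fixpoint Qbase q rho i : {poly {poly R}} :=
  if i is n.+1 then
    (((1 - q ^+ n * rho ^+ 2)^-1)%:P%:P) *
     (('X - (q ^+ n * rho)%:P%:P * 'X%:P) * Qbase q rho n
      - (qint q n)%:P%:P * (if n is m.+1 then Qbase q rho m else 0))
  else 1.

(** The polynomials Q_(i,j), with j before i because the recursion is on j; it
    raises i. *)
Fixpoint Qrec q rho j i : {poly {poly R}} :=
  if j is n.+1 then
    'X%:P * Qrec q rho n i
    - (qint q n)%:P%:P * (if n is m.+1 then Qrec q rho m i else 0)
    - (q ^+ n * rho)%:P%:P * Qrec q rho n i.+1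
  else Qbase q rho i.

Arguments Qbase : simpl never.
Arguments Qrec : simpl never.

(** The value of Qrec q rho j i at (x, y). *)
Definition Qfun q rho i j x y : R := (Qrec q rho j i).[x%:P].[y].

Let hE := (hornerM, hornerD, hornerN, hornerC, hornerX).

Lemma Qfun00 q rho x y : Qfun q rho 0 0 x y = 1.
Proof. by rewrite /Qfun /Qrec /Qbase !hornerC. Qed.

Lemma QfunSr q rho i j x y : Qfun q rho i j.+1 x y =
  y * Qfun q rho i j x y - qint q j * Qfun q rho i j.-1 x y
  - q ^+ j * rho * Qfun q rho i.+1 j x y.
Proof.
rewrite /Qfun [Qrec q rho j.+1 i]/Qrec -/(@Qrec).
case: j => [|j] /=; rewrite !hE //.
by rewrite qint0 !mul0r.
Qed.

Lemma QfunS0 q rho i x y : 1 - q ^+ i * rho ^+ 2 != 0 ->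
  (1 - q ^+ i * rho ^+ 2) * Qfun q rho i.+1 0 x y =
  (x - q ^+ i * rho * y) * Qfun q rho i 0 x y
  - qint q i * Qfun q rho i.-1 0 x y.
Proof.
move=> d0; rewrite /Qfun /Qrec [Qbase q rho i.+1]/Qbase -/(@Qbase).
case: i d0 => [|i] d0 /=; rewrite !hE mulVKf//.
by rewrite qint0 !mul0r.
Qed.

Lemma one_sub_qrho_neq0 q rho n : -1 < q <= 1 -> `|rho| < 1 ->
  1 - q ^+ n * rho ^+ 2 != 0.
Proof.
move=> /andP[q1 q2] hr; rewrite mulrC; apply: qpoch_factor_neq0.
  by rewrite ler_norml q2 ltW.
by rewrite normrX exprn_ilt1.
Qed.

(** For j = 0 the two recurrences of gamma combine into the recursion defining
    Q_(i,0); the second of them then raises j. *)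
Lemma gamma_Qfun q rho i j x y : -1 < q <= 1 -> `|rho| < 1 ->
  x \in qsupp q -> y \in qsupp q ->
  qgamma q rho i j x y = Qfun q rho i j x y * qgamma q rho 0 0 x y.
Proof.
move=> hq hr xS yS; set g := qgamma q rho 0 0 x y.
have base n : qgamma q rho n 0 x y = Qfun q rho n 0 x y * g /\
    qgamma q rho n.+1 0 x y = Qfun q rho n.+1 0 x y * g.
  have step m : qgamma q rho m 0 x y = Qfun q rho m 0 x y * g ->
      qint q m * qgamma q rho m.-1 0 x y = qint q m * Qfun q rho m.-1 0 x y * g ->
      qgamma q rho m.+1 0 x y = Qfun q rho m.+1 0 x y * g.
    move=> e1 e2; have d0 := one_sub_qrho_neq0 m hq hr.
    apply: (mulfI d0); rewrite [RHS]mulrA QfunS0// [RHS]mulrBl -e2.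
    rewrite (_ : _ * g = (x - q ^+ m * rho * y) * qgamma q rho m 0 x y); last first.
      by rewrite e1 mulrA.
    have := gamma_recl hq m 0 hr xS yS; have := gamma_recr hq m 0 hr xS yS.
    rewrite qint0 mul0r subr0 expr0 mul1r => -> e.
    rewrite mulrBl mul1r {1}e; ring.
  elim: n => [|n [IH1 IH2]].
    rewrite /g Qfun00 mul1r; split=> //; apply: step => //.
      by rewrite Qfun00 mul1r.
    by rewrite qint0 !mul0r.
  by split=> //; apply: step => //; rewrite IH1 mulrA.
suff : (forall i, qgamma q rho i j x y = Qfun q rho i j x y * g) /\
    (forall i, qgamma q rho i j.+1 x y = Qfun q rho i j.+1 x y * g).
  by case.
elim: j {i} => [|j [IH1 IH2]].
  split=> i; first by case: (base i).
  rewrite gamma_recr// QfunSr qint0 !mul0r !subr0.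
  by case: (base i) => -> ->; ring.
split=> // i; rewrite gamma_recr// QfunSr IH1 !IH2; ring.
Qed.

(** The formula for Q_(1,1). It gives the effect on gamma_00 of replacing rho by
    rho q and, for q = 1, a differential equation in rho. *)
Lemma gamma11 q rho x y : -1 < q <= 1 -> `|rho| < 1 ->
  x \in qsupp q -> y \in qsupp q ->
  (1 - rho ^+ 2) * (1 - q * rho ^+ 2) * qgamma q rho 1 1 x y
  = ((x - rho * y) * (y - rho * x) + rho * (1 - rho ^+ 2))
    * qgamma q rho 0 0 x y.
Proof.
move=> hq hr xS yS.
have := gamma_recl hq 0 0 hr xS yS; have := gamma_recr hq 0 0 hr xS yS.
have := gamma_recl hq 0 1 hr xS yS; have := gamma_recr hq 0 1 hr xS yS.
rewrite !qint0 !qint1 !mul0r !subr0 !expr0 !expr1 !mul1r /=.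
set g := qgamma _ _ 0 0 _ _; set g1 := qgamma _ _ 1 0 _ _.
set g2 := qgamma _ _ 0 1 _ _; set g11 := qgamma _ _ 1 1 _ _.
set g02 := qgamma _ _ 0 2 _ _ => e02 e11 e01 e10.
have e2 : (1 - rho ^+ 2) * g2 = (y - rho * x) * g by rewrite mulrBl mul1r {1}e01 e10; ring.
have e : (1 - q * rho ^+ 2) * g11 = (x - rho * y) * g2 + rho * g.
  by rewrite mulrBl mul1r {1}e11 e02; ring.
by rewrite -mulrA e mulrDr mulrCA e2; ring.
Qed.

Lemma omega_qE q rho x y : q <= 1 -> omega_q q rho x y =
  (1 - rho ^+ 2) ^+ 2 - (1 - q) * rho * (1 + rho ^+ 2) * x * y
  + (1 - q) * rho ^+ 2 * (x ^+ 2 + y ^+ 2).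
Proof.
move=> q1; have s0 : Num.sqrt (1 - q) ^+ 2 = 1 - q by rewrite sqr_sqrtr ?subr_ge0.
rewrite /omega_q /omega; move: (Num.sqrt _) s0 => s <-; by field.
Qed.

Lemma gamma00_qscale q rho x y : -1 < q <= 1 -> `|rho| < 1 ->
  x \in qsupp q -> y \in qsupp q ->
  qgamma q (rho * q) 0 0 x y * ((1 - rho ^+ 2) * (1 - q * rho ^+ 2))
  = qgamma q rho 0 0 x y * omega_q q rho x y.
Proof.
move=> hq hr xS yS; have /andP[_ q2] := hq.
rewrite gamma_qscale// omega_qE// mulrBl -[_ * qgamma q rho 1 1 x y * _]mulrA.
by rewrite [qgamma q rho 1 1 x y * _]mulrC gamma11//; ring.
Qed.

Lemma norm_rhoq_lt1 q rho n : -1 < q <= 1 -> `|rho| < 1 -> `|rho * q ^+ n| < 1.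
Proof.
move=> /andP[q1 q2] hr; rewrite normrM normrX; apply: le_lt_trans hr.
by rewrite ler_piMr// exprn_ile1// ler_norml q2 ltW.
Qed.

Lemma gamma00_qscale_iter q rho n x y : -1 < q <= 1 -> `|rho| < 1 ->
  x \in qsupp q -> y \in qsupp q ->
  qgamma q (rho * q ^+ n) 0 0 x y * qpoch (rho ^+ 2) q (2 * n)
  = qgamma q rho 0 0 x y * \prod_(l < n) omega_q q (rho * q ^+ l) x y.
Proof.
move=> hq hr xS yS; elim: n => [|n IH].
  by rewrite muln0 qpoch0 big_ord0 expr0 !mulr1.
rewrite mulnS !qpochS big_ord_recr /= [RHS]mulrA -IH exprSr.
have E := gamma00_qscale hq (norm_rhoq_lt1 n hq hr) xS yS.
rewrite [RHS]mulrAC -E [rho * (_ * q)]mulrA.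
by rewrite exprMn -!exprM [(n * 2)%N]mulnC [q ^+ (2 * n).+1]exprS; ring.
Qed.

Section Mehler.
Context (q rho x y : R) (hq : -1 < q <= 1) (qlt1 : q < 1) (hr : `|rho| < 1).
Context (xS : x \in qsupp q) (yS : y \in qsupp q).

Let nq : `|q| < 1. Proof. by case/andP: hq => q1 _; rewrite ltr_norml q1. Qed.
Let nr2 : `|rho ^+ 2| < 1. Proof. by rewrite normrX exprn_ilt1. Qed.

(** As n grows, gamma_00 at rho q^n tends to its value 1 at rho = 0. *)
Lemma gamma00_qscale_lim :
  (fun n => qgamma q rho 0 0 x y * \prod_(l < n) omega_q q (rho * q ^+ l) x y)
  @ \oo --> qpoch_oo (rho ^+ 2) q.
Proof.
under eq_fun do rewrite -gamma00_qscale_iter//.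
apply: (@cvg_lim_eq _ _ (1 * qpoch_oo (rho ^+ 2) q)); first by rewrite mul1r.
apply: cvgM; last first.
  have : (fun n => (2 * n)%N) @ \oo --> \oo by apply: cvg_mulnl.
  move=> h; apply: (@cvg_comp _ _ _ (fun n => (2 * n)%N) (qpoch (rho ^+ 2) q) _ _ _ h).
  exact: qpoch_cvg.
rewrite (_ : (fun n => _) = (fun n => limn (series
   (fun k => (q ^+ n) ^+ k * gamma_term q rho 0 0 x y k)))).
  apply: (@cvg_lim_eq _ _ (gamma_term q rho 0 0 x y 0)).
    by rewrite /gamma_term qfact0 expr0 !qHermite0 divr1 !mulr1.
  apply: pow_series_cvg0; first exact: gamma_abs_cvg.
    by apply: cvg_expr.
  by near=> n; rewrite normrX exprn_ile1// ltW.
apply/funext => n; congr (limn (series _)); apply/funext => k.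
by rewrite /gamma_term exprMn -!mulrA mulrCA.
Unshelve. all: by end_near. Qed.

Lemma gamma00_neq0_lt1 : qgamma q rho 0 0 x y != 0.
Proof.
apply/eqP => g0; have := gamma00_qscale_lim; rewrite g0.
under eq_fun do rewrite mul0r.
move=> /(cvg_lim (@Rhausdorff R)); rewrite lim_cst// => /esym /eqP.
by rewrite (negbTE (qpoch_oo_neq0 nq nr2)).
Qed.

Lemma q_Mehler : qgamma q rho 0 0 x y =
  qpoch_oo (rho ^+ 2) q
  / limn (fun n => \prod_(j < n) omega_q q (rho * q ^+ j) x y).
Proof.
have g0 := gamma00_neq0_lt1.
have h : (fun n => \prod_(j < n) omega_q q (rho * q ^+ j) x y) @ \oo -->
   (qgamma q rho 0 0 x y)^-1 * qpoch_oo (rho ^+ 2) q.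
  rewrite (_ : (fun n => _) = (fun n => (qgamma q rho 0 0 x y)^-1 *
    (qgamma q rho 0 0 x y * \prod_(l < n) omega_q q (rho * q ^+ l) x y))).
    by apply: cvgMl_tmp; exact: gamma00_qscale_lim.
  by apply/funext => n; rewrite mulKf.
rewrite (cvg_lim (@Rhausdorff R) h) invfM invrK mulrCA mulfV ?mulr1//.
exact: qpoch_oo_neq0.
Qed.

End Mehler.
End QuotientPolynomials.

(** * Mehler's formula for q = 1 *)

Section PointwiseDerivatives.
Context {R : realType}.
Implicit Types (f g : R -> R) (x df dg c : R).

Lemma is_derive_addf f g x df dg : is_derive x (1 : R) f df ->
  is_derive x (1 : R) g dg -> is_derive x (1 : R) (fun z => f z + g z) (df + dg).
Proof. exact: is_deriveD. Qed.

Lemma is_derive_subf f g x df dg : is_derive x (1 : R) f df ->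
  is_derive x (1 : R) g dg -> is_derive x (1 : R) (fun z => f z - g z) (df - dg).
Proof. exact: is_deriveB. Qed.

Lemma is_derive_mulf f g x df dg : is_derive x (1 : R) f df ->
  is_derive x (1 : R) g dg ->
  is_derive x (1 : R) (fun z => f z * g z) (f x * dg + g x * df).
Proof. exact: is_deriveM. Qed.

Lemma is_derive_scalef c f x df : is_derive x (1 : R) f df ->
  is_derive x (1 : R) (fun z => c * f z) (c * df).
Proof. exact: is_deriveZ. Qed.

Lemma is_derive_conv f x df dg : df = dg ->
  is_derive x (1 : R) f df -> is_derive x (1 : R) f dg.
Proof. by move=> ->. Qed.

End PointwiseDerivatives.

Section Mehler1.
Context {R : realType}.
Context (x y : R).

Let S1 (z : R) : z \in qsupp (1 : R).
Proof. by rewrite in_qsupp// subrr mul0r ler0n. Qed.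

Let hq1 : -1 < (1 : R) <= 1. Proof. by rewrite lexx andbT; lra. Qed.

Let c n : R := qHermite 1 n x * qHermite 1 n y / qfact 1 n.

Let cE i (t : R) : (fun k => iter i (@pseries_diffs R) c k * t ^+ k)
  = gamma_term 1 t i i x y.
Proof.
have e k : iter i (@pseries_diffs R) c k =
    qHermite 1 (k + i) x * qHermite 1 (k + i) y / qfact 1 k.
  elim: i k => [|i IH] k; first by rewrite addn0.
  rewrite iterS /pseries_diffs IH addSnnS qfactS qint_at1.
  have := qfact_neq0 k hq1; have : k.+1%:R != 0 :> R by rewrite pnatr_eq0.
  by move=> ? ?; field; apply/andP.
by apply/funext => k; rewrite e /gamma_term; ring.
Qed.

Let g (t : R) : R := limn (pseries c t).

Let gE t : g t = qgamma 1 t 0 0 x y.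
Proof. by rewrite /g /pseries qgammaE -(cE 0). Qed.

(* Differentiating in rho turns gamma_00 into gamma_11. *)
Let g_deriv (t : R) : `|t| < 1 -> is_derive t (1 : R) g (qgamma 1 t 1 1 x y).
Proof.
move=> t1; pose K := (1 + `|t|) / 2.
have nt := normr_ge0 t.
have K0 : 0 <= K by rewrite /K; lra.
have K1 : `|K| < 1 by rewrite ger0_norm// /K; lra.
have tK : `|t| < `|K| by rewrite [ltRHS]ger0_norm// /K; lra.
have cK i : cvgn (pseries (iter i (@pseries_diffs R) c) K).
  by rewrite /pseries cE; exact: gamma_cvg.
have := pseries_snd_diffs (cK 0) (cK 1) (cK 2) tK.
by rewrite /pseries (cE 1).
Qed.

(* The right-hand side of Mehler's formula at rho = t is exp (- G t). *)
Let G (t : R) : R :=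
  2^-1 * ln (1 - t ^+ 2) + (x - t * y) ^+ 2 / (2 * (1 - t ^+ 2)) - x ^+ 2 / 2.

Let G_deriv (t : R) : `|t| < 1 -> is_derive t (1 : R) G
  (- t / (1 - t ^+ 2) + (x - t * y) * (t * x - y) / (1 - t ^+ 2) ^+ 2).
Proof.
move=> t1; have D0 : 0 < 1 - t ^+ 2.
  by rewrite subr_gt0 -real_normK ?num_real// exprn_ilt1.
have dD : is_derive t (1 : R) (fun t : R => 1 - t ^+ 2) (- (2 * t)).
  by apply: is_derive_eq; rewrite /GRing.scale /=; ring.
have dl : is_derive t (1 : R) (fun t : R => ln (1 - t ^+ 2)) ((1 - t ^+ 2)^-1 * - (2 * t)).
  exact: (@is_derive1_comp _ (@ln R) (fun t => 1 - t ^+ 2) t _ _ (is_derive1_ln D0) dD).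
have dn : is_derive t (1 : R) (fun t : R => (x - t * y) ^+ 2) (- (2 * y * (x - t * y))).
  by apply: is_derive_eq; rewrite /GRing.scale /=; ring.
have d2 : is_derive t (1 : R) (fun t : R => 2 * (1 - t ^+ 2)) (2 * - (2 * t)).
  by apply: is_derive_eq; rewrite /GRing.scale /=; ring.
have n20 : 2 * (1 - t ^+ 2) != 0 by rewrite gt_eqF// mulr_gt0.
have di := @is_deriveV _ (fun t : R => 2 * (1 - t ^+ 2)) t _ 1 n20 d2.
have dc : is_derive t (1 : R) (fun=> x ^+ 2 / 2 : R) 0 by exact: is_derive_cst.
apply: is_derive_conv (is_derive_subf (is_derive_addf (is_derive_scalef 2^-1 dl)
  (is_derive_mulf dn di)) dc).
by rewrite /GRing.scale /=; field; rewrite gt_eqF.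
Qed.

Let F (t : R) : R := g t * expR (G t).

Let F_deriv (t : R) : `|t| < 1 -> is_derive t (1 : R) F 0.
Proof.
move=> t1; have D0 : 1 - t ^+ 2 != 0.
  by rewrite gt_eqF// subr_gt0 -real_normK ?num_real// exprn_ilt1.
have de : is_derive t (1 : R) (fun t => expR (G t)) (expR (G t) *
   (- t / (1 - t ^+ 2) + (x - t * y) * (t * x - y) / (1 - t ^+ 2) ^+ 2)).
  exact: (@is_derive1_comp _ (@expR R) G t _ _ (is_derive_expR (G t)) (G_deriv t1)).
apply: is_derive_conv (is_derive_mulf (g_deriv t1) de).
have := gamma11 hq1 t1 (S1 x) (S1 y); rewrite mul1r -gE => e.
have -> : qgamma 1 t 1 1 x y = ((x - t * y) * (y - t * x) + t * (1 - t ^+ 2))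
   * g t / ((1 - t ^+ 2) * (1 - t ^+ 2)).
  by rewrite -e mulrAC mulfV ?mul1r// mulf_neq0.
by rewrite /GRing.scale /=; field.
Qed.

Let F_cst (rho : R) : `|rho| < 1 -> F rho = F 0.
Proof.
move=> hr; have [-> //|r0] := eqVneq rho 0.
have key (a b : R) : a < b -> -1 < a -> b < 1 -> F b = F a.
  move=> ab a1 b1.
  have d t : t \in `[a, b] -> is_derive t (1 : R) F 0.
    by rewrite in_itv /= => /andP[? ?]; apply: F_deriv; rewrite ltr_norml; lra.
  have d' t : t \in `]a, b[ -> is_derive t (1 : R) F ((fun=> 0 : R) t).
    by move=> /subset_itv_oo_cc; exact: d.
  have cF : {within `[a, b], continuous F}.
    by apply: derivable_within_continuous => t tab; have [] := d t tab.
  have [z _] := MVT ab d' cF.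
  by rewrite mul0r => /eqP; rewrite subr_eq0 => /eqP.
move: hr; rewrite ltr_norml => /andP[h1 h2].
have [rp|rn] := ltP 0 rho; first by apply: key => //; lra.
by apply/esym; apply: key => //; rewrite lt_neqAle r0.
Qed.

Lemma Mehler_q1 rho : `|rho| < 1 ->
  qgamma 1 rho 0 0 x y = (Num.sqrt (1 - rho ^+ 2))^-1
    * expR (x ^+ 2 / 2 - (x - rho * y) ^+ 2 / (2 * (1 - rho ^+ 2))).
Proof.
move=> hr; have D0 : 0 < 1 - rho ^+ 2.
  by rewrite subr_gt0 -real_normK ?num_real// exprn_ilt1.
have F0 : F 0 = 1.
  rewrite /F /G (_ : _ + _ - _ = 0) ?expR0 ?mulr1; last first.
    by rewrite expr0n subr0 ln1 mul0r subr0 mulr1 mulr0 add0r subrr.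
  rewrite gE qgammaE; apply: (cvg_lim (@Rhausdorff R)).
  rewrite -(@cvg_shiftS _ (series (gamma_term 1 0 0 0 x y))).
  have -> : (fun n => series (gamma_term 1 0 0 0 x y) n.+1) = (fun=> 1).
    apply/funext => n; rewrite seriesSl {1}/gamma_term qfact0 expr0 divr1 !mul1r.
    rewrite /series /= big1 ?qHermite0 ?mulr1 ?addr0// => i _.
    by rewrite /gamma_term expr0n !mul0r.
  exact: cvg_cst.
have := F_cst hr; rewrite F0 /F gE => e.
have -> : qgamma 1 rho 0 0 x y = expR (- G rho).
  have eG : expR (G rho) != 0 by rewrite gt_eqF// expR_gt0.
  by apply: (mulIf eG); rewrite e expRN mulVf.
have -> : (Num.sqrt (1 - rho ^+ 2))^-1 = expR (- (2^-1 * ln (1 - rho ^+ 2))).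
  rewrite expRN; congr (_^-1); rewrite -powR12_sqrt ?ltW// /powR.
  by rewrite gt_eqF.
by rewrite -expRD; congr expR; rewrite /G; ring.
Qed.

Lemma gamma00_neq0_q1 rho : `|rho| < 1 -> qgamma 1 rho 0 0 x y != 0.
Proof.
move=> hr; have D0 : 0 < 1 - rho ^+ 2.
  by rewrite subr_gt0 -real_normK ?num_real// exprn_ilt1.
rewrite Mehler_q1// mulf_neq0//; last by rewrite gt_eqF// expR_gt0.
by rewrite invr_eq0 gt_eqF// sqrtr_gt0.
Qed.

End Mehler1.

(** * The polynomials Q_(i,j) and the density f_2D *)

Section Identification.
Context {R : realType}.
Implicit Types (q rho x y : R) (i j : nat).

Lemma gamma00_neq0 q rho x y : -1 < q <= 1 -> `|rho| < 1 ->
  x \in qsupp q -> y \in qsupp q -> qgamma q rho 0 0 x y != 0.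
Proof.
move=> hq hr xS yS; have [q1|qN1] := eqVneq q 1.
  by rewrite q1; exact: gamma00_neq0_q1.
by apply: gamma00_neq0_lt1 => //; case/andP: hq => _; rewrite lt_neqAle qN1.
Qed.

Lemma invS_in_qsupp q n : -1 < q <= 1 -> (n.+1%:R^-1 : R) \in qsupp q.
Proof.
move=> /andP[q1 q2]; rewrite in_qsupp//.
have n0 : 0 < n.+1%:R^-1 :> R by rewrite invr_gt0 ltr0n.
have n1 : n.+1%:R^-1 <= 1 :> R by rewrite invf_le1 ?ltr0n// ler1n.
move: n0 n1; set z := _^-1 => n0 n1.
have : z ^+ 2 <= 1 by rewrite exprn_ile1// ltW.
have := sqr_ge0 z; nra.
Qed.

(** The support contains the points 1 / (n + 1), so it is infinite. *)
Lemma poly_eq0_qsupp (D : idomainType) (f : R -> D) q (p : {poly D}) :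
  injective f -> -1 < q <= 1 ->
  (forall x, x \in qsupp q -> p.[f x] = 0) -> p = 0.
Proof.
move=> fI hq p0; apply/eqP; apply/negPn/negP => pN0.
pose s := [seq f (k.+1%:R^-1) | k <- iota 0 (size p)].
have sp : all (root p) s.
  by apply/allP => _ /mapP[k _ ->]; rewrite /root p0// invS_in_qsupp.
have us : uniq s.
  rewrite map_inj_uniq ?iota_uniq// => k l /fI /invr_inj /eqP.
  by rewrite eqr_nat eqSS => /eqP.
by have := max_poly_roots pN0 sp us; rewrite size_map size_iota ltnn.
Qed.

Lemma QE q rho i j x y : -1 < q <= 1 -> `|rho| < 1 ->
  Q q rho i j x y = Qfun q rho i j x y.
Proof.
move=> hq hr; rewrite /Q /Qfun /Qpoly.
suff -> : xget 0 [set p | is_Qpoly q rho i j p] = Qrec q rho j i by [].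
apply: xget_unique => [z w zS wS|p pQ]; first exact: gamma_Qfun.
apply/eqP; rewrite -subr_eq0; apply/eqP.
apply: (poly_eq0_qsupp (@polyC_inj R) hq) => z zS.
apply: (poly_eq0_qsupp (@inj_id R) hq) => w wS.
rewrite hornerD hornerN hornerD hornerN.
apply/eqP; rewrite subr_eq0; apply/eqP.
apply: (mulIf (gamma00_neq0 hq hr zS wS)); rewrite -pQ//.
exact: gamma_Qfun.
Qed.

Lemma gamma_Q q rho i j x y : -1 < q <= 1 -> `|rho| < 1 ->
  x \in qsupp q -> y \in qsupp q ->
  qgamma q rho i j x y = Q q rho i j x y * qgamma q rho 0 0 x y.
Proof. by move=> *; rewrite QE//; exact: gamma_Qfun. Qed.

Lemma f_2DE q rho x y : -1 < q <= 1 -> `|rho| < 1 ->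
  x \in qsupp q -> y \in qsupp q ->
  f_2D q rho x y = qgamma q rho 0 0 x y * (f_N q x * f_N q y).
Proof.
move=> hq hr xS yS; rewrite /f_2D /f_CN.
have [q1|qN1] := eqVneq q 1; last first.
  rewrite -q_Mehler//; first by ring.
  by case/andP: hq => _; rewrite lt_neqAle qN1.
rewrite q1 Mehler_q1// /f_N eqxx.
have D0 : 0 < 1 - rho ^+ 2.
  by rewrite subr_gt0 -real_normK ?num_real// exprn_ilt1.
have p0 : 0 <= 2 * pi :> R by rewrite mulr_ge0// pi_ge0.
rewrite sqrtrM// (expRD (x ^+ 2 / 2)) (expRN (x ^+ 2 / 2)).
have e0 : expR (x ^+ 2 / 2) != 0 by rewrite gt_eqF// expR_gt0.
have s0 : Num.sqrt (1 - rho ^+ 2) != 0 by rewrite gt_eqF// sqrtr_gt0.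
have t0 : Num.sqrt (2 * pi) != 0 :> R by rewrite gt_eqF// sqrtr_gt0 mulr_gt0// pi_gt0.
by field; rewrite e0 s0 t0.
Qed.

End Identification.

(** * Changing rho into rho q^m *)

Section PolynomialFunctions.
Context {R : realType}.
Implicit Types (f g : R -> R) (F G : R -> R -> R) (q rho x y : R).

(** Polynomial functions of one variable. *)
Definition polyfun f := exists p : {poly R}, forall x, f x = p.[x].

Lemma polyfun_cst (c : R) : polyfun (fun=> c).
Proof. by exists c%:P => x; rewrite hornerC. Qed.

Lemma polyfun_id : polyfun id.
Proof. by exists 'X => x; rewrite hornerX. Qed.

Lemma polyfunD f g : polyfun f -> polyfun g -> polyfun (fun x => f x + g x).
Proof. by move=> [p Hp] [r Hr]; exists (p + r) => x; rewrite hornerD Hp Hr. Qed.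

Lemma polyfunM f g : polyfun f -> polyfun g -> polyfun (fun x => f x * g x).
Proof. by move=> [p Hp] [r Hr]; exists (p * r) => x; rewrite hornerM Hp Hr. Qed.

(** Functions of two variables that are polynomial in each of them. *)
Definition bipolyfun F := (forall y, polyfun (F^~ y)) /\ (forall x, polyfun (F x)).

Lemma bipolyfun_cst (c : R) : bipolyfun (fun _ _ => c).
Proof. by split=> z; exact: polyfun_cst. Qed.

Lemma bipolyfun_fst : bipolyfun (fun x _ => x).
Proof. by split=> z; [exact: polyfun_id|exact: polyfun_cst]. Qed.

Lemma bipolyfun_snd : bipolyfun (fun _ y => y).
Proof. by split=> z; [exact: polyfun_cst|exact: polyfun_id]. Qed.

Lemma bipolyfunD F G : bipolyfun F -> bipolyfun G ->
  bipolyfun (fun x y => F x y + G x y).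
Proof. by move=> [F1 F2] [G1 G2]; split=> z; exact: polyfunD. Qed.

Lemma bipolyfunM F G : bipolyfun F -> bipolyfun G ->
  bipolyfun (fun x y => F x y * G x y).
Proof. by move=> [F1 F2] [G1 G2]; split=> z; exact: polyfunM. Qed.

Lemma bipolyfun_sum n (F : nat -> R -> R -> R) : (forall k, bipolyfun (F k)) ->
  bipolyfun (fun x y => \sum_(k < n) F k x y).
Proof.
move=> bF; elim: n => [|n IH].
  by under eq2_fun do rewrite big_ord0; exact: bipolyfun_cst.
by under eq2_fun do rewrite big_ord_recr; exact: bipolyfunD.
Qed.

Lemma bipolyfun_prod n (F : nat -> R -> R -> R) : (forall k, bipolyfun (F k)) ->
  bipolyfun (fun x y => \prod_(k < n) F k x y).
Proof.
move=> bF; elim: n => [|n IH].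
  by under eq2_fun do rewrite big_ord0; exact: bipolyfun_cst.
by under eq2_fun do rewrite big_ord_recr; exact: bipolyfunM.
Qed.

Lemma bipolyfun_Q q rho i j : bipolyfun (Q q rho i j).
Proof.
split=> [y|x]; last by exists (Qpoly q rho i j).[x%:P].
exists (map_poly (horner_eval y) (Qpoly q rho i j)) => x.
by rewrite -[in RHS](hornerC x y) -/(horner_eval y x%:P) horner_map.
Qed.

Lemma bipolyfun_omega q rho : q <= 1 -> bipolyfun (omega_q q rho).
Proof.
move=> q1; have -> : omega_q q rho = (fun x y =>
    (1 - rho ^+ 2) ^+ 2 + (- ((1 - q) * rho * (1 + rho ^+ 2))) * (x * y)
    + ((1 - q) * rho ^+ 2) * (x * x + y * y)).
  by apply/funext => x; apply/funext => y; rewrite omega_qE//; ring.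
have c := bipolyfun_cst; have X := bipolyfun_fst; have Y := bipolyfun_snd.
by apply: bipolyfunD; first apply: bipolyfunD => //; apply: bipolyfunM => //;
  [exact: bipolyfunM|apply: bipolyfunD; exact: bipolyfunM].
Qed.

Lemma polyfun_eq_qsupp f g q : -1 < q <= 1 -> polyfun f -> polyfun g ->
  (forall x, x \in qsupp q -> f x = g x) -> f =1 g.
Proof.
move=> hq [p Hp] [r Hr] fg x; apply/eqP; rewrite -subr_eq0 Hp Hr.
rewrite -hornerN -hornerD (_ : p - r = 0) ?horner0//.
apply: (poly_eq0_qsupp (@inj_id R) hq) => z zS.
by rewrite hornerD hornerN -Hp -Hr fg ?subrr.
Qed.

Lemma bipolyfun_eq_qsupp F G q : -1 < q <= 1 -> bipolyfun F -> bipolyfun G ->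
  (forall x y, x \in qsupp q -> y \in qsupp q -> F x y = G x y) ->
  forall x y, F x y = G x y.
Proof.
move=> hq [F1 F2] [G1 G2] FG x y.
apply: (polyfun_eq_qsupp hq (F2 x) (G2 x)) => z zS.
by apply: (polyfun_eq_qsupp hq (F1 z) (G1 z)) => w wS; exact: FG.
Qed.

End PolynomialFunctions.

Section Rescaling.
Context {R : realType}.
Context (q rho : R) (hq : -1 < q <= 1) (hr : `|rho| < 1).
Implicit Types (x y : R) (i j k m n : nat).

Let hrn n : `|rho * q ^+ n| < 1. Proof. exact: norm_rhoq_lt1. Qed.
Let q_le1 : q <= 1. Proof. by case/andP: hq. Qed.

Lemma gamma_qscaleS i j k x y : x \in qsupp q -> y \in qsupp q ->
  qgamma q (rho * q ^+ k.+1) i j x y = qgamma q (rho * q ^+ k) i j x y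
    - (1 - q) * (rho * q ^+ k) * qgamma q (rho * q ^+ k) i.+1 j.+1 x y.
Proof. by move=> xS yS; rewrite exprSr mulrA gamma_qscale. Qed.

(** Iterating gamma_qscale. *)
Lemma gamma_qscale_expand i j m x y : x \in qsupp q -> y \in qsupp q ->
  qgamma q (rho * q ^+ m) i j x y =
  \sum_(k < m.+1) (-1) ^+ k * (q ^+ 'C(k, 2) * gbin q m k)
     * ((1 - q) ^+ k * rho ^+ k * qgamma q rho (i + k) (j + k) x y).
Proof.
move=> xS yS; elim: m i j => [|m IH] i j.
  by rewrite big_ord_recr big_ord0 /= gbin0 !expr0 !addn0 !mulr1 !mul1r add0r.
rewrite gamma_qscaleS// !IH; set g := fun k : nat => (1 - q) ^+ k * rho ^+ k *
  qgamma q rho (i + k) (j + k) x y.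
rewrite [RHS](gbin_sum_recr q m g); congr (_ - _).
rewrite !mulr_sumr; apply: eq_bigr => k _.
by rewrite /g !addSnnS !exprS; ring.
Qed.

(** The inverse of the expansion gamma_qscale_expand. *)
Lemma gamma_qscale_invert i j n x y : x \in qsupp q -> y \in qsupp q ->
  q ^+ 'C(n, 2) * rho ^+ n * (1 - q) ^+ n * qgamma q rho (i + n) (j + n) x y =
  \sum_(k < n.+1) (-1) ^+ k * (q ^+ 'C(n - k, 2) * gbin q n k)
     * qgamma q (rho * q ^+ k) i j x y.
Proof.
move=> xS yS; elim: n i j => [|n IH] i j.
  by rewrite big_ord_recr big_ord0 /= gbin0 !expr0 !addn0 !mulr1 !mul1r add0r.
pose g k := qgamma q (rho * q ^+ k) i j x y.
have step (k : 'I_n.+1) : q ^+ n * (rho * (1 - q)) *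
    qgamma q (rho * q ^+ k) i.+1 j.+1 x y = q ^+ (n - k) * (g k - g k.+1).
  rewrite /g gamma_qscaleS// -{1}(subnK (_ : k <= n)%N) ?exprD; last by rewrite -ltnS.
  by ring.
have w (k : 'I_n.+1) : q ^+ 'C(n - k, 2) * q ^+ (n - k) = q ^+ 'C(n.+1 - k, 2).
  by rewrite -exprD subSn ?binS ?bin1 1?addnC// -ltnS.
rewrite -!addSnnS binS bin1 exprD !exprS.
transitivity (q ^+ n * (rho * (1 - q)) * (q ^+ 'C(n, 2) * rho ^+ n *
  (1 - q) ^+ n * qgamma q rho (i.+1 + n) (j.+1 + n) x y)); first by ring.
rewrite IH mulr_sumr.
transitivity (\sum_(k < n.+1) (-1) ^+ k * (q ^+ 'C(n.+1 - k, 2) * gbin q n k) * g k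
  - \sum_(k < n.+1) (-1) ^+ k * (q ^+ 'C(n.+1 - k, 2) * gbin q n k) * g k.+1).
  rewrite -sumrB; apply: eq_bigr => k _; rewrite -w -mulrBr.
  by rewrite mulrCA step; ring.
transitivity ((-1) ^+ 0 * (q ^+ 'C(n.+1, 2) * 1) * g 0%N + \sum_(k < n.+1)
  ((-1) ^+ k.+1 * (q ^+ 'C(n - k, 2) * gbin q n k.+1) * g k.+1
   + (-1) ^+ k.+1 * (q ^+ 'C(n - k, 2) * (q ^+ (n - k) * gbin q n k)) * g k.+1));
  last first.
  rewrite [RHS]big_ord_recl /= gbin0 subn0; congr (_ + _).
  by apply: eq_bigr => k _; rewrite /bump /= add1n subSS gbinS /g; ring.
rewrite big_split /= addrA; congr (_ + _).
  rewrite [RHS]addrC [in RHS]big_ord_recr /= (gbin_small _ (ltnSn n)) !(mulr0, mul0r) addr0.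
  rewrite [LHS]big_ord_recl /= gbin0 subn0 addrC; congr (_ + _).
by rewrite -sumrN; apply: eq_bigr => k _; rewrite -w exprS; ring.
Qed.

Lemma qpoch_rho2_neq0 n : qpoch (rho ^+ 2) q n != 0.
Proof.
apply: qpoch_neq0; last by rewrite normrX exprn_ilt1.
by case/andP: hq => q1 _; rewrite ler_norml q_le1 ltW.
Qed.

Theorem Q_qscale x y i j m :
  Q q (rho * q ^+ m) i j x y * \prod_(l < m) omega_q q (rho * q ^+ l) x y =
  qpoch (rho ^+ 2) q (2 * m)
    * \sum_(k < m.+1) (-1) ^+ k * qbinom q m k * q ^+ 'C(k, 2)
        * (1 - q) ^+ k * rho ^+ k * Q q rho (i + k) (j + k) x y.
Proof.
move: x y; apply: (bipolyfun_eq_qsupp hq).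
- apply: bipolyfunM; first exact: bipolyfun_Q.
  by apply: (@bipolyfun_prod _ _ (fun l => omega_q q (rho * q ^+ l))) => k; exact: bipolyfun_omega.
- apply: bipolyfunM; first exact: bipolyfun_cst.
  apply: (@bipolyfun_sum _ _ (fun k x y => (-1) ^+ k * qbinom q m k * q ^+ 'C(k, 2)
        * (1 - q) ^+ k * rho ^+ k * Q q rho (i + k) (j + k) x y)) => k.
  by apply: bipolyfunM; [exact: bipolyfun_cst|exact: bipolyfun_Q].
move=> x y xS yS; apply: (mulIf (gamma00_neq0 hq hr xS yS)).
rewrite -mulrA [X in _ * X = _]mulrC -gamma00_qscale_iter// [LHS]mulrA.
rewrite -gamma_Q// gamma_qscale_expand// [LHS]mulrC -mulrA; congr (_ * _).
rewrite mulr_suml; apply: eq_bigr => k _.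
by rewrite (gamma_Q (i + k))// qbinom_gbin//; ring.
Qed.

Theorem prod_omega_expand x y n :
  \prod_(j < n) omega_q q (rho * q ^+ j) x y =
  qpoch (rho ^+ 2) q (2 * n)
    * \sum_(k < n.+1) (-1) ^+ k * qbinom q n k * q ^+ 'C(k, 2)
        * (1 - q) ^+ k * rho ^+ k * Q q rho k k x y.
Proof.
by have := Q_qscale x y 0 0 n; rewrite QE// Qfun00 mul1r.
Qed.

Theorem Q_diag_expand x y n :
  q ^+ 'C(n, 2) * rho ^+ n * (1 - q) ^+ n * Q q rho n n x y =
  \sum_(k < n.+1) (-1) ^+ k * q ^+ 'C(n - k, 2) * qbinom q n k
    * (\prod_(j < k) omega_q q (rho * q ^+ j) x y)
    / qpoch (rho ^+ 2) q (2 * k).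
Proof.
move: x y; apply: (bipolyfun_eq_qsupp hq).
- by apply: bipolyfunM; [exact: bipolyfun_cst|exact: bipolyfun_Q].
- apply: (@bipolyfun_sum _ _ (fun k x y => (-1) ^+ k * q ^+ 'C(n - k, 2)
    * qbinom q n k * (\prod_(j < k) omega_q q (rho * q ^+ j) x y)
    / qpoch (rho ^+ 2) q (2 * k))) => k.
  apply: bipolyfunM; last exact: bipolyfun_cst.
  apply: bipolyfunM; first exact: bipolyfun_cst.
  by apply: (@bipolyfun_prod _ _ (fun l => omega_q q (rho * q ^+ l))) => l; exact: bipolyfun_omega.
move=> x y xS yS; apply: (mulIf (gamma00_neq0 hq hr xS yS)).
rewrite -[LHS]mulrA -gamma_Q// (gamma_qscale_invert 0 0)// mulr_suml.
apply: eq_bigr => k _; rewrite qbinom_gbin//.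
have := gamma00_qscale_iter k hq hr xS yS => /(canRL (mulfK (qpoch_rho2_neq0 _))) ->.
ring.
Qed.

End Rescaling.

(** * Generating function of the Q_(i,j) *)

Section SeriesLimits.
Context {R : realType}.
Implicit Types (u M : nat -> R).

Lemma series_tail_le u M n : (forall k, `|u k| <= M k) -> cvgn (series M) ->
  `|limn (series u) - series u n| <= limn (series M) - series M n.
Proof.
move=> uM cM; have M0 k : 0 <= M k by exact: le_trans (uM k).
have cu : cvgn (series u) by apply: abs_cvg_cvg; exact: abs_cvg_le cM.
have cd : (fun m => `|series u m - series u n|) @ \oo
    --> `|limn (series u) - series u n|.
  by apply: cvg_norm; apply: cvgB => //; exact: cvg_cst.
rewrite -(cvg_lim (@Rhausdorff R) cd); apply: limr_le; first exact: cvgP cd.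
near=> m; have nm : (n <= m)%N by near: m; exists n.
have sub v : series v m - series v n = \sum_(n <= k < m) v k.
  by rewrite sub_series nm.
rewrite sub; apply: le_trans (ler_norm_sum _ _ _) _.
apply: (@le_trans _ _ (\sum_(n <= k < m) M k)); first exact: ler_sum.
by rewrite -sub lerD2r series_le_lim.
Unshelve. all: by end_near. Qed.

(** Tannery's theorem: dominated convergence for series. *)
Lemma series_dominated_cvg (u : nat -> nat -> R) (v : nat -> R) M :
  (forall N k, `|u N k| <= M k) -> cvgn (series M) ->
  (forall k, u ^~ k @ \oo --> v k) ->
  (fun N => limn (series (u N))) @ \oo --> limn (series v).
Proof.
move=> uM cM uv.
have vM k : `|v k| <= M k.
  rewrite -(cvg_lim (@Rhausdorff R) (cvg_norm (uv k))).
  apply: limr_le; first exact: cvgP (cvg_norm (uv k)).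
  by near=> N; exact: uM.
apply/cvgrPdist_lt => e e0; have e3 : 0 < e / 3 by rewrite divr_gt0.
have [K _ HK] : \forall n \near \oo, `|limn (series M) - series M n| < e / 3.
  by move/cvgrPdist_lt : cM; exact.
have {HK} HK : limn (series M) - series M K < e / 3.
  by apply: le_lt_trans (HK K _) => //=; exact: ler_norm.
have cS : (fun N => series (u N) K) @ \oo --> series v K.
  elim: K {HK} => [|K IH].
    rewrite /series /= big_nil; under eq_fun do rewrite big_nil.
    exact: cvg_cst.
  rewrite seriesSr; under eq_fun do rewrite seriesSr.
  exact: cvgD.
near=> N.
have h1 := series_tail_le K (uM N) cM; have h2 := series_tail_le K vM cM.
have h3 : `|series v K - series (u N) K| < e / 3.
  by near: N; move/cvgrPdist_lt : cS; exact.
rewrite (_ : _ - _ = (limn (series v) - series v K)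
  + (series v K - series (u N) K) - (limn (series (u N)) - series (u N) K)); last by ring.
apply: le_lt_trans (ler_normB _ _) _.
have := ler_normD (limn (series v) - series v K) (series v K - series (u N) K).
lra.
Unshelve. all: by end_near. Qed.

Lemma lim_series_sum (u : nat -> nat -> R) N :
  (forall n, cvgn (series (u n))) ->
  cvgn (series (fun k => \sum_(n < N) u n k)) /\
  limn (series (fun k => \sum_(n < N) u n k)) = \sum_(n < N) limn (series (u n)).
Proof.
move=> cu; elim: N => [|N [IH1 IH2]].
  rewrite big_ord0 (_ : (fun k => _) = (fun=> 0)); last first.
    by apply/funext => k; rewrite big_ord0.
  have -> : series (fun=> 0 : R) = (fun=> 0).
    by apply/funext => n; rewrite /series /= big1.
  by split; [exact: is_cvg_cst|exact: (cvg_lim (@Rhausdorff R) (cvg_cst _))].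
rewrite big_ord_recr -IH2 (_ : (fun k => _) =
  (fun k => \sum_(n < N) u n k + u N k)); last first.
  by apply/funext => k; rewrite big_ord_recr.
split; last by rewrite lim_seriesDE.
by rewrite seriesDE; apply: (is_cvgD IH1); exact: cu.
Qed.

End SeriesLimits.

Section GeneratingFunction.
Context {R : realType}.
Implicit Types (q rho x y t s T : R) (n m k : nat).

(** A majorant for t^n H_(n+k)(x) / [n]!, where T slightly exceeds |t|. *)
Lemma phi_majorant_cvg q T k : -1 < q <= 1 -> 0 <= T -> (1 - q) * T ^+ 2 < 1 ->
  cvgn (series (fun n => T ^+ n * Num.sqrt (qfact q (n + k)) / qfact q n)).
Proof.
move=> hq T0 T1; have f0 n : 0 < qfact q n by exact: qfact_gt0.
have q2 : 0 <= 1 - q by rewrite subr_ge0; case/andP: hq.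
pose c' n := T * Num.sqrt (qint q n.+1)^-1
   * Num.sqrt (qint q (n + k).+1 / qint q n.+1).
apply: (@ratio_test _ _ c' (T * Num.sqrt (1 - q) * 1)).
- move=> n; apply: divr_ge0; last exact: ltW.
  by rewrite mulr_ge0 ?exprn_ge0.
- move=> n; rewrite /c' addSn !qfactS exprS.
  have d0 := qint_gt0 n hq.
  rewrite !(sqrtrM _ (ltW (f0 _))) !sqrtrM ?(ltW (qint_gt0 _ hq))// !sqrtrV ?ltW//.
  set z := Num.sqrt (qint q n.+1).
  have z0 : z != 0 by rewrite gt_eqF// sqrtr_gt0.
  have -> : qint q n.+1 = z * z by rewrite -expr2 sqr_sqrtr// ltW.
  by field; rewrite z0 (qfact_neq0 _ hq).
- apply: cvgM; first by apply: cvgMl_tmp; exact: cvg_sqrt_qint_inv.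
  rewrite -sqrtr1; apply: continuous_cvg; first exact: sqrt_continuous.
  exact: cvg_qint_ratio_addn.
- rewrite mulr1 -[ltRHS]sqrtr1 -(ger0_norm T0) -sqrtr_sqr -sqrtrM ?sqr_ge0//.
  by rewrite ltr_sqrt// mulrC.
Qed.

(** The terms of the series that for k = 0 defines phi_H. *)
Definition phi_term q t k x n : R := t ^+ n / qfact q n * qHermite q (n + k) x.

Lemma phi_abs_cvg q t k x : -1 < q <= 1 -> x \in qsupp q ->
  (1 - q) * t ^+ 2 < 1 -> abs_cvg (phi_term q t k x).
Proof.
move=> hq xS t1; have q2 : 0 <= 1 - q by rewrite subr_ge0; case/andP: hq.
have c0 : 0 <= (1 - q) * t ^+ 2 by rewrite mulr_ge0 ?sqr_ge0.
have [r r1 hrr] := exists_radius c0 t1; have r0 : 0 < r by rewrite (lt_trans ltr01).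
have [C C0 HC] := qHermite_growth hq xS r1.
apply: (@abs_cvg_le _ _ (fun n => (C * r ^+ k) *
  ((`|t| * r) ^+ n * Num.sqrt (qfact q (n + k)) / qfact q n))); last first.
  rewrite seriesZE; apply: is_cvgZl_tmp; apply: phi_majorant_cvg => //.
    by rewrite mulr_ge0// ltW.
  by rewrite exprMn real_normK ?num_real// mulrA.
move=> n; have f0 : 0 < qfact q n by exact: qfact_gt0.
rewrite /phi_term !normrM normfV normrX (gtr0_norm f0).
apply: le_trans (_ : `|t| ^+ n / qfact q n
    * (C * (r ^+ (n + k) * Num.sqrt (qfact q (n + k)))) <= _).
  by rewrite ler_wpM2l// divr_ge0 ?exprn_ge0// ltW.
by rewrite le_eqVlt; apply/orP; left; apply/eqP; rewrite exprMn exprD; ring.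
Qed.

(** In k both sides satisfy the recursion of the big q-Hermite polynomials. *)
Lemma phi_big_qHermite q t k x : -1 < q <= 1 -> x \in qsupp q ->
  (1 - q) * t ^+ 2 < 1 ->
  limn (series (phi_term q t k x)) = phi_H q t x * big_qHermite q t k x.
Proof.
move=> hq xS t1; pose G k := limn (series (phi_term q t k x)).
have cG j : cvgn (series (phi_term q t j x)) by apply: abs_cvg_cvg; exact: phi_abs_cvg.
have GS j : G j.+1 = (x - t * q ^+ j) * G j - qint q j * G j.-1.
  pose v n := qint q n * (t ^+ n / qfact q n * qHermite q (n + j).-1 x).
  have vS : (fun n => v n.+1) = (fun n => t * phi_term q t j x n).
    apply/funext => n; rewrite /v /phi_term addSn exprS qfactS.
    have := qint_gt0 n hq => /lt0r_neq0 ?; have ? := qfact_neq0 n hq; field.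
    by apply/andP.
  have cv : cvgn (series v).
    by apply: cvg_series_shift; rewrite vS seriesZE; exact: is_cvgZl_tmp.
  have vE : limn (series v) = t * G j.
    by rewrite lim_series_shift// vS lim_seriesZE// /v qint0 mul0r add0r.
  have e n : phi_term q t j.+1 x n = x * phi_term q t j x n
     + ((- qint q j) * phi_term q t j.-1 x n + (- q ^+ j) * v n).
    rewrite /phi_term /v addnS qHermiteS addnC qintD.
    case: j {v vS cv vE} => [|j]; first by rewrite qint0 addn0 /= expr0; ring.
    by rewrite addSn /= [(j + n)%N]addnC; ring.
  rewrite {1}/G (_ : phi_term q t j.+1 x = (fun n => x * phi_term q t j x n
     + ((- qint q j) * phi_term q t j.-1 x n + (- q ^+ j) * v n))); last exact/funext.
  have cZ (c : R) u : cvgn (series u) -> cvgn (series (fun n => c * u n)).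
    by move=> cu; rewrite seriesZE; exact: is_cvgZl_tmp.
  rewrite lim_seriesDE; [|exact: cZ|by rewrite seriesDE; apply: is_cvgD; exact: cZ].
  rewrite lim_seriesDE; [|exact: cZ|exact: cZ].
  by rewrite !lim_seriesZE// vE /G; ring.
have G0 : G 0%N = phi_H q t x.
  by congr (limn (series _)); apply/funext => n; rewrite /phi_term addn0.
rewrite -/(G k); suff : G k = phi_H q t x * big_qHermite q t k x /\
  G k.+1 = phi_H q t x * big_qHermite q t k.+1 x by case.
elim: k => [|k [IH1 IH2]].
  by rewrite GS G0 big_qHermite0 big_qHermite1 qint0 expr0; split; ring.
by split=> //; rewrite GS big_qHermiteS IH2 /= IH1; ring.
Qed.

Section Bounds.
Context (q : R) (hq : -1 < q <= 1).

Let f0 n : 0 < qfact q n. Proof. exact: qfact_gt0. Qed.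

(** The Gaussian binomial (n+k choose k), written symmetrically. *)
Let cb n k := qfact q (n + k) / (qfact q n * qfact q k).

Let cb_ge0 n k : 0 <= cb n k.
Proof. by rewrite divr_ge0 ?mulr_ge0// ltW. Qed.

Let cbn0 n : cb n 0 = 1.
Proof. by rewrite /cb addn0 qfact0 mulr1 mulfV// gt_eqF. Qed.

Let cbSr n k : cb n k.+1 = cb n k * (qint q (n + k).+1 / qint q k.+1).
Proof.
rewrite /cb addnS !qfactS; field.
by rewrite !gt_eqF// qint_gt0.
Qed.

Let cbSl n k : cb n.+1 k = cb n k * (qint q (n + k).+1 / qint q n.+1).
Proof.
rewrite /cb addSn !qfactS; field.
by rewrite !gt_eqF// qint_gt0.
Qed.

Let cbSS n k : cb n.+1 k.+1 = cb n k.+1 + q ^+ n.+1 * cb n.+1 k.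
Proof.
rewrite !(cbSl n) !cbSr addnS.
have -> : qint q (n + k).+2 = qint q n.+1 + q ^+ n.+1 * qint q k.+1.
  by rewrite -qintD addnS addSn.
by field; rewrite !gt_eqF// qint_gt0.
Qed.

Context (sg : R) (sg0 : 0 <= sg) (sg1 : sg < 1).

(* Phi n = 1 / (sg; q)_(n+1); the recursion PhiS is all that is used. *)
Let Phi n : R := limn (series (fun k => sg ^+ k * cb n k)).

Let Phi_cvg n : cvgn (series (fun k => sg ^+ k * cb n k)).
Proof.
apply: (@ratio_test _ _ (fun k => sg * (qint q (n + k).+1 / qint q k.+1)) (sg * 1)).
- by move=> k; rewrite mulr_ge0 ?exprn_ge0.
- by move=> k; rewrite cbSr exprS; ring.
- apply: cvgMl_tmp; under eq_fun do rewrite addnC; exact: cvg_qint_ratio_addn.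
- by rewrite mulr1.
Qed.

Let den_gt0 n : 0 < 1 - sg * q ^+ n.
Proof.
rewrite subr_gt0; apply: le_lt_trans (ler_norm _) _; rewrite normrM normrX.
rewrite ger0_norm//; apply: le_lt_trans sg1; rewrite ler_piMr// exprn_ile1//.
by case/andP: hq => q1 q2; rewrite ler_norml q2 ltW.
Qed.

Let PhiS n : Phi n.+1 = (1 - sg * q ^+ n.+1)^-1 * Phi n.
Proof.
apply: (mulfI (lt0r_neq0 (den_gt0 n.+1))); rewrite mulVKf ?gt_eqF// mulrBl mul1r.
have cS m : cvgn (series (fun k => sg ^+ k.+1 * cb m k.+1)).
  exact: (@cvg_series_shiftV _ (fun k => sg ^+ k * cb m k)).
rewrite {1}/Phi lim_series_shift// [Phi n]lim_series_shift// !cbn0 -addrA.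
congr (_ + _); apply/eqP; rewrite subr_eq addrC; apply/eqP.
rewrite (_ : (fun k => _) = (fun k => (sg * q ^+ n.+1) * (sg ^+ k * cb n.+1 k)
   + sg ^+ k.+1 * cb n k.+1)); last first.
  by apply/funext => k; rewrite cbSS !exprS; ring.
have cP : cvgn (series (fun k => (sg * q ^+ n.+1) * (sg ^+ k * cb n.+1 k))).
  by rewrite seriesZE; apply: is_cvgZl_tmp; exact: Phi_cvg.
by rewrite lim_seriesDE// lim_seriesZE.
Qed.

Let Phi_ge0 n : 0 <= Phi n.
Proof.
apply: le_trans (series_le_lim 0 _ _) => //.
  by rewrite /series /= big_nil.
by move=> k; rewrite mulr_ge0 ?exprn_ge0.
Qed.

Context (T : R) (T0 : 0 <= T) (T1 : (1 - q) * T ^+ 2 < 1).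

Let a n := T ^+ n / Num.sqrt (qfact q n).

Let a_ge0 n : 0 <= a n. Proof. by rewrite divr_ge0 ?exprn_ge0. Qed.

Let aS n : a n.+1 = (T * Num.sqrt (qint q n.+1)^-1) * a n.
Proof.
rewrite /a qfactS sqrtrM ?ltW// sqrtrV ?qint_ge0// exprS invfM; ring.
Qed.

Let Tq : T * Num.sqrt (1 - q) < 1.
Proof.
rewrite -[ltRHS]sqrtr1 -(ger0_norm T0) -sqrtr_sqr -sqrtrM ?sqr_ge0//.
by rewrite ltr_sqrt// mulrC.
Qed.

Lemma weights_cvg : cvgn (series a).
Proof.
apply: (@ratio_test _ _ (fun n => T * Num.sqrt (qint q n.+1)^-1)
  (T * Num.sqrt (1 - q))) => //.
by apply: cvgMl_tmp; exact: cvg_sqrt_qint_inv.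
Qed.

Let aPhi_cvg : cvgn (series (fun n => a n * Phi n)).
Proof.
apply: (@ratio_test _ _ (fun n => (T * Num.sqrt (qint q n.+1)^-1)
  * (1 - sg * q ^+ n.+1)^-1) (T * Num.sqrt (1 - q))) => //.
- by move=> n; rewrite mulr_ge0.
- by move=> n; rewrite aS PhiS; ring.
have Tc : (fun n => T * Num.sqrt (qint q n.+1)^-1) @ \oo --> T * Num.sqrt (1 - q).
  by apply: cvgMl_tmp; exact: cvg_sqrt_qint_inv.
have [q_1|qN1] := eqVneq q 1.
  apply: (@cvg_lim_eq _ _ ((T * Num.sqrt (1 - q)) * (1 - sg)^-1)).
    by rewrite q_1 subrr sqrtr0 mulr0 mul0r.
  apply: cvgM => //; rewrite q_1; under eq_fun do rewrite expr1n mulr1.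
  exact: cvg_cst.
apply: (@cvg_lim_eq _ _ ((T * Num.sqrt (1 - q)) * (1 - sg * 0)^-1)).
  by rewrite mulr0 subr0 invr1 mulr1.
apply: cvgM => //; apply: cvgV; first by rewrite mulr0 subr0 oner_neq0.
apply: cvgB; first exact: cvg_cst.
apply: cvgMl_tmp; case/andP: hq => q1 q2; apply: cvg_qpowS => //.
by rewrite lt_neqAle qN1.
Qed.

Lemma weights_cb_cvg k : cvgn (series (fun n => a n * cb n k)).
Proof.
apply: (@ratio_test _ _ (fun n => (T * Num.sqrt (qint q n.+1)^-1)
  * (qint q (n + k).+1 / qint q n.+1)) (T * Num.sqrt (1 - q) * 1)).
- by move=> n; rewrite mulr_ge0.
- by move=> n; rewrite aS cbSl; ring.
- apply: cvgM; last exact: cvg_qint_ratio_addn.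
  by apply: cvgMl_tmp; exact: cvg_sqrt_qint_inv.
- by rewrite mulr1.
Qed.

Let psi k : R := limn (series (fun n => a n * cb n k)).

Let psi_ge0 k : 0 <= psi k.
Proof.
have h n : 0 <= a n * cb n k by rewrite mulr_ge0.
by have := series_le_lim 0 h (@weights_cb_cvg k); rewrite {1}/series /= big_nil.
Qed.

(** The double series with terms a n * sg^k * cb n k is bounded by summing over k
    first, which leaves the convergent series of a n * Phi n. *)
Lemma weights_double_cvg : cvgn (series (fun k => sg ^+ k * psi k)).
Proof.
apply: nondecreasing_is_cvgn.
  by apply: nondecreasing_series => k _ _; rewrite mulr_ge0 ?exprn_ge0.
exists (limn (series (fun n => a n * Phi n))) => _ [K _ <-].
have cZ k : cvgn (series (fun n => sg ^+ k * (a n * cb n k))).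
  by rewrite seriesZE; apply: is_cvgZl_tmp; exact: weights_cb_cvg.
have [c1 c2] := lim_series_sum K cZ.
rewrite /series /= big_mkord.
rewrite (eq_bigr (fun k : 'I_K => limn (series (fun n => sg ^+ k * (a n * cb n k))))).
  rewrite -c2; apply: lim_series_le => // n.
  rewrite (eq_bigr (fun k : 'I_K => a n * (sg ^+ k * cb n k))); last by move=> k _; ring.
  rewrite -mulr_sumr ler_wpM2l//.
  rewrite -(big_mkord xpredT (fun k => sg ^+ k * cb n k)).
  apply: (@series_le_lim _ (fun k => sg ^+ k * cb n k)) => // k.
  by rewrite mulr_ge0 ?exprn_ge0.
by move=> k _; rewrite lim_seriesZE//; exact: weights_cb_cvg.
Qed.

End Bounds.
End GeneratingFunction.

Section GeneratingFunctionSum.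
Context {R : realType}.
Context (q rho x y t s : R) (hq : -1 < q <= 1) (hr : `|rho| < 1).
Context (xS : x \in qsupp q) (yS : y \in qsupp q).
Context (t1 : (1 - q) * t ^+ 2 < 1) (s1 : (1 - q) * s ^+ 2 < 1).
Implicit Types (n m k N : nat).

Let q2 : 0 <= 1 - q. Proof. by rewrite subr_ge0; case/andP: hq. Qed.
Let f0 n : 0 < qfact q n. Proof. exact: qfact_gt0. Qed.

(** The terms of the triple series behind the generating function. *)
Let A n m k := (t ^+ n / qfact q n) * (s ^+ m / qfact q m)
  * gamma_term q rho n m x y k.

(** With T = |t| r, S = |s| r and sg = |rho| r^2, the growth of the q-Hermite
    polynomials bounds A n m k by a constant times
    sg^k T^n S^m (cb n k * cb m k)^(1/2) / ([n]! [m]!)^(1/2), where cb n k is the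
    Gaussian binomial (n+k choose k). The inequality between the arithmetic and
    the geometric means then separates n from m. *)
Lemma triple_majorant : exists2 M : nat -> R, cvgn (series M) &
  forall N k, \sum_(n < N) \sum_(m < N) `|A n m k| <= M k.
Proof.
pose c := Num.max `|rho| (Num.max ((1 - q) * t ^+ 2) ((1 - q) * s ^+ 2)).
have c0 : 0 <= c by rewrite le_max normr_ge0.
have c1 : c < 1 by rewrite !gt_max hr t1 s1.
have [r r1 cr] := exists_radius c0 c1.
have r0 : 0 < r by rewrite (lt_trans ltr01).
have rr z : z <= c -> z * r ^+ 2 < 1.
  by move=> zc; apply: le_lt_trans cr; rewrite ler_wpM2r ?sqr_ge0.
pose sg := `|rho| * r ^+ 2.
have sg0 : 0 <= sg by rewrite mulr_ge0 ?sqr_ge0.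
have sg1 : sg < 1 by apply: rr; rewrite le_max lexx.
pose T := `|t| * r; pose S := `|s| * r.
have T0 : 0 <= T by rewrite mulr_ge0// ltW.
have S0 : 0 <= S by rewrite mulr_ge0// ltW.
have T1 : (1 - q) * T ^+ 2 < 1.
  rewrite exprMn real_normK ?num_real// mulrA; apply: rr.
  by rewrite !le_max lexx orbT.
have S1 : (1 - q) * S ^+ 2 < 1.
  rewrite exprMn real_normK ?num_real// mulrA; apply: rr.
  by rewrite !le_max lexx !orbT.
have [C C0 HC] := qHermite_growth hq xS r1.
have [D D0 HD] := qHermite_growth hq yS r1.
pose cb n k := qfact q (n + k) / (qfact q n * qfact q k).
have cb0 n k : 0 <= cb n k by rewrite divr_ge0 ?mulr_ge0// ltW.
pose a n := T ^+ n / Num.sqrt (qfact q n).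
pose b n := S ^+ n / Num.sqrt (qfact q n).
have a0 n : 0 <= a n by rewrite divr_ge0 ?exprn_ge0.
have b0 n : 0 <= b n by rewrite divr_ge0 ?exprn_ge0.
have ca : cvgn (series a) := weights_cvg hq T0 T1.
have cb_ : cvgn (series b) := weights_cvg hq S0 S1.
have cac k : cvgn (series (fun n => a n * cb n k)) := @weights_cb_cvg _ _ hq _ T0 T1 k.
have cbc k : cvgn (series (fun n => b n * cb n k)) := @weights_cb_cvg _ _ hq _ S0 S1 k.
have da := weights_double_cvg hq sg0 sg1 T0 T1.
have db := weights_double_cvg hq sg0 sg1 S0 S1.
pose psi k : R := limn (series (fun n => a n * cb n k)).
pose psi' k : R := limn (series (fun n => b n * cb n k)).
pose la : R := limn (series a); pose lb : R := limn (series b).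
pose K := C * D / 2.
have K0 : 0 <= K by rewrite divr_ge0// mulr_ge0.
have bound n m k :
    `|A n m k| <= K * sg ^+ k * (a n * cb n k * b m + a n * (b m * cb m k)).
  rewrite /A /gamma_term !normrM !normfV !normrX !(gtr0_norm (f0 _)).
  set sn := Num.sqrt (qfact q n); set sm := Num.sqrt (qfact q m).
  set sk := Num.sqrt (qfact q k).
  set En := Num.sqrt (cb n k); set Em := Num.sqrt (cb m k).
  have sn0 : 0 < sn by rewrite sqrtr_gt0.
  have sm0 : 0 < sm by rewrite sqrtr_gt0.
  have sk0 : 0 < sk by rewrite sqrtr_gt0.
  have en : qfact q n = sn * sn by rewrite -expr2 sqr_sqrtr// ltW.
  have em : qfact q m = sm * sm by rewrite -expr2 sqr_sqrtr// ltW.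
  have ek : qfact q k = sk * sk by rewrite -expr2 sqr_sqrtr// ltW.
  have split j : Num.sqrt (qfact q (k + j)) =
      Num.sqrt (qfact q j) * sk * Num.sqrt (cb j k).
    rewrite /sk -!sqrtrM ?mulr_ge0 ?(ltW (f0 _))//; congr Num.sqrt.
    by rewrite /cb addnC mulrC divfK// mulf_neq0// gt_eqF.
  have cE : cb n k = En ^+ 2 by rewrite sqr_sqrtr.
  have cE' : cb m k = Em ^+ 2 by rewrite sqr_sqrtr.
  apply: (@le_trans _ _ (`|t| ^+ n / qfact q n * (`|s| ^+ m / qfact q m)
    * (`|rho| ^+ k / qfact q k * (C * (r ^+ (k + n) * (sn * sk * En)))
       * (D * (r ^+ (k + m) * (sm * sk * Em)))))).
    have p0 (z : R) j : 0 <= `|z| ^+ j / qfact q j.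
      by rewrite divr_ge0 ?exprn_ge0// ltW.
    apply: ler_wpM2l; first by rewrite mulr_ge0.
    apply: ler_pM => //; first by rewrite mulr_ge0.
      by apply: ler_wpM2l => //; rewrite -split.
    by rewrite -split.
  rewrite cE cE' en em ek.
  rewrite [leLHS](_ : _ = C * D * sg ^+ k * (a n * b m) * (En * Em)); last first.
    rewrite /a /b -/sn -/sm /sg /T /S expr2 !exprMn !exprD.
    by field; rewrite !gt_eqF.
  rewrite [leRHS](_ : _ = C * D * sg ^+ k * (a n * b m) * ((En ^+ 2 + Em ^+ 2) / 2));
    last by rewrite /K; field.
  apply: ler_wpM2l; first by rewrite !mulr_ge0 ?exprn_ge0.
  have := sqr_ge0 (En - Em); nra.
exists (fun k => K * (lb * (sg ^+ k * psi k) + la * (sg ^+ k * psi' k))).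
  rewrite seriesZE; apply: is_cvgZl_tmp; rewrite seriesDE !seriesZE.
  by apply: is_cvgD; apply: is_cvgZl_tmp.
move=> N k.
have le_lim (u : nat -> R) : (forall n, 0 <= u n) -> cvgn (series u) ->
    \sum_(n < N) u n <= limn (series u).
  by move=> u0 cu; rewrite -(big_mkord xpredT u); exact: (@series_le_lim _ u).
apply: (@le_trans _ _ (K * sg ^+ k * ((\sum_(n < N) a n * cb n k) * (\sum_(m < N) b m)
  + (\sum_(n < N) a n) * \sum_(m < N) b m * cb m k))).
  rewrite !mulr_suml -big_split mulr_sumr; apply: ler_sum => n _ /=.
  rewrite !mulr_sumr -big_split mulr_sumr; apply: ler_sum => m _ /=.
  exact: bound.
rewrite [leRHS](_ : _ = K * sg ^+ k * (psi k * lb + la * psi' k)); last by ring.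
apply: ler_wpM2l; first by rewrite mulr_ge0 ?exprn_ge0.
have ac0 n : 0 <= a n * cb n k by rewrite mulr_ge0.
have bc0 n : 0 <= b n * cb n k by rewrite mulr_ge0.
by apply: lerD; apply: ler_pM; rewrite ?sumr_ge0// ?le_lim//; exact: le_lim.
Qed.

Let w n m := t ^+ n * s ^+ m / (qfact q n * qfact q m).

Let A_abs_cvg n m : abs_cvg (A n m).
Proof. by apply: abs_cvgZ; exact: gamma_abs_cvg. Qed.

Let A_lim n m : limn (series (A n m)) = w n m * qgamma q rho n m x y.
Proof.
rewrite /A lim_seriesZE; last exact: gamma_cvg.
by rewrite -qgammaE /w invfM; ring.
Qed.

Let lim_series_sum2 (u : nat -> nat -> nat -> R) N :
  (forall n m, cvgn (series (u n m))) ->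
  cvgn (series (fun k => \sum_(n < N) \sum_(m < N) u n m k)) /\
  limn (series (fun k => \sum_(n < N) \sum_(m < N) u n m k))
  = \sum_(n < N) \sum_(m < N) limn (series (u n m)).
Proof.
move=> cu; have inner n := lim_series_sum N (cu n).
have [c1 c2] := @lim_series_sum _ (fun n k => \sum_(m < N) u n m k) N
  (fun n => (inner n).1).
split; first exact: c1.
by rewrite c2; apply: eq_bigr => n _; exact: (inner n).2.
Qed.

Lemma double_gamma_summable (c : R) : summable [set: nat * nat]
  (fun p => (c * (w p.1 p.2 * qgamma q rho p.1 p.2 x y))%:E).
Proof.
have [M cM HM] := triple_majorant.
have sq N : \sum_(n < N) \sum_(m < N) `|c * (w n m * qgamma q rho n m x y)|
    <= `|c| * limn (series M).
  apply: (@le_trans _ _ (`|c| * \sum_(n < N) \sum_(m < N)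
      limn (series (fun k => `|A n m k|)))).
    rewrite mulr_sumr; apply: ler_sum => n _; rewrite mulr_sumr.
    apply: ler_sum => m _; rewrite normrM ler_wpM2l//.
    by rewrite -A_lim; exact: lim_series_norm_le.
  have [c1 <-] := lim_series_sum2 N A_abs_cvg.
  by rewrite ler_wpM2l//; apply: lim_series_le => // k; exact: HM.
rewrite /summable; apply: (@le_lt_trans _ _ (`|c| * limn (series M))%:E); last exact: ltry.
apply: ub_ereal_sup => _ [X [finX _] <-].
rewrite fsbig_finite//=.
set F := finmap.enum_fset _.
pose N := (\max_(p <- F) maxn p.1 p.2).+1.
have FN p : p \in F -> (p.1 < N)%N /\ (p.2 < N)%N.
  move=> pF; have := @leq_bigmax_seq _ _ xpredT (fun p => maxn p.1 p.2) p pF isT.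
  by rewrite /N !ltnS geq_max => /andP.
rewrite sumEFin lee_fin; apply: le_trans (sq N).
rewrite pair_bigA /=.
pose h (z : 'I_N * 'I_N) := (nat_of_ord z.1, nat_of_ord z.2).
have hI : injective h.
  by move=> [n1 m1] [n2 m2] [] /val_inj -> /val_inj ->.
rewrite -(big_map h xpredT (fun p => `|c * (w p.1 p.2 * qgamma q rho p.1 p.2 x y)|)).
set L := map _ _.
have uL : uniq L by rewrite map_inj_uniq ?index_enum_uniq.
have FL : {subset F <= L}.
  move=> [n m] /FN /= [nN mN]; apply/mapP.
  by exists (Ordinal nN, Ordinal mN); rewrite ?mem_index_enum.
rewrite -[leLHS]addr0 [leRHS](bigID (fun p => p \in F)) /=.
apply: lerD; last by apply: sumr_ge0.
rewrite le_eqVlt; apply/orP; left; apply/eqP; rewrite -[RHS]big_filter.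
apply: perm_big; apply: uniq_perm; rewrite ?finmap.fset_uniq ?filter_uniq// => p.
by rewrite mem_filter; case: (boolP (p \in F)) => //= /FL.
Qed.

Let sum_A N k : \sum_(n < N) \sum_(m < N) A n m k = rho ^+ k / qfact q k
  * (\sum_(n < N) phi_term q t k x n) * (\sum_(m < N) phi_term q s k y m).
Proof.
rewrite -mulrA big_distrlr mulr_sumr; apply: eq_bigr => n _.
rewrite mulr_sumr; apply: eq_bigr => m _.
rewrite /A /gamma_term /phi_term [(k + n)%N]addnC [(k + m)%N]addnC /=; ring.
Qed.

Let v k := rho ^+ k / qfact q k * big_qHermite q t k x * big_qHermite q s k y.

Lemma double_gamma_cvg :
  (fun N => \sum_(n < N) \sum_(m < N) w n m * qgamma q rho n m x y) @ \oo
  --> limn (series (fun k => phi_H q t x * phi_H q s y * v k)).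
Proof.
have [M cM HM] := triple_majorant.
have eN N : \sum_(n < N) \sum_(m < N) w n m * qgamma q rho n m x y
    = limn (series (fun k => \sum_(n < N) \sum_(m < N) A n m k)).
  have [_ ->] := lim_series_sum2 N (fun n m => abs_cvg_cvg (A_abs_cvg (n := n) (m := m))).
  by apply: eq_bigr => n _; apply: eq_bigr => m _; rewrite A_lim.
under eq_fun do rewrite eN.
apply: (@series_dominated_cvg _ (fun N k => \sum_(n < N) \sum_(m < N) A n m k) _ M) => //.
  move=> N k; apply: le_trans (HM N k); apply: le_trans (ler_norm_sum _ _ _) _.
  by apply: ler_sum => n _; exact: ler_norm_sum.
move=> k; under eq_fun do rewrite sum_A.
apply: (@cvg_lim_eq _ _ (rho ^+ k / qfact q k *
  (phi_H q t x * big_qHermite q t k x) * (phi_H q s y * big_qHermite q s k y))).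
  by rewrite /v; ring.
rewrite -!phi_big_qHermite//.
have cs z u : z \in qsupp q -> (1 - q) * u ^+ 2 < 1 ->
    (fun N => \sum_(n < N) phi_term q u k z n) @ \oo
    --> limn (series (phi_term q u k z)).
  move=> zS u1; under eq_fun do rewrite -(big_mkord xpredT (phi_term q u k z)).
  by apply: abs_cvg_cvg; exact: phi_abs_cvg.
by apply: cvgM; [apply: cvgMl_tmp|]; exact: cs.
Qed.

Lemma big_qHermite_series_cvg : cvgn (series v).
Proof.
have [r r1 hrr] := exists_radius (normr_ge0 rho) hr.
have [C C0 HC] := big_qHermite_growth t hq xS r1.
have [D D0 HD] := big_qHermite_growth s hq yS r1.
have r0 : 0 < r by rewrite (lt_trans ltr01).
apply: abs_cvg_cvg; apply: (@abs_cvg_le _ _ (fun n => (C * D) *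
  ((`|rho| * r ^+ 2) ^+ n * (Num.sqrt (qfact q (n + 0))
     * Num.sqrt (qfact q (n + 0))) / qfact q n))); last first.
  rewrite seriesZE; apply: is_cvgZl_tmp; apply: gamma_majorant_cvg => //.
  by rewrite mulr_ge0// exprn_ge0// ltW.
move=> n; rewrite /v !normrM normfV normrX (gtr0_norm (f0 n)) !addn0.
apply: le_trans (_ : `|rho| ^+ n / qfact q n
    * (C * (r ^+ n * Num.sqrt (qfact q n)))
    * (D * (r ^+ n * Num.sqrt (qfact q n))) <= _).
  have p0 : 0 <= `|rho| ^+ n / qfact q n.
    by rewrite divr_ge0 ?exprn_ge0// ltW.
  apply: ler_pM => //; first by rewrite mulr_ge0.
  by rewrite ler_wpM2l.
rewrite le_eqVlt; apply/orP; left; apply/eqP.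
by rewrite exprMn expr2 exprMn; ring.
Qed.

Theorem Q_generating_function :
  cvgn (series v) /\
  has_double_sum
    (fun n m => t ^+ n * s ^+ m / (qfact q n * qfact q m) * Q q rho n m x y)
    (density_quotient q rho t s x y * limn (series v)).
Proof.
split; first exact: big_qHermite_series_cvg.
have g0 := gamma00_neq0 hq hr xS yS.
set g := qgamma q rho 0 0 x y in g0.
have uE n m : w n m * Q q rho n m x y = g^-1 * (w n m * qgamma q rho n m x y).
  by rewrite gamma_Q// -/g; field.
have -> : density_quotient q rho t s x y = phi_H q t x * phi_H q s y / g.
  rewrite /density_quotient -/g; case: ifPn => // ff.
  rewrite f_2DE// -/g /f_bN.
  have /norP[fx fy] : ~~ ((f_N q x == 0) || (f_N q y == 0)) by rewrite -mulf_eq0.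
  by field; rewrite fx fy g0.
split.
  rewrite (_ : (fun p => _) = (fun p =>
    (g^-1 * (w p.1 p.2 * qgamma q rho p.1 p.2 x y))%:E)).
    exact: double_gamma_summable.
  by apply/funext => p; rewrite -uE.
under eq_fun => N.
  rewrite (eq_bigr (fun n : 'I_N => g^-1 * \sum_(m < N) w n m * qgamma q rho n m x y)).
    rewrite -mulr_sumr; over.
  by move=> n _; rewrite mulr_sumr; apply: eq_bigr => m _; rewrite -uE.
apply: (@cvg_lim_eq _ _ (g^-1 * limn (series (fun k => phi_H q t x * phi_H q s y * v k)))).
  rewrite lim_seriesZE; last exact: big_qHermite_series_cvg.
  by rewrite mulrA [g^-1 * _]mulrC.
by apply: cvgMl_tmp; exact: double_gamma_cvg.
Qed.

End GeneratingFunctionSum.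

(** * Integrals of real functions *)

Section HasIntegral.
Context d (T : measurableType d) (R : realType) (mu : {measure set T -> \bar R}).
Implicit Types (f g : T -> R) (a b c : R).

(** The real function f is integrable with integral c. *)
Definition has_int f c :=
  mu.-integrable setT (EFin \o f) /\ (\int[mu]_z (f z)%:E = c%:E)%E.

Lemma has_int_eq f g a b : f =1 g -> a = b -> has_int f a -> has_int g b.
Proof. by move=> /funext <- <-. Qed.

Lemma has_int_integrable f :
  mu.-integrable setT (EFin \o f) -> exists c, has_int f c.
Proof.
move=> fi; exists (fine (\int[mu]_z (f z)%:E)); split => //.
by rewrite fineK//; exact: (integrable_fin_num measurableT fi).
Qed.

Lemma has_int_measurable f c : has_int f c -> measurable_fun setT f.
Proof. by move=> [/integrableP[mf _] _]; exact/measurable_EFinP. Qed.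

Lemma has_intD f g a b : has_int f a -> has_int g b ->
  has_int (fun z => f z + g z) (a + b).
Proof.
move=> [fi fa] [gi gb]; split.
  exact: (integrableD measurableT fi gi).
rewrite EFinD -fa -gb -(integralD measurableT fi gi).
by apply: eq_integral.
Qed.

Lemma has_intZ f a c : has_int f a -> has_int (fun z => c * f z) (c * a).
Proof.
move=> [fi fa]; split.
  exact: (integrableZl measurableT c fi).
rewrite EFinM -fa -(integralZl measurableT fi).
by apply: eq_integral.
Qed.

Lemma has_intB f g a b : has_int f a -> has_int g b ->
  has_int (fun z => f z - g z) (a - b).
Proof.
move=> fa gb; apply: has_int_eq (has_intD fa (has_intZ (-1) gb)) => [z|]; ring.
Qed.

Lemma has_int0 : has_int (fun=> 0) 0.
Proof. by split; [exact: integrable0|rewrite integral0]. Qed.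

Lemma has_int_sum n (u : nat -> T -> R) (c : nat -> R) :
  (forall k, has_int (u k) (c k)) ->
  has_int (fun z => \sum_(k < n) u k z) (\sum_(k < n) c k).
Proof.
move=> uc; elim: n => [|n IH].
  by apply: has_int_eq has_int0 => [z|]; rewrite big_ord0.
by apply: has_int_eq (has_intD IH (uc n)) => [z|]; rewrite big_ord_recr.
Qed.

Lemma has_int_le f g a b : (forall z, f z <= g z) -> has_int f a ->
  has_int g b -> a <= b.
Proof.
move=> fg [fi fa] [gi gb]; rewrite -lee_fin -fa -gb.
by apply: (le_integral measurableT fi gi) => z _; rewrite lee_fin.
Qed.

Lemma has_int_unique f a b : has_int f a -> has_int f b -> a = b.
Proof. by move=> [_ fa] [_ fb]; apply: EFin_inj; rewrite -fa. Qed.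

Lemma has_int_dominated f g c : measurable_fun setT f ->
  (forall z, `|f z| <= g z) -> has_int g c -> exists2 a, has_int f a & `|a| <= c.
Proof.
move=> mf fg [gi gc].
have fi : mu.-integrable setT (EFin \o f).
  apply: (le_integrable measurableT _ _ gi); first exact/measurable_EFinP.
  by move=> z _ /=; rewrite lee_fin (le_trans (fg z))// ler_norm.
have [a fa] := has_int_integrable fi; exists a => //.
have gg : has_int g c by [].
rewrite ler_norml; apply/andP; split.
  apply: (@has_int_le (fun z => (-1) * g z) f).
  - by move=> z; rewrite mulN1r; have := fg z; rewrite ler_norml => /andP[].
  - by apply: has_int_eq (has_intZ (-1) gg) => //; rewrite mulN1r.
  - exact: fa.
apply: has_int_le fa gg => z; exact: le_trans (ler_norm _) (fg z).
Qed.

Lemma has_int_norm f a : has_int f a -> exists c, has_int (fun z => `|f z|) c.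
Proof. by move=> [fi _]; apply: has_int_integrable; exact: integrable_norm. Qed.

Lemma has_int_cvg (f_ : nat -> T -> R) f g (c_ : nat -> R) c e :
  (forall n, has_int (f_ n) (c_ n)) -> (forall n z, `|f_ n z| <= g z) ->
  has_int g e -> (forall z, f_ ^~ z @ \oo --> f z) -> c_ @ \oo --> c ->
  has_int f c.
Proof.
move=> fc fg [gi _] ff cc.
have mf_ n : measurable_fun setT (EFin \o f_ n) by case: (fc n) => /integrableP[].
have ff' z : (fun n => (EFin \o f_ n) z) @ \oo --> (EFin \o f) z.
  by apply: cvg_EFin; [exact: nearW|exact: ff].
have mf : measurable_fun setT (EFin \o f).
  by apply: (emeasurable_fun_cvg (fun n => EFin \o f_ n)) => // z _; exact: ff'.
have aef : {ae mu, forall z, setT z ->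
    (fun n => (EFin \o f_ n) z) @ \oo --> (EFin \o f) z}.
  by apply: aeW => z _; exact: ff'.
have aeg : {ae mu, forall z n, setT z -> (`|(EFin \o f_ n) z| <= (EFin \o g) z)%E}.
  by apply: aeW => z n _ /=; rewrite lee_fin.
have [fi _ fl] := dominated_convergence measurableT mf_ mf aef gi aeg.
split=> //; rewrite -[LHS](cvg_lim _ fl)//; apply: cvg_lim => //.
have -> : (fun n => \int[mu]_z (EFin \o f_ n) z)%E = (fun n => (c_ n)%:E).
  by apply/funext => n; case: (fc n).
by apply: cvg_EFin; [exact: nearW|exact: cc].
Qed.

(** Termwise integration of a series with summable L1 norms. *)
Lemma has_int_series (u : nat -> T -> R) (c e M : nat -> R) :
  (forall n, has_int (u n) (c n)) ->
  (forall n, has_int (fun z => `|u n z|) (e n)) ->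
  (forall n, e n <= M n) -> cvgn (series M) ->
  (forall z, cvgn (series (u ^~ z))) ->
  has_int (fun z => limn (series (u ^~ z))) (limn (series c)).
Proof.
move=> uc ue eM cM cu.
pose f_ n z := (series (u ^~ z) n)%:E.
pose f z : \bar R := (limn (series (u ^~ z)))%:E.
pose g z : \bar R := (\sum_(n <oo) (`|u n z|)%:E)%E.
have e0 n : 0 <= e n.
  by apply: has_int_le has_int0 (ue n) => z.
have mu_ n : measurable_fun setT (u n) := has_int_measurable (uc n).
have mn n : measurable_fun setT (fun z => (`|u n z|)%:E).
  by apply/measurable_EFinP; apply: measurableT_comp.
have fE n z : f_ n z = (\sum_(k < n) u k z)%:E by rewrite /f_ /series /= big_mkord.
have mf_ n : measurable_fun setT (f_ n).
  apply: (eq_measurable_fun (fun z => (\sum_(k < n) u k z)%:E)).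
    by move=> z _; rewrite fE.
  by apply/measurable_EFinP; apply: measurable_sum.
have ff z : f_ ^~ z @ \oo --> f z by apply: cvg_EFin; [exact: nearW|exact: cu].
have mf : measurable_fun setT f.
  by apply: (emeasurable_fun_cvg f_) => // z _; exact: ff.
have g0 z : (0 <= g z)%E by apply: nneseries_ge0.
have mg : measurable_fun setT g.
  by apply: ge0_emeasurable_sum => // n z _ _; rewrite lee_fin.
have gi : mu.-integrable setT g.
  apply/integrableP; split=> //.
  under eq_integral => z _ do rewrite gee0_abs//.
  rewrite integral_nneseries//.
  have -> : (\sum_(n <oo) \int[mu]_z (`|u n z|)%:E = \sum_(n <oo) (e n)%:E)%E.
    by apply: eq_eseriesr => n _; case: (ue n).
  apply: (@le_lt_trans _ _ (limn (series M))%:E); last exact: ltry.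
  apply: lime_le; first by apply: is_cvg_nneseries => n _ _; rewrite lee_fin.
  near=> n; rewrite sumEFin lee_fin; apply: le_trans (series_le_lim n _ cM).
    by apply: ler_sum => k _.
  by move=> k; exact: le_trans (e0 k) (eM k).
have fg n z : (`|f_ n z| <= g z)%E.
  apply: (@le_trans _ _ (\sum_(0 <= k < n) (`|u k z|)%:E)%E).
    by rewrite /f_ /series /= sumEFin lee_fin ler_norm_sum.
  by apply: nneseries_lim_ge => k _ _; rewrite lee_fin.
have aef : {ae mu, forall z, setT z -> f_ ^~ z @ \oo --> f z} by apply: aeW => z _; exact: ff.
have aeg : {ae mu, forall z n, setT z -> (`|f_ n z| <= g z)%E} by apply: aeW => z n _; exact: fg.
have [fi _ fl] := dominated_convergence measurableT mf_ mf aef gi aeg.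
split=> //; rewrite -(cvg_lim _ fl)//; apply: cvg_lim => //.
have -> : (fun n => \int[mu]_z f_ n z)%E = (fun n => (series c n)%:E).
  apply/funext => n; have [_ h] := has_int_sum n uc.
  under eq_integral do rewrite fE.
  by rewrite h /series /= big_mkord.
apply: cvg_EFin; first exact: nearW.
have ce n : `|c n| <= M n.
  have [a ha ale] := has_int_dominated (mu_ n) (fun z => lexx _) (ue n).
  by rewrite (has_int_unique (uc n) ha) (le_trans ale).
by apply: abs_cvg_cvg; exact: abs_cvg_le cM.
Unshelve. all: by end_near. Qed.

End HasIntegral.

Section ProductIntegral.
Context {R : realType}.
Let mu := @lebesgue_measure R.

(** Lebesgue measure on the plane. *)
Definition plane_measure := (mu \x mu)%E.

Lemma has_int_prod (f g : measurableTypeR R -> R) (a b : R) :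
  has_int mu f a -> has_int mu g b ->
  has_int plane_measure (fun z => f z.1 * g z.2) (a * b).
Proof.
move=> fa gb; have mf := has_int_measurable fa; have mg := has_int_measurable gb.
have mfg : measurable_fun setT
    (fun z : measurableTypeR R * measurableTypeR R => (f z.1 * g z.2)%:E).
  apply/measurable_EFinP; apply: measurable_funM.
    exact: (measurableT_comp mf).
  exact: (measurableT_comp mg).
have i2 (f' g' : measurableTypeR R -> R) (a' b' : R) : has_int mu f' a' ->
    has_int mu g' b' -> (\int[mu]_x \int[mu]_y (f' x * g' y)%:E = (a' * b')%:E)%E.
  move=> fa' gb'.
  under eq_integral => x _.
    have [_ ->] := has_intZ (f' x) gb'; rewrite mulrC; over.
  by have [_ ->] := has_intZ b' fa'; rewrite mulrC.
have [c fc] := has_int_norm fa; have [e ge] := has_int_norm gb.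
have fgi : plane_measure.-integrable setT (EFin \o (fun z => f z.1 * g z.2)).
  apply/(integrable12ltyP _ _ mfg).
  under eq_integral => x _ do under eq_integral => y _ do rewrite /= normrM.
  by rewrite (i2 _ _ _ _ fc ge) ltry.
split; first exact: fgi.
rewrite -(i2 _ _ _ _ fa gb).
exact: (esym (integral12_prod_meas1 fgi)).
Qed.

End ProductIntegral.

(** * Orthogonality from a weight, and the integrals of products of Q_(i,j) *)

Section Favard.
Context {R : realType}.
Implicit Types (J : nat -> nat -> R) (b : nat -> R).

(** J m l is the integral of p_m p_l for a three-term recursive family p. That
    multiplication by x is symmetric determines all J m l from the J m 0. *)
Lemma favard_moments J b (A : R) : b 0%N = 0 ->
  (forall m l, J m.+1 l + b m * J m.-1 l = J m l.+1 + b l * J m l.-1) ->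
  (forall m, J m 0%N = A * (m == 0%N)%:R) ->
  forall m l, J m l = A * ((m == l)%:R * \prod_(i < m) b i.+1).
Proof.
move=> b0 JS J0; pose c m := \prod_(i < m) b i.+1.
have cS m : c m.+1 = c m * b m.+1 by rewrite /c big_ord_recr.
have c0 : c 0%N = 1 by rewrite /c big_ord0.
suff h l : (forall m, J m l = A * ((m == l)%:R * c m)) /\
    (forall m, J m l.+1 = A * ((m == l.+1)%:R * c m)).
  by move=> m l; case: (h l).
elim: l => [|l [IH1 IH2]].
  have e m : J m 0%N = A * ((m == 0%N)%:R * c m).
    by rewrite J0; case: m => [|m]; rewrite ?c0 ?mulr1//= mul0r.
  split=> // m; have := JS m 0%N; rewrite b0 mul0r addr0 => <-; rewrite !e.
  case: m => [|[|m]] /=; rewrite ?b0 ?cS ?c0; ring.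
split=> // m; have := JS m l.+1; rewrite !IH2 /= IH1 => /eqP.
rewrite addrC -subr_eq => /eqP <-.
case: m => [|m].
  rewrite b0 !mul0r !eqSS !cS c0; case: l {IH1 IH2} => [|l] /=; ring.
rewrite !eqSS /= {IH1 IH2}.
have [e1|_] := eqVneq m.+1 l.
  by subst l; rewrite (_ : (m == m.+2) = false) ?cS /=; [ring|lia].
by have [e2|_] := eqVneq m l.+1; [subst m; rewrite !cS|] => /=; ring.
Qed.

Context (mu : {measure set (measurableTypeR R) -> \bar R}).

Lemma favard_has_int (p : nat -> R -> R) b (c A : R) (w : R -> R) :
  b 0%N = 0 -> (forall x, p 0%N x = 1) ->
  (forall n x, p n.+1 x = c * x * p n x - b n * p n.-1 x) ->
  (forall m l, mu.-integrable setT (EFin \o (fun x => p m x * p l x * w x))) ->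
  (forall n, has_int mu (fun x => p n x * w x) (A * (n == 0%N)%:R)) ->
  forall m l, has_int mu (fun x => p m x * p l x * w x)
    (A * ((m == l)%:R * \prod_(i < m) b i.+1)).
Proof.
move=> b0 p0 pS pi pA.
have ex m l := has_int_integrable (pi m l).
pose J m l : R := sval (cid (ex m l)).
have JP m l : has_int mu (fun x => p m x * p l x * w x) (J m l).
  by rewrite /J; case: cid.
move=> m l; rewrite -(favard_moments (J := J) b0)// {m l}.
- move=> m l; apply: has_int_unique (has_intD (JP m.+1 l) (has_intZ (b m) (JP m.-1 l))) _.
  apply: has_int_eq (has_intD (JP m l.+1) (has_intZ (b l) (JP m l.-1))) => // x.
  by rewrite !pS; ring.
- move=> m; apply: has_int_unique (JP m 0%N) _.
  by apply: has_int_eq (pA m) => // x; rewrite p0 mulr1.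
Qed.

End Favard.

Section TopCoefficients.
Context {R : realType}.
Context (q rho : R).
Implicit Types (i j k m n c s u : nat).

(** The coefficient of x^(m+k-c) y^c in Q_(m,k), in its top degree m + k. *)
Fixpoint Qtop k m c : R :=
  if k is k'.+1 then
    (if c is c'.+1 then Qtop k' m c' else 0) - q ^+ k' * rho * Qtop k' m.+1 c
  else (-1) ^+ c * (q ^+ 'C(c, 2) * gbin q m c) * rho ^+ c / qpoch (rho ^+ 2) q m.

Arguments Qtop : simpl never.

Lemma Qtop0E m c : Qtop 0 m c =
  (-1) ^+ c * (q ^+ 'C(c, 2) * gbin q m c) * rho ^+ c / qpoch (rho ^+ 2) q m.
Proof. by []. Qed.

Lemma Qtop00 c : Qtop 0 0 c = (c == 0%N)%:R.
Proof.
rewrite Qtop0E; case: c => [|c].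
  by rewrite gbin0 qpoch0 !expr0 divr1 !mulr1.
by rewrite gbin_small// !(mulr0, mul0r).
Qed.

Lemma Qtop0S m c : qpoch (rho ^+ 2) q m.+1 != 0 ->
  (1 - q ^+ m * rho ^+ 2) * Qtop 0 m.+1 c =
  Qtop 0 m c - q ^+ m * rho * (if c is c'.+1 then Qtop 0 m c' else 0).
Proof.
rewrite qpochS mulf_eq0 negb_or => /andP[n1 n2].
rewrite [q ^+ m * _]mulrC; case: c => [|c]; rewrite !Qtop0E.
  by rewrite !gbin0 qpochS mulr0 subr0; field; rewrite n1 n2.
by rewrite gbin_weight qpochS [(-1) ^+ _]exprS [rho ^+ c.+1]exprS; field; rewrite n1 n2.
Qed.

Lemma Qtop_expand k m c : Qtop k m c =
  \sum_(u < k.+1) (-1) ^+ u * (q ^+ 'C(u, 2) * gbin q k u)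
    * (rho ^+ u * (if (k - u <= c)%N then Qtop 0 (m + u) (c - (k - u)) else 0)).
Proof.
elim: k m c => [|k IH] m c.
  by rewrite big_ord_recr big_ord0 /= gbin0 !expr0 !subn0 addn0 !mul1r add0r.
pose g u := rho ^+ u *
  (if (k.+1 - u <= c)%N then Qtop 0 (m + u) (c - (k.+1 - u)) else 0).
rewrite [RHS](gbin_sum_recr q k g) -[LHS]/((if c is c'.+1 then Qtop k m c' else 0)
  - q ^+ k * rho * Qtop k m.+1 c).
congr (_ - _); last first.
  rewrite IH -mulrA; congr (_ * _); rewrite mulr_sumr; apply: eq_bigr => u _.
  by rewrite /g subSS addSnnS exprS; ring.
case: c @g => [|c] g.
  rewrite big1// => u _; rewrite /g leqn0 subSn ?eqS0 ?mulr0//; last by rewrite -ltnS.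
rewrite IH; apply: eq_bigr => u _; rewrite /g subSn ?ltnS ?subSS//.
by rewrite -ltnS.
Qed.

End TopCoefficients.

Arguments Qtop : simpl never.

Section Weight.
Context {R : realType}.
Let mu := @lebesgue_measure R.

Context (q : R) (hq : -1 < q <= 1) (w : R -> R).

(* The weight w stands for the density f_N extended by 0 outside its support. *)
Context (w_ge0 : forall x, 0 <= w x) (w_out : forall x, x \notin qsupp q -> w x = 0).
Context (w_poly : forall p : {poly R},
  mu.-integrable setT (EFin \o (fun x => p.[x] * w x))).
Context (w_H : forall n,
  has_int mu (fun x => qHermite q n x * w x) (n == 0%N)%:R).

Local Notation H := (qHermite q).
Let f0 n : 0 < qfact q n. Proof. exact: qfact_gt0. Qed.

Lemma polyfun_qHermite n : polyfun (qHermite q n).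
Proof.
suff: polyfun (qHermite q n) /\ polyfun (qHermite q n.+1) by case.
elim: n => [|n [IH1 IH2]].
  split; first exact: polyfun_cst.
  by exists 'X => x; rewrite qHermite1 hornerX.
split=> //; have [p Hp] := IH1; have [r Hr] := IH2.
exists ('X * r - (qint q n.+1)%:P * p) => x.
by rewrite qHermiteS Hp Hr hornerD hornerN !hornerM hornerX hornerC.
Qed.

Lemma w_polyfun f : polyfun f -> mu.-integrable setT (EFin \o (fun x => f x * w x)).
Proof.
move=> [p Hp]; rewrite (_ : (fun x => _) = (fun x => p.[x] * w x))//.
by apply/funext => x; rewrite Hp.
Qed.

Lemma qHermite_orthogonal m n :
  has_int mu (fun x => H m x * H n x * w x) ((m == n)%:R * qfact q m).
Proof.
have e : \prod_(i < m) qint q i.+1 = qfact q m.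
  elim: m => [|m IH]; first by rewrite big_ord0 qfact0.
  by rewrite big_ord_recr IH qfactS.
have := @favard_has_int _ mu H (qint q) 1 1 w (qint0 q) (qHermite0 q) _ _ _ m n.
rewrite e mul1r; apply.
- by move=> k x; rewrite mul1r qHermiteS.
- by move=> k l; apply: w_polyfun; apply: polyfunM; exact: polyfun_qHermite.
- by move=> k; apply: has_int_eq (w_H k) => //; rewrite mul1r.
Qed.

(** By |H_n H_a| <= (H_n^2 / s + s H_a^2) / 2 with s^2 = [n]!; only the growth in
    n matters. *)
Lemma qHermite_L1_bound n a :
  exists2 e, has_int mu (fun x => `|H n x * H a x * w x|) e &
    e <= Num.sqrt (qfact q n) * ((1 + qfact q a) / 2).
Proof.
set s := Num.sqrt (qfact q n).
have s0 : 0 < s by rewrite sqrtr_gt0 qfact_gt0.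
have ss : s ^+ 2 = qfact q n by rewrite sqr_sqrtr// ltW// qfact_gt0.
have hn := qHermite_orthogonal n n; have ha := qHermite_orthogonal a a.
rewrite !eqxx !mul1r in hn ha.
have g := has_intZ (2 * s)^-1 (has_intD hn (has_intZ (s ^+ 2) ha)).
have mf : measurable_fun setT (fun x : measurableTypeR R => `|H n x * H a x * w x|).
  by apply: measurableT_comp => //; exact: has_int_measurable (qHermite_orthogonal n a).
have [|e he ele] := has_int_dominated mf _ g.
  move=> x; rewrite normr_id normrM (ger0_norm (w_ge0 x)) normrM.
  rewrite (_ : _ * (_ + _) = (2 * s)^-1 * (H n x ^+ 2 + s ^+ 2 * H a x ^+ 2) * w x);
    last by ring.
  rewrite ler_wpM2r// [leRHS]mulrC ler_pdivlMr ?mulr_gt0//.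
  rewrite -(real_normK (num_real (H n x))) -(real_normK (num_real (H a x))).
  have := sqr_ge0 (`|H n x| - s * `|H a x|); nra.
exists e => //; apply: le_trans (ler_norm e) _; apply: le_trans ele _.
by rewrite -ss le_eqVlt; apply/orP; left; apply/eqP; field; rewrite gt_eqF.
Qed.

Section GammaIntegral.
Context (rho : R) (hr : `|rho| < 1) (i j : nat).

(** Termwise, the n-th integral vanishes unless n + i = a and n + j = b; for
    a + b <= i + j this leaves n = 0 only. *)
Lemma has_int_gamma a b : (a + b <= i + j)%N ->
  has_int plane_measure (fun z => qgamma q rho i j z.1 z.2
    * ((H a z.1 * w z.1) * (H b z.2 * w z.2)))
  (if (a == i) && (b == j) then qfact q i * qfact q j else 0).
Proof.
move=> abij.
pose u n (z : measurableTypeR R * measurableTypeR R) := rho ^+ n / qfact q n *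
  ((H (n + i) z.1 * H a z.1 * w z.1) * (H (n + j) z.2 * H b z.2 * w z.2)).
pose c n := rho ^+ n / qfact q n * (((n + i == a)%N%:R * qfact q (n + i))
  * ((n + j == b)%N%:R * qfact q (n + j))).
have uc n : has_int plane_measure (u n) (c n).
  exact: (has_intZ _ (has_int_prod (qHermite_orthogonal (n + i) a)
    (qHermite_orthogonal (n + j) b))).
pose K := (1 + qfact q a) / 2 * ((1 + qfact q b) / 2).
pose M n := K * (`|rho| ^+ n * (Num.sqrt (qfact q (n + i))
     * Num.sqrt (qfact q (n + j))) / qfact q n).
have ex n : exists e, has_int plane_measure (fun z => `|u n z|) e /\ e <= M n.
  have [e1 h1 l1] := qHermite_L1_bound (n + i) a.
  have [e2 h2 l2] := qHermite_L1_bound (n + j) b.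
  exists (`|rho| ^+ n / qfact q n * (e1 * e2)); split.
    apply: has_int_eq (has_intZ _ (has_int_prod h1 h2)) => // z.
    by rewrite /u [RHS]normrM normf_div normrX (gtr0_norm (f0 n)) -[X in _ * X = _]normrM.
  have e10 : 0 <= e1 by apply: (has_int_le _ (has_int0 _) h1) => z.
  have e20 : 0 <= e2 by apply: (has_int_le _ (has_int0 _) h2) => z.
  rewrite (_ : M n = `|rho| ^+ n / qfact q n
    * ((Num.sqrt (qfact q (n + i)) * ((1 + qfact q a) / 2))
    * (Num.sqrt (qfact q (n + j)) * ((1 + qfact q b) / 2)))); last first.
    by rewrite /M /K; ring.
  apply: ler_wpM2l; first by rewrite divr_ge0 ?exprn_ge0// ltW.
  exact: ler_pM.
pose e n := sval (cid (ex n)).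
have eP n : has_int plane_measure (fun z => `|u n z|) (e n) /\ e n <= M n.
  by rewrite /e; case: cid.
have cM : cvgn (series M).
  by rewrite /M seriesZE; apply: is_cvgZl_tmp; exact: gamma_majorant_cvg.
have uE z : series (u ^~ z) = series (fun n =>
    ((H a z.1 * w z.1) * (H b z.2 * w z.2)) * gamma_term q rho i j z.1 z.2 n).
  by congr series; apply/funext => n; rewrite /u /gamma_term; ring.
have out z : z.1 \notin qsupp q \/ z.2 \notin qsupp q ->
    (H a z.1 * w z.1) * (H b z.2 * w z.2) = 0.
  by move=> [] /w_out ->; rewrite !(mulr0, mul0r).
have s0 : series (fun=> 0 : R) = (fun=> 0).
  by apply/funext => n; rewrite /series /= big1.
have both z : (z.1 \in qsupp q /\ z.2 \in qsupp q) \/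
    (z.1 \notin qsupp q \/ z.2 \notin qsupp q).
  case: (boolP (z.1 \in qsupp q)) => h1; last by right; left.
  by case: (boolP (z.2 \in qsupp q)) => h2; [left|right; right].
have cu z : cvgn (series (u ^~ z)).
  rewrite uE; have [[z1 z2]|zo] := both z.
    by rewrite seriesZE; apply: is_cvgZl_tmp; exact: gamma_cvg.
  by under eq_fun do rewrite (out _ zo) mul0r; rewrite s0; exact: is_cvg_cst.
have := has_int_series uc (fun n => (eP n).1) (fun n => (eP n).2) cM cu.
apply: has_int_eq => [z|].
  rewrite uE; have [[z1 z2]|zo] := both z.
    by rewrite lim_seriesZE; [rewrite mulrC|exact: gamma_cvg].
  rewrite (out _ zo) mulr0; under eq_fun do rewrite mul0r.
  by rewrite s0; exact: (cvg_lim (@Rhausdorff R) (cvg_cst _)).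
have c1 n : c n.+1 = 0.
  rewrite /c; have [ea|_] := eqVneq (n.+1 + i)%N a; last by rewrite !mul0r mulr0.
  have [eb|_] := eqVneq (n.+1 + j)%N b; last by rewrite !mul0r !mulr0.
  by exfalso; lia.
have -> : limn (series c) = c 0%N.
  have cc : series (fun n => c n.+1) = (fun=> 0).
    by rewrite -s0; congr series; apply/funext.
  rewrite lim_series_shift.
    by rewrite cc (cvg_lim (@Rhausdorff R) (cvg_cst _)) addr0.
  by apply: cvg_series_shift; rewrite cc; exact: is_cvg_cst.
rewrite /c expr0 qfact0 divr1 mul1r !add0n ![_ == a]eq_sym ![_ == b]eq_sym.
by case: (a == i); case: (b == j); rewrite ?(mul0r, mulr0, mul1r).
Qed.

(* V k m a b is the integral of D m k a b as long as a + b + (m + k) <= i + j: it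
   is 0 below that degree, and in that degree only the top coefficients of
   Q_(m,k) matter. The factors H_a and H_b make an induction on the recursions of
   Q_(m,k) possible, multiplication by x or y being absorbed into them. *)
Let D m k a b := fun z : measurableTypeR R * measurableTypeR R =>
  qgamma q rho i j z.1 z.2 * ((H a z.1 * w z.1) * (H b z.2 * w z.2))
    * Qfun q rho m k z.1 z.2.

Let V k m a b : R := if (a + b + (m + k) == i + j)%N && (b <= j)%N
  then qfact q i * qfact q j * Qtop q rho k m (j - b) else 0.

Let P k m := forall a b, (a + b + (m + k) <= i + j)%N ->
  has_int plane_measure (D m k a b) (V k m a b).

Let V0 k m a b : (a + b + (m + k) < i + j)%N -> V k m a b = 0.
Proof. by move=> h; rewrite /V ltn_eqF. Qed.

Let P00 : P 0 0.
Proof.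
move=> a b h; rewrite !addn0 in h.
apply: has_int_eq (has_int_gamma h) => [z|]; first by rewrite /D Qfun00 mulr1.
rewrite /V !addn0 Qtop00; case: ifP => [/andP[/eqP -> /eqP ->]|ab].
  by rewrite eqxx leqnn subnn eqxx mulr1.
case: ifP => // /andP[/eqP e bj]; rewrite subn_eq0.
have [jb|] := leqP j b; last by rewrite mulr0.
have ea : a = i by lia.
have eb : b = j by lia.
by rewrite ea eb !eqxx in ab.
Qed.

Let xH a x : x * H a x = H a.+1 x + qint q a * H a.-1 x.
Proof. by rewrite qHermiteS subrK. Qed.

(* Multiplication by x or y: only the raised index reaches the top degree. *)
Let mulx k m a b : P k m -> (a + b + (m + k) < i + j)%N ->
  has_int plane_measure (fun z => z.1 * D m k a b z) (V k m a.+1 b).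
Proof.
move=> Pm h.
have h1 : (a.+1 + b + (m + k) <= i + j)%N by lia.
have h2 : (a.-1 + b + (m + k) <= i + j)%N by lia.
have h3 : (a.-1 + b + (m + k) < i + j)%N by lia.
apply: has_int_eq (has_intD (Pm _ _ h1) (has_intZ (qint q a) (Pm _ _ h2))) => [z|].
  rewrite /D; have := xH a z.1; set X := qgamma _ _ _ _ _ _; move=> e.
  transitivity (X * ((z.1 * H a z.1) * w z.1 * (H b z.2 * w z.2))
    * Qfun q rho m k z.1 z.2); last by ring.
  by rewrite e; ring.
by rewrite (V0 h3) mulr0 addr0.
Qed.

Let muly k m a b : P k m -> (a + b + (m + k) < i + j)%N ->
  has_int plane_measure (fun z => z.2 * D m k a b z) (V k m a b.+1).
Proof.
move=> Pm h.
have h1 : (a + b.+1 + (m + k) <= i + j)%N by lia.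
have h2 : (a + b.-1 + (m + k) <= i + j)%N by lia.
have h3 : (a + b.-1 + (m + k) < i + j)%N by lia.
apply: has_int_eq (has_intD (Pm _ _ h1) (has_intZ (qint q b) (Pm _ _ h2))) => [z|].
  rewrite /D; have := xH b z.2; set X := qgamma _ _ _ _ _ _; move=> e.
  transitivity (X * ((H a z.1) * w z.1 * ((z.2 * H b z.2) * w z.2))
    * Qfun q rho m k z.1 z.2); last by ring.
  by rewrite e; ring.
by rewrite (V0 h3) mulr0 addr0.
Qed.

Let VS0 m a b : (a + b + m < i + j)%N ->
  (1 - q ^+ m * rho ^+ 2) * V 0 m.+1 a b
  = V 0 m a.+1 b - q ^+ m * rho * V 0 m a b.+1.
Proof.
move=> h; rewrite /V !addn0.
have -> : (a.+1 + b + m == i + j)%N = (a + b + m.+1 == i + j)%N by lia.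
have -> : (a + b.+1 + m == i + j)%N = (a + b + m.+1 == i + j)%N by lia.
case: eqP => _ /=; last by rewrite !mulr0 subr0.
case: (ltngtP b j) => bj.
- rewrite mulrCA Qtop0S; last exact: qpoch_rho2_neq0.
  by rewrite subnS; case: (j - b)%N (subn_gt0 b j) => [|c]; rewrite ?bj //= => _; ring.
- by rewrite !mulr0 subr0.
- rewrite mulrCA Qtop0S; last exact: qpoch_rho2_neq0.
  by rewrite bj subnn; ring.
Qed.

Let PS0 m : P 0 m -> (0 < m -> P 0 m.-1)%N -> P 0 m.+1.
Proof.
move=> Pm Pm1 a b h.
have d0 := one_sub_qrho_neq0 m hq hr.
have h' : (a + b + (m + 0) < i + j)%N by lia.
have third : has_int plane_measure (fun z => qint q m * D m.-1 0 a b z) 0.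
  case: m Pm Pm1 h d0 h' => [|m] Pm Pm1 h d0 h'.
    by apply: has_int_eq (has_int0 _) => // z; rewrite qint0 mul0r.
  have hm : (a + b + (m + 0) < i + j)%N by lia.
  have := has_intZ (qint q m.+1) (Pm1 isT a b (ltnW hm)).
  by rewrite (V0 hm) mulr0.
have tot := has_intB (has_intB (mulx Pm h') (has_intZ (q ^+ m * rho) (muly Pm h'))) third.
apply: has_int_eq (has_intZ (1 - q ^+ m * rho ^+ 2)^-1 tot) => [z|].
  have e := QfunS0 z.1 z.2 d0.
  apply: (mulfI d0); rewrite mulVKf// /D [in RHS]mulrCA e; ring.
by apply: (mulfI d0); rewrite mulVKf// VS0 ?subr0//; lia.
Qed.

Let PSr k : (forall m, P k m) -> (forall m, 0 < k -> P k.-1 m)%N ->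
  forall m, P k.+1 m.
Proof.
move=> Pk Pk1 m a b h.
have h' : (a + b + (m + k) < i + j)%N by lia.
have h'' : (a + b + (m.+1 + k) <= i + j)%N by lia.
have third : has_int plane_measure (fun z => qint q k * D m k.-1 a b z) 0.
  case: k Pk Pk1 h h' h'' => [|k] Pk Pk1 h h' h''.
    by apply: has_int_eq (has_int0 _) => // z; rewrite qint0 mul0r.
  have hm : (a + b + (m + k) < i + j)%N by lia.
  have := has_intZ (qint q k.+1) (Pk1 m isT a b (ltnW hm)).
  by rewrite (V0 hm) mulr0.
have tot := has_intB (has_intB (muly (Pk m) h') third)
  (has_intZ (q ^+ k * rho) (Pk m.+1 a b h'')).
apply: has_int_eq tot => [z|]; first by rewrite /D QfunSr; ring.
rewrite subr0 /V.
have -> : (a + b.+1 + (m + k) == i + j)%N = (a + b + (m + k.+1) == i + j)%N by lia.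
have -> : (a + b + (m.+1 + k) == i + j)%N = (a + b + (m + k.+1) == i + j)%N by lia.
case: eqP => _ /=; last by rewrite mulr0 subr0.
rewrite [Qtop q rho k.+1 m _]/Qtop -/(@Qtop R q rho).
case: (ltngtP b j) => bj.
- by rewrite subnS; case: (j - b)%N (subn_gt0 b j) => [|c]; rewrite ?bj //= => _; ring.
- by rewrite mulr0 subr0.
- by rewrite bj subnn; ring.
Qed.

Lemma has_int_gamma_Q m k : (m + k <= i + j)%N ->
  has_int plane_measure (fun z => qgamma q rho i j z.1 z.2
     * Qfun q rho m k z.1 z.2 * (w z.1 * w z.2))
  (if (m + k == i + j)%N then qfact q i * qfact q j * Qtop q rho k m j else 0).
Proof.
move=> h; have base n : P 0 n /\ P 0 n.+1.
  elim: n => [|n [IH1 IH2]]; split=> //; first by apply: PS0 => //; exact: P00.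
  exact: PS0.
have all n : (forall m, P n m) /\ (forall m, P n.+1 m).
  elim: n => [|n [IH1 IH2]].
    have b0 l : P 0 l by case: (base l).
    by split=> //; exact: PSr.
  by split=> //; apply: PSr.
have [Pk _] := all k; have := Pk m 0%N 0%N h.
apply: has_int_eq => [z|]; first by rewrite /D !qHermite0; ring.
by rewrite /V !add0n andbT subn0.
Qed.

End GammaIntegral.

End Weight.

Section DensityWeight.
Context {R : realType}.
Let mu := @lebesgue_measure R.
Implicit Types (q rho x y : R).

(** The density f_N extended by 0 outside its support. *)
Definition f_N_weight q x : R := if x \in qsupp q then f_N q x else 0.

(** What the integral formulas require of the density: nonnegativity, finite
    moments, total mass 1 and the vanishing of the means of H_n for n > 0. *)
Definition normalized_weight q := [/\ forall x, 0 <= f_N_weight q x,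
  forall p : {poly R},
    mu.-integrable setT (EFin \o (fun x => p.[x] * f_N_weight q x)) &
  forall n, has_int mu (fun x => qHermite q n x * f_N_weight q x) (n == 0%N)%:R].

Lemma measurable_qsupp q : measurable (qsupp q : set (measurableTypeR R)).
Proof. by rewrite /qsupp; case: ifP. Qed.

(** Here f_2D = gamma_00 f_N f_N, and Q_(i,j) gamma_00 = gamma_(i,j). *)
Lemma has_integral2_Q_le q rho i j m k : -1 < q <= 1 -> `|rho| < 1 ->
  normalized_weight q -> (m + k <= i + j)%N ->
  has_integral2 q
    (fun x y => Q q rho i j x y * Q q rho m k x y * f_2D q rho x y)
    (if (m + k == i + j)%N then qfact q i * qfact q j * Qtop q rho k m j else 0).
Proof.
move=> hq hr [w0 wp wH] mk.
have wo x : x \notin qsupp q -> f_N_weight q x = 0.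
  by rewrite /f_N_weight => /negbTE ->.
have [gi gE] := has_int_gamma_Q hq w0 wo wp wH hr mk.
have mD : measurable (qsupp q `*` qsupp q :
    set (measurableTypeR R * measurableTypeR R)).
  by apply: measurableX; exact: measurable_qsupp.
have E : (fun z : measurableTypeR R * measurableTypeR R =>
     (Q q rho i j z.1 z.2 * Q q rho m k z.1 z.2 * f_2D q rho z.1 z.2)%:E)
     \_ (qsupp q `*` qsupp q) =
   EFin \o (fun z => qgamma q rho i j z.1 z.2
     * Qfun q rho m k z.1 z.2 * (f_N_weight q z.1 * f_N_weight q z.2)).
  apply/funext => -[x y] /=; rewrite /patch in_setX /= /f_N_weight.
  case: ifPn => [/andP[xS yS]|]; last first.
    by rewrite negb_and => /orP[] /negbTE ->; rewrite ?mul0r !mulr0.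
  by rewrite xS yS f_2DE// [qgamma q rho i j x y]gamma_Q// -QE//; congr (_%:E); ring.
split.
  by apply/(integrable_mkcond _ mD); rewrite E.
by rewrite integral_mkcond E.
Qed.

Lemma has_integral2_QC q rho i j m k c :
  has_integral2 q (fun x y => Q q rho i j x y * Q q rho m k x y * f_2D q rho x y) c ->
  has_integral2 q (fun x y => Q q rho m k x y * Q q rho i j x y * f_2D q rho x y) c.
Proof.
rewrite (_ : (fun x y => Q q rho m k x y * _ * _) =
  (fun x y => Q q rho i j x y * Q q rho m k x y * f_2D q rho x y))//.
by apply/funext => x; apply/funext => y; rewrite [Q q rho m k x y * _]mulrC.
Qed.

Lemma Q_orthogonal_degree q rho i j m k : -1 < q <= 1 -> `|rho| < 1 ->
  normalized_weight q -> (i + j != m + k)%N ->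
  has_integral2 q
    (fun x y => Q q rho i j x y * Q q rho m k x y * f_2D q rho x y) 0.
Proof.
move=> hq hr nw ne; have [le|lt] := leqP (m + k) (i + j).
  have := has_integral2_Q_le hq hr nw le.
  by rewrite eq_sym (negbTE ne).
apply: has_integral2_QC.
have := has_integral2_Q_le hq hr nw (ltnW lt).
by rewrite (negbTE ne).
Qed.

Lemma qpochD (a : R) q m l :
  qpoch a q (m + l) = qpoch a q m * qpoch (a * q ^+ m) q l.
Proof.
elim: l => [|l IH]; first by rewrite addn0 qpoch0 mulr1.
by rewrite addnS !qpochS IH exprD; ring.
Qed.

(** Setting u = k - v in Qtop_expand and s = j - v in the closed form turns both
    into the same sum over v <= min(j, k). *)
Lemma Qtop_closed_form q rho n j k : -1 < q <= 1 -> `|rho| < 1 ->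
  (j <= n)%N -> (k <= n)%N ->
  qfact q (n - j) * qfact q j * Qtop q rho k (n - k) j =
  (-1) ^ (k%:Z - j%:Z) * (qfact q j * qfact q (n - j))
  / qpoch (rho ^+ 2) q n
  * \sum_(s < j.+1)
      q ^ (binom2 (k%:Z - j%:Z) + s%:Z * (s%:Z - 1)
           + s%:Z * (k%:Z - j%:Z))
      * qbinom q k (k%:Z - j%:Z + s%:Z) * qbinom q (n - j + s)%N s
      * rho ^ (k%:Z - j%:Z + 2 * s%:Z)
      * qpoch (rho ^+ 2 * q ^+ (n - j + s)) q (j - s).
Proof.
move=> hq hr jn kn.
pose F v := (-1) ^+ (k - v) * (q ^+ 'C(k - v, 2) * gbin q k (k - v))
  * (rho ^+ (k - v) * Qtop q rho 0 (n - v) (j - v)).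
have split_sum (G : nat -> R) a b : (forall v, (b <= v)%N -> G v = 0) ->
    \sum_(v < a + b) G v = \sum_(v < b) G v.
  move=> G0; rewrite -(big_mkord xpredT G) (@big_cat_nat _ _ _ b)//=; last exact: leq_addl.
  rewrite (big_mkord xpredT G) [X in _ + X]big1_seq ?addr0// => v.
  by rewrite mem_index_iota => /andP[_ /andP[bv _]]; exact: G0.
have lhs : Qtop q rho k (n - k) j =
    \sum_(v < k.+1) (if (v <= j)%N then F v else 0).
  rewrite Qtop_expand (reindex_inj rev_ord_inj) /=; apply: eq_bigr => v _.
  have vk : (v <= k)%N by rewrite -ltnS.
  rewrite subSS subKn// /F; case: ifP => vj; last by rewrite !mulr0.
  by rewrite (_ : (n - k + (k - v))%N = (n - v)%N)//; lia.
pose G v := (if (v <= k)%N then F v else 0).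
have n0 m : qpoch (rho ^+ 2) q m != 0 by exact: qpoch_rho2_neq0.
have term (v : 'I_j.+1) :
  (-1) ^ (k%:Z - j%:Z) / qpoch (rho ^+ 2) q n *
   (q ^ (binom2 (k%:Z - j%:Z) + (j - v)%N%:Z * ((j - v)%N%:Z - 1)
           + (j - v)%N%:Z * (k%:Z - j%:Z))
      * qbinom q k (k%:Z - j%:Z + (j - v)%N%:Z) * qbinom q (n - j + (j - v))%N (j - v)%N
      * rho ^ (k%:Z - j%:Z + 2 * (j - v)%N%:Z)
      * qpoch (rho ^+ 2 * q ^+ (n - j + (j - v))) q (j - (j - v))) = G v.
  have vj : (v <= j)%N by rewrite -ltnS.
  rewrite /G; case: leqP => [vk|kv]; last first.
    by rewrite qbinom_lt0 ?mulr0 ?mul0r ?mulr0//; lia.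
  set u := (k - v)%N; set s := (j - v)%N.
  have -> : k%:Z - j%:Z = u%:Z - s%:Z by rewrite /u /s; lia.
  have -> : u%:Z - s%:Z + s%:Z = u%:Z by ring.
  have -> : u%:Z - s%:Z + 2 * s%:Z = (u + s)%N%:Z by lia.
  have -> : (n - j + s)%N = (n - v)%N by rewrite /s; lia.
  have -> : (j - s)%N = v by rewrite /s; lia.
  have C2 m : 2 * 'C(m, 2)%:Z = m%:Z * (m%:Z - 1).
    by elim: m => [|m IH]; [rewrite bin0n|rewrite binS bin1 PoszD mulrDr IH; lia].
  have -> : binom2 (u%:Z - s%:Z) + s%:Z * (s%:Z - 1) + s%:Z * (u%:Z - s%:Z)
      = ('C(u, 2) + 'C(s, 2))%N%:Z.
    have -> : binom2 (u%:Z - s%:Z) = 'C(u, 2)%:Z + 'C(s, 2)%:Z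
        - s%:Z * (s%:Z - 1) - s%:Z * (u%:Z - s%:Z).
      rewrite /binom2 (_ : _ * (_ - 1) = ('C(u, 2)%:Z + 'C(s, 2)%:Z
        - s%:Z * (s%:Z - 1) - s%:Z * (u%:Z - s%:Z)) * 2); first by rewrite mulzK.
      have := C2 u; have := C2 s; lia.
    lia.
  rewrite !qbinom_gbin// /F -/u -/s Qtop0E.
  have -> : qpoch (rho ^+ 2) q n =
      qpoch (rho ^+ 2) q (n - v) * qpoch (rho ^+ 2 * q ^+ (n - v)) q v.
    by rewrite -qpochD; congr qpoch; lia.
  have m1 : (-1) ^ (u%:Z - s%:Z) = (-1) ^+ u * (-1) ^+ s :> R.
    rewrite expfzDr ?oppr_eq0 ?oner_eq0//; congr (_ * _).
    by rewrite -exprz_inv invrN1.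
  rewrite m1 -!exprnP !exprD.
  have d1 := n0 (n - v)%N.
  have d2 : qpoch (rho ^+ 2 * q ^+ (n - v)) q v != 0.
    apply: contraNneq (n0 (n - v + v)%N) => d2.
    by rewrite qpochD d2 mulr0.
  by field; rewrite d1 d2.
have rhs : (-1) ^ (k%:Z - j%:Z) / qpoch (rho ^+ 2) q n * \sum_(s < j.+1)
      q ^ (binom2 (k%:Z - j%:Z) + s%:Z * (s%:Z - 1)
           + s%:Z * (k%:Z - j%:Z))
      * qbinom q k (k%:Z - j%:Z + s%:Z) * qbinom q (n - j + s)%N s
      * rho ^ (k%:Z - j%:Z + 2 * s%:Z)
      * qpoch (rho ^+ 2 * q ^+ (n - j + s)) q (j - s) = \sum_(v < j.+1) G v.
  rewrite mulr_sumr (reindex_inj rev_ord_inj) /=; apply: eq_bigr => v _.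
  by rewrite subSS term.
transitivity ((qfact q j * qfact q (n - j)) * \sum_(v < j.+1) G v); last first.
  by rewrite -rhs; ring.
rewrite [qfact q (n - j) * _]mulrC; congr (_ * _); rewrite lhs.
pose K v := if (v <= j)%N then G v else 0.
have -> : \sum_(v < k.+1) (if (v <= j)%N then F v else 0) = \sum_(v < k.+1) K v.
  apply: eq_bigr => v _; have vk : (v <= k)%N by rewrite -ltnS.
  by rewrite /K /G vk.
have -> : \sum_(v < j.+1) G v = \sum_(v < j.+1) K v.
  apply: eq_bigr => v _; have vj : (v <= j)%N by rewrite -ltnS.
  by rewrite /K vj.
rewrite -(split_sum K j.+1) => [|v kv].
  rewrite addnC (split_sum K)// => v jv.
  by rewrite /K leqNgt jv.
by rewrite /K /G [(v <= k)%N]leqNgt kv; case: ifP.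
Qed.

End DensityWeight.

(** * The weight for q = 1 *)

Section GaussianWeight.
Context {R : realType}.
Let mu := @lebesgue_measure R.

(** An integrable derivative has integral 0 if its primitive tends to 0 at both
    ends, which need only be known along the integers. *)
Lemma has_int_derivative0 (f F : R -> R) :
  mu.-integrable setT (EFin \o f) -> continuous f ->
  (forall x, is_derive x (1 : R) F (f x)) ->
  (fun n : nat => F n.+1%:R) @ \oo --> (0 : R) ->
  (fun n : nat => F (- n.+1%:R)) @ \oo --> (0 : R) ->
  has_int mu f 0.
Proof.
move=> fi cf dF F1 F2; split=> //.
have cF : continuous F.
  move=> x; apply: differentiable_continuous; apply/derivable1_diffP.
  by case: (dF x).
pose I n : set R := `[- n.+1%:R, n.+1%:R]%classic.
pose f_ n := (EFin \o f) \_ (I n).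
have mf : measurable_fun (setT : set (measurableTypeR R)) (EFin \o f) by case/integrableP : fi.
have mI n : measurable (I n : set (measurableTypeR R)) by exact: measurable_itv.
have fI n : (\int[mu]_x f_ n x = (F n.+1%:R - F (- n.+1%:R))%:E)%E.
  rewrite -integral_mkcond EFinB; apply: continuous_FTC2.
  - by apply: (@lt_trans _ _ 0); rewrite ?oppr_lt0 ltr0n.
  - by apply: continuous_subspaceT.
  - split.
    + by move=> x _; case: (dF x).
    + by apply: cvg_at_right_filter; exact: cF.
    + by apply: cvg_at_left_filter; exact: cF.
  - by move=> x _; rewrite derive1E; case: (dF x).
have mf_ n : measurable_fun (setT : set (measurableTypeR R)) (f_ n).
  by apply/(measurable_restrict _ (mI n) measurableT); rewrite setTI; exact: measurable_funS mf.
have aef : {ae mu, forall x, setT x -> f_ ^~ x @ \oo --> (EFin \o f) x}.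
  apply: aeW => x _; apply: cvg_near_cst; near=> n.
  rewrite /f_ /patch mem_set// /I /= in_itv /= -ler_norml.
  apply: le_trans (_ : n%:R <= _); last by rewrite ler_nat.
  by near: n; exact: nbhs_infty_ger.
have aeg : {ae mu, forall x n, setT x -> (`|f_ n x| <= (abse \o (EFin \o f)) x)%E}.
  by apply: aeW => x n _; rewrite /f_ /patch; case: ifP => //=; rewrite normr0 lee_fin.
have [_ _ fl] := dominated_convergence measurableT mf_ mf aef (integrable_abse fi) aeg.
rewrite -[LHS](cvg_lim _ fl)//; apply: cvg_lim => //.
under eq_fun do rewrite fI.
apply: cvg_EFin; first exact: nearW.
by apply: (@cvg_lim_eq _ _ (0 - 0)); [rewrite subr0|exact: cvgB].
Unshelve. all: by end_near. Qed.

Lemma pow_le_exp (x : R) n : `|x| ^+ n <= (1 + 4 ^+ n * n`!%:R) * expR (x ^+ 2 / 4).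
Proof.
have y0 : 0 <= x ^+ 2 / 4 by rewrite divr_ge0// sqr_ge0.
have e1 : 1 <= expR (x ^+ 2 / 4) by rewrite -[leLHS]expR0 ler_expR.
have h : (x ^+ 2 / 4) ^+ n <= n`!%:R * expR (x ^+ 2 / 4).
  case: n => [|n]; first by rewrite expr0 mul1r.
  rewrite -ler_pdivrMl ?ltr0n ?fact_gt0// mulrC.
  apply: le_trans (expR_ge1Dxn n y0); by rewrite lerDr.
have h2 : `|x| ^+ n <= 1 + (`|x| ^+ n) ^+ 2.
  have := exprn_ge0 n (normr_ge0 x); nra.
apply: le_trans h2 _; rewrite mulrDl mul1r lerD//.
rewrite -exprM mulnC exprM real_normK ?num_real// -mulrA.
have -> : (x ^+ 2) ^+ n = 4 ^+ n * (x ^+ 2 / 4) ^+ n.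
  by rewrite -exprMn; congr (_ ^+ _); field.
by rewrite ler_wpM2l ?exprn_ge0.
Qed.

Lemma horner_le_exp (p : {poly R}) :
  exists2 C, 0 <= C & forall x, `|p.[x]| <= C * expR (x ^+ 2 / 4).
Proof.
exists (\sum_(i < size p) `|p`_i| * (1 + 4 ^+ i * i`!%:R)).
  by apply: sumr_ge0 => i _; rewrite mulr_ge0// addr_ge0// mulr_ge0// exprn_ge0.
move=> x; rewrite horner_coef mulr_suml; apply: le_trans (ler_norm_sum _ _ _) _.
apply: ler_sum => i _; rewrite normrM normrX -mulrA ler_wpM2l//.
exact: pow_le_exp.
Qed.

Let g (x : R) : R := normal_pdf 0 1 x.

Let gE x : g x = expR (- (x ^+ 2 / 2)) / Num.sqrt (2 * pi).
Proof.
rewrite /g normal_pdfE ?oner_neq0// /normal_peak /normal_fun subr0.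
rewrite expr1n mul1r mulrC mulNr; congr (expR (- (_ / _)) / Num.sqrt _).
by rewrite mulr_natl.
Qed.

Let weight1 x : f_N_weight 1 x = g x.
Proof.
rewrite /f_N_weight in_qsupp// subrr mul0r ler0n /f_N eqxx gE.
by [].
Qed.

Let g_deriv (x : R) : is_derive x (1 : R) g (- x * g x).
Proof.
have -> : g = (fun x => (Num.sqrt (2 * pi))^-1 * expR (- (2^-1) * (x * x))).
  apply/funext => z; rewrite gE mulrC; congr (_ * expR _).
  by rewrite expr2; field.
have dq : is_derive x (1 : R) (fun z : R => - 2^-1 * (z * z)) (- 2^-1 * (x * 1 + x * 1)).
  apply: is_derive_scalef; apply: is_derive_mulf; exact: is_derive_id.
have de : is_derive x (1 : R) (fun z : R => expR (- 2^-1 * (z * z)))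
    (expR (- 2^-1 * (x * x)) * (- 2^-1 * (x * 1 + x * 1))).
  exact: (@is_derive1_comp _ (@expR R) (fun z : R => - 2^-1 * (z * z)) x _ _
    (is_derive_expR _) dq).
apply: is_derive_conv (is_derive_scalef (Num.sqrt (2 * pi))^-1 de).
by field; rewrite gt_eqF// sqrtr_gt0 mulr_gt0// pi_gt0.
Qed.

Lemma qHermite_deriv n (x : R) :
  is_derive x (1 : R) (qHermite 1 n) (n%:R * qHermite 1 n.-1 x).
Proof.
suff: is_derive x (1 : R) (qHermite 1 n) (n%:R * qHermite 1 n.-1 x) /\
  is_derive x (1 : R) (qHermite 1 n.+1) (n.+1%:R * qHermite 1 n x) by case.
elim: n => [|n [IH1 IH2]].
  split; first by rewrite mul0r; exact: is_derive_cst.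
  rewrite qHermite0 mulr1 (_ : qHermite 1 1 = id); first exact: is_derive_id.
  by apply/funext => z; rewrite qHermite1.
split=> //.
rewrite (_ : qHermite 1 n.+2 = (fun z => z * qHermite 1 n.+1 z
  - qint 1 n.+1 * qHermite 1 n z)); last by apply/funext => z; rewrite qHermiteS.
apply: is_derive_conv (is_derive_subf (is_derive_mulf (is_derive_id x 1) IH2)
  (is_derive_scalef (qint 1 n.+1) IH1)).
rewrite (qHermiteS 1 n x) !qint_at1 -[n.+2%:R]natr1 -[n.+1%:R]natr1.
ring.
Qed.

Lemma normalized_weight_q1 : normalized_weight (1 : R).
Proof.
pose s2 : R := Num.sqrt 2.
have s20 : s2 != 0 by rewrite gt_eqF// sqrtr_gt0.
pose c : R := normal_peak 1 / normal_peak s2.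
have gs x : expR (x ^+ 2 / 4) * g x = c * normal_pdf 0 s2 x.
  rewrite gE normal_pdfE// /c [RHS]mulrA.
  have pk : normal_peak s2 != 0 by rewrite gt_eqF// normal_peak_gt0.
  rewrite divfK// /normal_peak expr1n mul1r -[pi *+ 2]mulr_natl /normal_fun subr0.
  rewrite sqr_sqrtr// [RHS]mulrC mulrA -expRD; congr (expR _ / _).
  by rewrite -mulr_natl; field.
have c0 : 0 <= c by rewrite divr_ge0// normal_peak_ge0.
clearbody c.
have g0 x : 0 <= g x by exact: normal_pdf_ge0.
have mg : measurable_fun setT g by exact: measurable_normal_pdf.
have pint (p : {poly R}) : mu.-integrable setT (EFin \o (fun x => p.[x] * g x)).
  have [C C0 HC] := horner_le_exp p.
  apply: (@le_integrable _ _ _ mu setT measurableT _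
    (fun x => (C * c)%:E * (normal_pdf 0 s2 x)%:E)%E).
  - apply/measurable_EFinP; apply: measurable_funM => //.
    by apply: continuous_measurable_fun; exact: continuous_horner.
  - move=> x _ /=; rewrite lee_fin -[C * c * _]mulrA -gs.
    rewrite !normrM (ger0_norm (g0 x)) (ger0_norm C0) (ger0_norm (expR_ge0 _)) mulrA.
    by rewrite ler_wpM2r.
  - by apply: integrableZl => //; exact: integrable_normal_pdf.
have wE : f_N_weight 1 = g by apply/funext => x; exact: weight1.
split; rewrite wE//.
case=> [|n].
  split; last by under eq_integral do rewrite qHermite0 mul1r; exact: integral_normal_pdf.
  have := pint 1; congr (_.-integrable _ _).
  by apply/funext => x /=; rewrite hornerC qHermite0.
have [p Hp] := polyfun_qHermite (1 : R) n.+1; have [r Hr] := polyfun_qHermite (1 : R) n.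
(* H_(n+1) g is the derivative of - H_n g. *)
have Hfun : (fun x => qHermite 1 n.+1 x * g x) = (fun x => p.[x] * g x).
  by apply/funext => x; rewrite Hp.
have [C C0 HC] := horner_le_exp r.
have Flim (e : R) : e ^+ 2 = 1 ->
    (fun m : nat => - (qHermite 1 n (e * m.+1%:R) * g (e * m.+1%:R))) @ \oo --> (0 : R).
  move=> e1; pose K := C * (c * normal_peak s2) * 4.
  have bnd m : `|- (qHermite 1 n (e * m.+1%:R) * g (e * m.+1%:R))| <= K * m.+1%:R^-1.
    set x := e * _; have x2 : x ^+ 2 = m.+1%:R ^+ 2 by rewrite exprMn e1 mul1r.
    rewrite normrN normrM (ger0_norm (g0 x)) Hr.
    apply: (@le_trans _ _ (C * expR (x ^+ 2 / 4) * g x)); first by rewrite ler_wpM2r.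
    rewrite -mulrA gs /K -!mulrA ler_wpM2l// ler_wpM2l//.
    rewrite normal_pdfE// ler_wpM2l ?normal_peak_ge0//.
    rewrite /normal_fun subr0 sqr_sqrtr// x2.
    have m0 : 0 < m.+1%:R :> R by rewrite ltr0n.
    rewrite mulNr expRN -lef_pV2 ?posrE ?invr_gt0 ?expR_gt0 ?divr_gt0 ?mulr_gt0 ?invr_gt0//.
    rewrite invrK invfM invrK.
    apply: le_trans (expR_ge1Dx _); rewrite -[2 *+ 2]mulr_natl.
    have := sqr_ge0 (m.+1%:R - 1 : R); rewrite expr2; set z := m.+1%:R.
    rewrite expr2; nra.
  have Kl : (fun m : nat => K * m.+1%:R^-1) @ \oo --> (0 : R).
    by apply: (@cvg_lim_eq _ _ (K * 0)); [rewrite mulr0|apply: cvgMl_tmp; exact: cvg_harmonic].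
  apply: (@squeeze_cvgr _ _ _ _ (fun m : nat => - (K * m.+1%:R^-1)) (fun m : nat => K * m.+1%:R^-1)) => //.
    by near=> m; rewrite -ler_norml.
  by apply: (cvg_lim_eq (oppr0 _)); exact: cvgN.
apply: (@has_int_derivative0 _ (fun x => - (qHermite 1 n x * g x))).
- by rewrite Hfun.
- rewrite Hfun => x; apply: cvgM; first exact: continuous_horner.
  by apply: continuous_normal_pdf; exact: oner_neq0.
- move=> x; have := is_derive_scalef (-1) (is_derive_mulf (qHermite_deriv n x) (g_deriv x)).
  rewrite (_ : (fun z => -1 * _) = (fun z => - (qHermite 1 n z * g z))); last first.
    by apply/funext => z; rewrite mulN1r.
  by apply: is_derive_conv; rewrite qHermiteS qint_at1; ring.
- by have := Flim 1 (expr1n _ _); under eq_fun do rewrite mul1r.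
- have := Flim (-1) _; rewrite sqrrN expr1n => /(_ erefl).
  by under eq_fun do rewrite mulN1r.
Unshelve. all: by end_near. Qed.

End GaussianWeight.

(** * The semicircle law *)

Section Semicircle.
Context {R : realType}.
Let mu := @lebesgue_measure R.

Let restrict_segment (f : R -> R) (b : R) : (forall x, b < `|x| -> f x = 0) ->
  (EFin \o f) \_ `[- b, b] = EFin \o f.
Proof.
move=> fo; apply/funext => x; rewrite /patch; case: ifPn => // /negP xb /=.
rewrite fo// ltNge; apply/negP => h; apply: xb; apply/mem_set.
by rewrite /= in_itv /= -ler_norml.
Qed.

Lemma integrable_segment (f : R -> R) (b : R) : continuous f ->
  (forall x, b < `|x| -> f x = 0) -> mu.-integrable setT (EFin \o f).
Proof.
move=> cf fo; rewrite -(restrict_segment fo).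
have mI : measurable (`[- b, b]%classic : set (measurableTypeR R)).
  exact: measurable_itv.
apply/(integrable_mkcond _ mI).
apply: continuous_compact_integrable; first exact: segment_compact.
exact: continuous_subspaceT.
Qed.

(** The fundamental theorem of calculus for a function supported in a segment,
    its primitive being differentiable inside. *)
Lemma has_int_segment (f F : R -> R) (b : R) : 0 < b -> continuous f ->
  (forall x, b < `|x| -> f x = 0) ->
  (forall x, `|x| < b -> is_derive x (1 : R) F (f x)) ->
  F @ (- b)^'+ --> F (- b) -> F @ b^'- --> F b ->
  has_int mu f (F b - F (- b)).
Proof.
move=> b0 cf fo dF Fl Fr.
have bb : - b < b by rewrite gtrN.
split; first exact: integrable_segment fo.
rewrite -[LHS]/(\int[mu]_x (EFin \o f) x)%E -(restrict_segment fo) -integral_mkcond EFinB.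
have inb x : x \in `](- b), b[%R -> `|x| < b by rewrite in_itv /= ltr_norml.
apply: continuous_FTC2 => //.
- exact: continuous_subspaceT.
- by split=> // x /inb xb; case: (dF x xb).
- by move=> x /inb xb; rewrite derive1E; case: (dF x xb).
Qed.

(** The polynomial U_n(y / 2), where U_n is the Chebyshev polynomial of the second
    kind. *)
Fixpoint cheb n (y : R) : R :=
  if n is m.+1 then y * cheb m y - (if m is p.+1 then cheb p y else 0) else 1.

Lemma chebSS n y : cheb n.+2 y = y * cheb n.+1 y - cheb n y.
Proof. by []. Qed.

Lemma cheb0 y : cheb 0 y = 1. Proof. by []. Qed.

Lemma cheb1 y : cheb 1 y = y. Proof. by rewrite /= subr0 mulr1. Qed.

Lemma chebS n y : cheb n.+1 y = y * cheb n y - (0 < n)%N%:R * cheb n.-1 y.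
Proof. by case: n => [|n]; rewrite ?cheb1 ?chebSS /= ?mul0r ?subr0 ?mulr1 ?mul1r. Qed.

Arguments cheb : simpl never.

Lemma polyfun_cheb n : polyfun (cheb n).
Proof.
suff: polyfun (cheb n) /\ polyfun (cheb n.+1) by case.
elim: n => [|n [[p Hp] [r Hr]]].
  split; first exact: polyfun_cst.
  by exists 'X => x; rewrite cheb1 hornerX.
split; first by exists r.
by exists ('X * r - p) => x; rewrite chebSS Hp Hr hornerD hornerN hornerM hornerX.
Qed.

Lemma polyfun_continuous (f : R -> R) : polyfun f -> continuous f.
Proof.
move=> [p Hp]; rewrite (_ : f = horner p); last exact/funext.
exact: continuous_horner.
Qed.

(** The first-order differential relation between consecutive polynomials. *)
Lemma cheb_deriv n (y : R) : exists2 d, is_derive y (1 : R) (cheb n) d &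
  (4 - y ^+ 2) * d = n.+2%:R * (y * cheb n y) - 2 * n.+1%:R * cheb n.+1 y.
Proof.
suff: (exists2 d, is_derive y (1 : R) (cheb n) d &
   (4 - y ^+ 2) * d = n.+2%:R * (y * cheb n y) - 2 * n.+1%:R * cheb n.+1 y) /\
  (exists2 d, is_derive y (1 : R) (cheb n.+1) d &
   (4 - y ^+ 2) * d = n.+3%:R * (y * cheb n.+1 y) - 2 * n.+2%:R * cheb n.+2 y)
  by case.
elim: n => [|n [[d Hd ed] [e He ee]]].
  split.
    exists 0; first exact: is_derive_cst.
    by rewrite cheb0 cheb1; ring.
  exists 1; last by rewrite chebSS cheb1 cheb0; ring.
  rewrite (_ : cheb 1 = id); first exact: is_derive_id.
  by apply/funext => z; rewrite cheb1.
split; first by exists e.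
exists (y * e + cheb n.+1 y * 1 - d).
  rewrite (_ : cheb n.+2 = (fun z => z * cheb n.+1 z - cheb n z))//.
  by apply: is_derive_subf => //; apply: is_derive_mulf => //; exact: is_derive_id.
transitivity (y * ((4 - y ^+ 2) * e) + (4 - y ^+ 2) * cheb n.+1 y
  - (4 - y ^+ 2) * d); first by ring.
rewrite ee ed (chebSS n.+1) (chebSS n) -[n.+4%:R]natr1 -[n.+3%:R]natr1 -[n.+2%:R]natr1 -[n.+1%:R]natr1.
by ring.
Qed.

Context (q : R) (hq : -1 < q <= 1) (qlt1 : q < 1).

Let p0 : 0 < 1 - q. Proof. by rewrite subr_gt0. Qed.
Let k := Num.sqrt (1 - q).
Let k0 : 0 < k. Proof. by rewrite sqrtr_gt0. Qed.
Let kk : k ^+ 2 = 1 - q. Proof. by rewrite sqr_sqrtr// ltW. Qed.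
Let b := 2 / k.
Let b0 : 0 < b. Proof. by rewrite divr_gt0. Qed.

(** The factor of f_N in front of the infinite product. *)
Definition semicircle (x : R) := Num.sqrt ((1 - q) * (4 - (1 - q) * x ^+ 2)).
Local Notation sc := semicircle.

Let yb x : (`|x| < b) = (`|k * x| < 2).
Proof. by rewrite normrM gtr0_norm// /b ltr_pdivlMr// mulrC. Qed.

Let A_gt0 x : `|x| < b -> 0 < 4 - (1 - q) * x ^+ 2.
Proof.
rewrite yb -kk -exprMn => h; rewrite subr_gt0 -real_normK ?num_real//.
have := normr_ge0 (k * x); nra.
Qed.

Let sc_out x : b < `|x| -> sc x = 0.
Proof.
move=> h; rewrite /sc ler0_sqrtr// pmulr_rle0// subr_le0 -kk -exprMn.
have : 2 < `|k * x| by rewrite normrM gtr0_norm// mulrC -ltr_pdivrMr.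
rewrite -real_normK ?num_real//; have := normr_ge0 (k * x); nra.
Qed.

Lemma semicircle_continuous : continuous sc.
Proof.
have [r Hr] : polyfun (fun x => (1 - q) * (4 - (1 - q) * x ^+ 2)).
  by exists ((1 - q)%:P * (4%:P - (1 - q)%:P * 'X^2)) => z; rewrite !hornerE.
rewrite (_ : sc = (fun x => Num.sqrt r.[x])); last first.
  by apply/funext => z; rewrite /sc -Hr.
move=> x; apply: continuous_cvg; first exact: sqrt_continuous.
exact: continuous_horner.
Qed.

Let sc2 x : `|x| < b -> sc x ^+ 2 = (1 - q) * (4 - (1 - q) * x ^+ 2).
Proof. by move=> /A_gt0 h; rewrite sqr_sqrtr// mulr_ge0// ltW. Qed.

Let sc_gt0 x : `|x| < b -> 0 < sc x.
Proof. by move=> /A_gt0 h; rewrite sqrtr_gt0 mulr_gt0. Qed.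

Let sc_deriv x : `|x| < b -> is_derive x (1 : R) sc (- ((1 - q) ^+ 2 * x) / sc x).
Proof.
move=> xb; have A0 := A_gt0 xb; have s0 := sc_gt0 xb.
have dc (c : R) : is_derive x (1 : R) (fun=> c) 0 by exact: is_derive_cst.
have dA : is_derive x (1 : R) (fun z => (1 - q) * (4 - (1 - q) * (z * z)))
    ((1 - q) * (0 - (1 - q) * (x * 1 + x * 1))).
  exact: (is_derive_scalef (1 - q) (is_derive_subf (dc 4) (is_derive_scalef (1 - q)
    (is_derive_mulf (is_derive_id x (1 : R)) (is_derive_id x (1 : R)))))).
have H0 : 0 < (1 - q) * (4 - (1 - q) * (x * x)) by rewrite -expr2 mulr_gt0.
have H : is_derive x (1 : R) (fun z => Num.sqrt ((1 - q) * (4 - (1 - q) * (z * z))))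
   ((2 * Num.sqrt ((1 - q) * (4 - (1 - q) * (x * x))))^-1
     * ((1 - q) * (0 - (1 - q) * (x * 1 + x * 1)))).
  exact: (@is_derive1_comp _ (@Num.sqrt R)
    (fun z : R => (1 - q) * (4 - (1 - q) * (z * z))) x _ _ (is_derive1_sqrt H0) dA).
rewrite (_ : sc = (fun z => Num.sqrt ((1 - q) * (4 - (1 - q) * (z * z)))))//.
apply: is_derive_conv H; rewrite -!expr2 -/(sc x).
by field; rewrite gt_eqF.
Qed.

Let kb : k * b = 2. Proof. by rewrite /b mulrC divfK// gt_eqF. Qed.

Let A_b : 4 - (1 - q) * b ^+ 2 = 0.
Proof. by rewrite -kk -exprMn kb; ring. Qed.

Let sc_b : sc b = 0. Proof. by rewrite /sc A_b mulr0 sqrtr0. Qed.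
Let sc_Nb : sc (- b) = 0. Proof. by rewrite /sc sqrrN A_b mulr0 sqrtr0. Qed.

Let asin_cvg (F : set_system R) (l : R) : Filter F -> (fun x => k * x / 2) @ F --> l ->
  (\forall x \near F, `|x| <= b) -> -1 <= l <= 1 ->
  (fun x => asin (k * x / 2)) @ F --> asin l.
Proof.
move=> FF Fl Fb l1.
have ca : {within `[(- 1)%R, 1%R], continuous (@asin R)}.
  have pi0 := pi_ge0 R.
  have := @segment_can_le_continuous R (- (pi / 2)) (pi / 2) sin asin.
  rewrite sinN sin_pihalf; apply; first by lra.
    by apply: continuous_subspaceT => z; exact: continuous_sin.
  by move=> z zi; apply: sinK.
move/subspace_continuousP : ca => /(_ l) ca.
apply: (@cvg_comp _ _ _ (fun x => k * x / 2) (@asin R) F (within `[(- 1)%R, 1%R] (nbhs l))); last first.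
  by apply: ca; rewrite /= in_itv.
move=> P wP.
have h : F [set x | `[(- 1)%R, 1%R]%classic (k * x / 2) -> P (k * x / 2)] := Fl _ wP.
change (F [set x | P (k * x / 2)]).
apply: (@filterS2 _ F FF _ _ _ _ Fb h) => x xb; apply.
rewrite /= in_itv /= -ler_norml normrM normfV (@gtr0_norm _ 2)// ler_pdivrMr// mul1r.
by rewrite normrM gtr0_norm// mulrC -ler_pdivlMr.
Qed.

Lemma has_int_semicircle : has_int mu sc (2 * pi).
Proof.
pose G x : R := x * sc x / 2 + 2 * asin (k * x / 2).
have n2 : (2 : R) != 0 by [].
have asin1 : asin 1 = pi / 2 :> R.
  rewrite -[X in asin X]sin_pihalf; apply: sinK; rewrite in_itv /= lexx andbT.
  by have := pi_ge0 R; lra.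
have asinN1 : asin (- 1) = - (pi / 2) :> R.
  rewrite -[X in asin (- X)]sin_pihalf -sinN; apply: sinK; rewrite in_itv /= lexx /=.
  by have := pi_ge0 R; lra.
have kc (z : R) : (fun x => k * x / 2) @ z --> k * z / 2.
  by apply: cvgMr_tmp; apply: cvgMl_tmp.
have xs (z : R) : (fun x => x * sc x / 2) @ z --> z * sc z / 2.
  by apply: cvgMr_tmp; apply: cvgM => //; exact: semicircle_continuous.
have -> : 2 * pi = G b - G (- b).
  have e1 : k * b / 2 = 1 by rewrite kb divff.
  have e2 : k * - b / 2 = - 1 by rewrite mulrN kb mulNr divff.
  by rewrite /G sc_b sc_Nb e1 e2 asin1 asinN1; field.
apply: has_int_segment => //.
- exact: semicircle_continuous.
- move=> x xb; have s0 := sc_gt0 xb; have s2 := sc2 xb.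
  have y1 : -1 < k * x / 2 < 1.
    move: xb; rewrite yb ltr_norml => /andP[h1 h2].
    by rewrite ltr_pdivlMr// ltr_pdivrMr// mulN1r mul1r h1.
  have dl : is_derive x (1 : R) (fun z => k * z / 2) (k / 2).
    rewrite (_ : (fun z => _) = (fun z => (k / 2) * z)); last by apply/funext => z; ring.
    apply: (is_derive_conv (mulr1 _)); apply: is_derive_scalef; exact: is_derive_id.
  have da : is_derive x (1 : R) (fun z => asin (k * z / 2))
      ((Num.sqrt (1 - (k * x / 2) ^+ 2))^-1 * (k / 2)).
    exact: (@is_derive1_comp _ (@asin R) (fun z : R => k * z / 2) x _ _
      (is_derive1_asin y1) dl).
  have sE : Num.sqrt (1 - (k * x / 2) ^+ 2) = sc x / (2 * k).
    rewrite -[RHS]ger0_norm ?divr_ge0 ?(ltW s0)// ?mulr_ge0 ?(ltW k0)//.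
    rewrite -sqrtr_sqr; congr Num.sqrt; rewrite !expr_div_n s2 -kk; field.
    by rewrite gt_eqF.
  rewrite sE in da.
  have dx := is_derive_mulf (is_derive_id x (1 : R)) (sc_deriv xb).
  have dx2 := is_derive_scalef 2^-1 dx.
  have := is_derive_addf dx2 (is_derive_scalef 2 da).
  rewrite (_ : (fun z => _) = G); last first.
    by apply/funext => z; rewrite /G [2^-1 * _]mulrC.
  apply: is_derive_conv.
  apply: (mulIf (lt0r_neq0 s0)); rewrite -expr2 s2.
  transitivity ((sc x ^+ 2 - (1 - q) ^+ 2 * x ^+ 2) / 2 + 2 * k ^+ 2).
    by field; rewrite !gt_eqF.
  by rewrite s2 kk; field.
- apply: cvgD; first exact: (cvg_at_right_filter (xs (- b))).
  apply: cvgMl_tmp; apply: asin_cvg.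
  + exact: (cvg_at_right_filter (kc (- b))).
  + near=> x; rewrite ler_norml; apply/andP; split.
      by apply: ltW; near: x; exact: nbhs_right_gt.
    by apply: ltW; near: x; apply: nbhs_right_lt; rewrite gtrN.
  + by rewrite mulrN kb mulNr divff// lexx /=; lra.
- apply: cvgD; first exact: (cvg_at_left_filter (xs b)).
  apply: cvgMl_tmp; apply: asin_cvg.
  + exact: (cvg_at_left_filter (kc b)).
  + near=> x; rewrite ler_norml; apply/andP; split.
      by apply: ltW; near: x; apply: nbhs_left_gt; rewrite gtrN.
    by apply: ltW; near: x; exact: nbhs_left_lt.
  + by rewrite kb divff// lexx andbT; lra.
Unshelve. all: by end_near. Qed.

Lemma cheb_semicircle_continuous n : continuous (fun x => cheb n (k * x) * sc x).
Proof.
move=> x; apply: cvgM; last exact: semicircle_continuous.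
apply: continuous_cvg; first exact: polyfun_continuous (polyfun_cheb n) _.
exact: cvgMl_tmp.
Qed.

(* With y = k x, the integrand is the derivative of (4 - y^2)^(3/2) U_n(y / 2),
   which vanishes at both ends of the support. *)
Let step n : has_int mu (fun x => (n.+1%:R - 2) * (k * x * (cheb n (k * x) * sc x))
   - 2 * n.+1%:R * (cheb n.+1 (k * x) * sc x)) 0.
Proof.
pose F x : R := k^-1 * ((4 - (1 - q) * (x * x)) * (sc x * cheb n (k * x))).
have cF : continuous F.
  move=> x; apply: cvgMl_tmp; apply: cvgM.
    apply: cvgB; first exact: cvg_cst.
    by apply: cvgMl_tmp; apply: cvgM.
  under eq_fun do rewrite mulrC; rewrite mulrC; exact: cheb_semicircle_continuous.
have e0 : (0 : R) = F b - F (- b).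
  by rewrite /F mulrNN -expr2 A_b !(mul0r, mulr0) subr0.
pose f x := (n.+1%:R - 2) * (k * x * (cheb n (k * x) * sc x))
   - 2 * n.+1%:R * (cheb n.+1 (k * x) * sc x).
suff seg : has_int mu f (F b - F (- b)) by rewrite -e0 in seg.
apply: (@has_int_segment f F b b0).
- move=> x; apply: cvgB; apply: cvgMl_tmp; last exact: cheb_semicircle_continuous.
  apply: cvgM; last exact: cheb_semicircle_continuous.
  exact: cvgMl_tmp.
- by move=> x /sc_out e; rewrite /f e !mulr0 subr0.
- move=> x xb; have s0 := sc_gt0 xb; have s2 := sc2 xb.
  have [d dU ed] := cheb_deriv n (k * x).
  have dl : is_derive x (1 : R) (fun z => k * z) (k * 1).
    by apply: is_derive_scalef; exact: is_derive_id.
  have dc : is_derive x (1 : R) (fun z => cheb n (k * z)) (d * (k * 1)).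
    exact: (@is_derive1_comp _ (cheb n) (fun z : R => k * z) x _ _ dU dl).
  have dA : is_derive x (1 : R) (fun z => 4 - (1 - q) * (z * z))
      (0 - (1 - q) * (x * 1 + x * 1)).
    have d4 : is_derive x (1 : R) (fun=> 4 : R) 0 by exact: is_derive_cst.
    exact: (is_derive_subf d4 (is_derive_scalef (1 - q)
      (is_derive_mulf (is_derive_id x (1 : R)) (is_derive_id x (1 : R))))).
  have H := is_derive_scalef k^-1 (is_derive_mulf dA (is_derive_mulf (sc_deriv xb) dc)).
  apply: is_derive_conv H.
  have ks : k != 0 by rewrite gt_eqF.
  have A4 : 4 - (1 - q) * (x * x) = sc x ^+ 2 / k ^+ 2.
    by rewrite s2 -expr2 kk [RHS]mulrC mulKf// gt_eqF.
  rewrite {1}A4 mulr1.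
  transitivity (sc x * ((4 - (1 - q) * (x * x)) * d) - 3 * (k * x) * sc x * cheb n (k * x)).
    rewrite A4 -kk; by field; rewrite ks gt_eqF.
  rewrite (_ : 4 - (1 - q) * (x * x) = 4 - (k * x) ^+ 2); last by rewrite exprMn kk expr2.
  rewrite ed /f -[n.+2%:R]natr1; ring.
- exact: cvg_at_right_filter (cF _).
- exact: cvg_at_left_filter (cF _).
Qed.

Lemma has_int_cheb_semicircle n :
  has_int mu (fun x => cheb n (k * x) * sc x) (2 * pi * (n == 0)%:R).
Proof.
suff: has_int mu (fun x => cheb n (k * x) * sc x) (2 * pi * (n == 0)%:R) /\
  has_int mu (fun x => cheb n.+1 (k * x) * sc x) 0 by case.
elim: n => [|n [IH1 IH2]].
  split.
    by apply: has_int_eq has_int_semicircle => [x|]; rewrite ?cheb0 ?mul1r ?mulr1.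
  apply: has_int_eq (has_intZ (- 3^-1) (step 0)) => [x|]; last by rewrite mulr0.
  by rewrite cheb0 cheb1; field.
split; first by rewrite mulr0.
have h := has_intZ (- (n.+4%:R)^-1)
  (has_intB (step n.+1) (has_intZ (n.+2%:R - 2) IH1)).
apply: has_int_eq h => [x|].
  rewrite chebSS -[n.+4%:R]natr1 -[n.+3%:R]natr1 -[n.+2%:R]natr1; field.
  by rewrite gt_eqF// !addr_gt0// ltr0n.
by case: n {IH1 IH2} => [|n]; rewrite ?subrr ?mul0r /= ?mulr0 ?mulr0 ?subrr ?mulr0.
Qed.

Lemma integrable_semicircle (f : R -> R) : continuous f ->
  mu.-integrable setT (EFin \o (fun x => f x * sc x)).
Proof.
move=> cf; apply: (@integrable_segment _ b).
  by move=> x; apply: cvgM; [exact: cf|exact: semicircle_continuous].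
by move=> x /sc_out ->; rewrite mulr0.
Qed.

Lemma has_int_cheb_orthogonal m n :
  has_int mu (fun x => cheb m (k * x) * cheb n (k * x) * sc x)
    (2 * pi * (m == n)%:R).
Proof.
have e : \prod_(i < m) (0 < i.+1)%N%:R = 1 :> R by rewrite big1.
have := @favard_has_int _ mu (fun n x => cheb n (k * x)) (fun n => (0 < n)%N%:R)
  k (2 * pi) sc erefl (fun x => cheb0 _) _ _ _ m n.
rewrite e mulr1; apply.
- by move=> i x; rewrite chebS.
- move=> i j; apply: integrable_semicircle => x.
  by apply: cvgM; apply: continuous_cvg => //;
    [exact: polyfun_continuous (polyfun_cheb i) _|exact: cvgMl_tmp|
     exact: polyfun_continuous (polyfun_cheb j) _|exact: cvgMl_tmp].
- exact: has_int_cheb_semicircle.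
Qed.

End Semicircle.

Arguments cheb : simpl never.

(** * The weight for |q| < 1 *)

Section TripleProduct.
Context {R : realType}.
Context (q : R) (hq : -1 < q <= 1).
Implicit Types (n k m : nat) (y z : R).

Lemma gbin_sym n k : (k <= n)%N -> gbin q n k = gbin q n (n - k).
Proof.
by move=> kn; rewrite !gbinE ?leq_subr// subKn// [X in _ / X]mulrC.
Qed.

Lemma gbinSl n k : (k <= n)%N ->
  gbin q n.+1 k.+1 = gbin q n k + q ^+ k.+1 * gbin q n k.+1.
Proof.
rewrite leq_eqVlt => /predU1P[->|kn].
  by rewrite gbinS !(gbin_small _ (ltnSn n)) subnn expr0 mul1r mulr0 add0r addr0.
rewrite (gbin_sym (leqW kn)) subSS -(subnSK kn) gbinS (subnSK kn).
rewrite -(gbin_sym (ltnW kn)) -(gbin_sym kn); congr (_ + q ^+ _ * _); lia.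
Qed.

(** Gaussian binomials counted from the middle of an odd row. *)
Definition midbin n k : R := if (k <= n)%N then gbin q n.*2.+1 (n - k) else 0.

Let midbin_rec n k : (k <= n)%N -> midbin n.+1 k.+1 =
  (1 + q ^+ (n.+1 + n.+1)) * midbin n k.+1 + q ^+ (n - k) * midbin n k
  + q ^+ (n + k).+3 * midbin n k.+2.
Proof.
move=> kn; rewrite /midbin ltnS kn doubleS subSS.
have [|nk] := ltnP k n; last first.
  have -> : k = n by lia.
  by rewrite subnn !gbin0 (_ : (n.+1 < n)%N = false) ?expr0; [ring|lia].
move=> kn'; rewrite -(subnSK kn') gbinS.
have -> : (n.*2.+2 - (n - k.+1) = (n + k).+3)%N by lia.
rewrite gbinSl; last by lia.
have [kn2|nk2] := ltnP k.+1 n; last first.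
  have -> : n = k.+1 by lia.
  rewrite subnn !gbin0 !mulr1.
  by rewrite (_ : ((k.+1 + k).+3 = k.+2 + k.+2)%N); [ring|lia].
rewrite -(subnSK kn2) [gbin q n.*2.+2 _]gbinSl; last by lia.
rewrite (_ : (n.+1 + n.+1 = (n + k).+3 + (n - k.+2).+1)%N); last by lia.
rewrite exprD; ring.
Qed.

Let midbin_rec0 n : midbin n.+1 0 =
  (1 + q ^+ n.+1 + q ^+ (n.+1 + n.+1)) * midbin n 0 + q ^+ n.+2 * midbin n 1.
Proof.
rewrite /midbin !leq0n !subn0 doubleS gbinS gbinSl; last by lia.
have -> : (n.*2.+2 - n = n.+2)%N by lia.
rewrite [gbin q n.*2.+1 n.+1]gbin_sym; last by lia.
have -> : (n.*2.+1 - n.+1 = n)%N by lia.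
case: n => [|n]; first by rewrite !gbin0 mulr0 !addr0 !exprD !exprS expr0; ring.
rewrite [gbin q n.+1.*2.+2 n.+1]gbinSl ?subSS ?subn0 /=; last by lia.
by rewrite (_ : (n.+2 + n.+2 = n.+3 + n.+1)%N) ?exprD; [ring|lia].
Qed.

(** The coefficients in the finite triple product. *)
Definition tpc n k : R := (-1) ^+ k * (q ^+ 'C(k.+1, 2) * midbin n k).

Lemma tpc_small n k : (n < k)%N -> tpc n k = 0.
Proof. by move=> nk; rewrite /tpc /midbin leqNgt nk !mulr0. Qed.

Let tpcS n k : let z := q ^+ n.+1 in
  tpc n.+1 k.+1 = (1 + z ^+ 2) * tpc n k.+1 - z * (tpc n k + tpc n k.+2).
Proof.
move=> z; have [kn|nk] := leqP k n; last first.
  by rewrite !tpc_small; [ring|lia..].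
rewrite /tpc midbin_rec// /z -exprM muln2 -addnn.
have e1 : q ^+ 'C(k.+2, 2) * q ^+ (n - k) = q ^+ n.+1 * q ^+ 'C(k.+1, 2).
  by rewrite -!exprD binS bin1; congr (q ^+ _); lia.
have e2 : q ^+ 'C(k.+2, 2) * q ^+ (n + k).+3 = q ^+ n.+1 * q ^+ 'C(k.+3, 2).
  by rewrite -!exprD [in RHS]binS bin1; congr (q ^+ _); lia.
transitivity ((-1) ^+ k.+1 * ((1 + q ^+ (n.+1 + n.+1))
    * (q ^+ 'C(k.+2, 2) * midbin n k.+1)
  + (q ^+ 'C(k.+2, 2) * q ^+ (n - k)) * midbin n k
  + (q ^+ 'C(k.+2, 2) * q ^+ (n + k).+3) * midbin n k.+2)); first by ring.
by rewrite e1 e2 !(exprS (-1)); ring.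
Qed.

Let tpc0S n : let z := q ^+ n.+1 in
  tpc n.+1 0 = (1 + z + z ^+ 2) * tpc n 0 - z * tpc n 1.
Proof.
move=> z; rewrite /tpc midbin_rec0 /z -exprM muln2 -addnn expr0 expr1.
rewrite (_ : 'C(1, 2) = 0%N)// (_ : 'C(2, 2) = 1%N)// expr0 expr1 [q ^+ n.+2]exprS; ring.
Qed.

(* Summation by parts for the multiplication by (1 + z)^2 - y^2 z, which acts as
   a tridiagonal matrix on the V k = U_(2k)(y / 2). *)
Let tridiagonal_sum (a V : nat -> R) z N :
  a 0%N * ((1 + z + z ^+ 2) * V 0%N - z * V 1%N)
  + \sum_(k < N) a k.+1 * ((1 + z ^+ 2) * V k.+1 - z * (V k.+2 + V k))
  = ((1 + z + z ^+ 2) * a 0%N - z * a 1%N) * V 0%N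
  + \sum_(k < N) ((1 + z ^+ 2) * a k.+1 - z * (a k + a k.+2)) * V k.+1
  + (z * a N.+1 * V N - z * a N * V N.+1).
Proof.
elim: N => [|N IH]; first by rewrite !big_ord0; ring.
by rewrite !big_ord_recr /= addrA IH; ring.
Qed.

(** The finite form of the Jacobi triple product: the truncated product in the
    density, expanded in Chebyshev polynomials of even index. *)
Lemma triple_product_finite n y :
  \prod_(1 <= j < n.+1) ((1 + q ^+ j) ^+ 2 - y ^+ 2 * q ^+ j)
  = \sum_(k < n.+1) tpc n k * cheb k.*2 y.
Proof.
elim: n => [|n IH].
  rewrite big_nil big_ord_recr big_ord0 /= add0r /tpc /midbin /= gbin0 cheb0.
  by rewrite !expr0 !mulr1.
rewrite big_nat_recr//= IH mulr_suml.
set z := q ^+ n.+1; set V := fun k => cheb k.*2 y.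
have V0 : V 0%N * ((1 + z) ^+ 2 - y ^+ 2 * z) = (1 + z + z ^+ 2) * V 0%N - z * V 1%N.
  by rewrite /V /= !chebSS cheb1 cheb0; ring.
have VS k : V k.+1 * ((1 + z) ^+ 2 - y ^+ 2 * z)
    = (1 + z ^+ 2) * V k.+1 - z * (V k.+2 + V k).
  rewrite /V !doubleS (chebSS k.*2.+2) (chebSS k.*2.+1) (chebSS k.*2); ring.
transitivity (tpc n 0 * ((1 + z + z ^+ 2) * V 0%N - z * V 1%N)
  + \sum_(k < n.+1) tpc n k.+1 * ((1 + z ^+ 2) * V k.+1 - z * (V k.+2 + V k))).
  rewrite big_ord_recl -mulrA V0; congr (_ + _).
  rewrite [RHS]big_ord_recr /= tpc_small// mul0r addr0.
  by apply: eq_bigr => k _; rewrite (_ : bump 0 k = k.+1)// -mulrA -/(V k.+1) VS.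
rewrite tridiagonal_sum !(@tpc_small n n.+1)// (@tpc_small n n.+2)// !(mulr0, mul0r).
rewrite subrr addr0 [RHS]big_ord_recl; congr (_ + _); first by rewrite tpc0S.
by apply: eq_bigr => k _; rewrite (_ : lift ord0 k = k.+1 :> nat)// tpcS.
Qed.

Context (qlt1 : q < 1).

Let nq : `|q| < 1. Proof. by case/andP: hq => q1 _; rewrite ltr_norml q1. Qed.
Let Pq := qpoch q q.
Let Pq_neq0 n : Pq n != 0. Proof. by apply: qpoch_neq0 => //; exact: ltW. Qed.
Let Pinf := qpoch_oo q q.
Let Pinf_neq0 : Pinf != 0. Proof. exact: qpoch_oo_neq0. Qed.

Lemma qpoch_qfact n : qpoch q q n = (1 - q) ^+ n * qfact q n.
Proof.
elim: n => [|n IH]; first by rewrite qpoch0 qfact0 expr0 mulr1.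
by rewrite qpochS IH qfactS exprSr -exprS -qint_geom; ring.
Qed.

Lemma gbin_qpoch n k : (k <= n)%N -> gbin q n k = Pq n / (Pq (n - k) * Pq k).
Proof.
move=> kn; rewrite /Pq !qpoch_qfact gbinE//.
have -> : (1 - q) ^+ n = (1 - q) ^+ (n - k) * (1 - q) ^+ k by rewrite -exprD subnK.
have d0 m : (1 - q) ^+ m != 0 by rewrite expf_neq0// subr_eq0 gt_eqF.
by field; rewrite !d0 !(qfact_neq0 _ hq).
Qed.

Let cvg_pi (s : nat -> nat) : s @ \oo --> \oo -> (fun n => Pq (s n)) @ \oo --> Pinf.
Proof.
by move=> h; apply: (@cvg_comp _ _ _ s Pq _ _ _ h); exact: qpoch_cvg.
Qed.

Lemma tpc_cvg k : (fun n => tpc n k) @ \oo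
  --> (-1) ^+ k * q ^+ 'C(k.+1, 2) / Pinf.
Proof.
apply: (@cvg_lim_eq _ _ ((-1) ^+ k * (q ^+ 'C(k.+1, 2) *
  (Pinf / (Pinf * Pinf))))).
  by field; exact: Pinf_neq0.
apply: cvgMl_tmp; apply: cvgMl_tmp.
have h : (fun n => Pq n.*2.+1 / (Pq (n + k.+1) * Pq (n - k))) @ \oo
    --> Pinf / (Pinf * Pinf).
  apply: cvgM.
    apply: cvg_pi; apply/cvgnyPge => A; near=> n.
    have : (A <= n)%N by near: n; exact: nbhs_infty_ge.
    by move=> h; lia.
  apply: cvgV; first by rewrite mulf_neq0.
  apply: cvgM.
    apply: cvg_pi; apply/cvgnyPge => A; near=> n.
    have : (A <= n)%N by near: n; exact: nbhs_infty_ge.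
    by move=> h; lia.
  apply: cvg_pi; apply/cvgnyPge => A; near=> n.
  have : (A + k <= n)%N by near: n; exact: nbhs_infty_ge.
  by move=> h; lia.
apply: cvg_trans h; apply: near_eq_cvg; near=> n.
have kn : (k <= n)%N by near: n; exact: nbhs_infty_ge.
rewrite /midbin kn gbin_qpoch; last by lia.
by rewrite (_ : (n.*2.+1 - (n - k) = n + k.+1)%N)//; lia.
Unshelve. all: by end_near. Qed.

(** The integral of f_N times U_m(y / 2), where y = x sqrt(1 - q). *)
Definition cheb_moment m : R :=
  if odd m then 0 else (-1) ^+ m./2 * q ^+ 'C(m./2.+1, 2).

(** J n m is the integral of f_N times k^n H_n U_m(k x / 2), with k = sqrt(1 - q).
    The recursions of H_n and U_m determine it: J n m vanishes for m < n and for
    m - n odd, and has the closed form b n l for m = n + 2 l. *)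
Lemma moments_vanish (J : nat -> nat -> R) : (forall m, J 0%N m = cheb_moment m) ->
  (forall n m, J n.+1 m = J n m.+1 + (0 < m)%N%:R * J n m.-1
     - (1 - q ^+ n) * J n.-1 m) ->
  forall n, J n 0%N = (n == 0%N)%:R.
Proof.
move=> J0 JS.
pose b n k := (-1) ^+ k * q ^+ 'C(k.+1, 2) * (Pq (n + k) / Pq k).
pose claim n := [/\ forall k, J n (n + k.*2)%N = b n k,
  forall k, J n (n + k.*2).+1 = 0 & forall m, (m < n)%N -> J n m = 0].
have PS m : Pq m.+1 = Pq m * (1 - q ^+ m.+1) by rewrite /Pq qpochS -exprS.
have c0 : claim 0%N.
  split=> // k; rewrite J0 /cheb_moment /= odd_double ?doubleK//=.
  by rewrite /b mulfV ?mulr1.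
have cS n : claim n -> (0 < n -> claim n.-1)%N -> claim n.+1.
  move=> [ev od lo] cp.
  have T k : (1 - q ^+ n) * J n.-1 (n.+1 + k.*2)%N =
      (-1) ^+ k.+1 * q ^+ 'C(k.+2, 2) * ((1 - q ^+ n) * Pq (n + k) / Pq k.+1).
    case: n ev od lo cp => [|n] ev od lo cp; first by rewrite expr0 subrr !mul0r mulr0.
    have [ev' _ _] := cp isT.
    have -> : (n.+2 + k.*2 = n + k.+1.*2)%N by lia.
    rewrite /= ev' /b (_ : (n + k.+1 = n.+1 + k)%N); last by lia.
    by ring.
  split.
  - move=> k; rewrite JS T addSn /=.
    have -> : (n + k.*2).+2 = (n + k.+1.*2)%N by lia.
    rewrite !ev /b addSn addnS !PS.
    have h1 : 1 - q ^+ k.+1 != 0.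
      by have := Pq_neq0 k.+1; rewrite PS mulf_eq0 negb_or => /andP[].
    have e2 : q ^+ 'C(k.+2, 2) = q ^+ k.+1 * q ^+ 'C(k.+1, 2).
      by rewrite binS bin1 addnC exprD.
    rewrite e2 (exprS (-1)) (_ : (n + k).+1 = (n + k.+1)%N); last by lia.
    by rewrite exprD; field; rewrite h1 Pq_neq0.
  - move=> k; rewrite JS addSn /=.
    rewrite (_ : (n + k.*2).+3 = (n + k.+1.*2).+1) ?od; last by lia.
    rewrite mulr0 !add0r.
    case: n ev od lo cp T => [|n] ev od lo cp T; first by rewrite expr0 subrr mul0r oppr0.
    have [_ od' _] := cp isT.
    by rewrite /= (_ : (n.+1 + k.*2).+2 = (n + k.+1.*2).+1) ?od' ?mulr0 ?oppr0//; lia.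
  - move=> m mn; rewrite JS; have [mlt|] := ltnP m n; last first.
      move=> nm; have -> : m = n by lia.
      have := od 0%N; rewrite addn0 => ->; rewrite add0r.
      case: n ev od lo cp T mn nm => [|n] ev od lo cp T mn nm.
        by rewrite mul0r expr0 subrr mul0r subrr.
      have [_ od' _] := cp isT.
      rewrite lo// mulr0; have := od' 0%N; rewrite addn0 /= => ->.
      by rewrite mulr0 subrr.
    case: n ev od lo cp T mn mlt => [//|n] ev od lo cp T mn mlt /=.
    have [ev' _ lo'] := cp isT.
    have -> : (0 < m)%N%:R * J n.+1 m.-1 = 0.
      case: m mn mlt => [|m] mn mlt; first by rewrite mul0r.
      by rewrite /= lo ?mulr0//; lia.
    have [mn'|] := ltnP m n; first by rewrite (lo' m)// (lo m.+1)// mulr0 addr0 subr0.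
    move=> nm; have -> : m = n by lia.
    have := ev 0%N; have := ev' 0%N; rewrite !addn0 /= => -> ->.
    by rewrite /b !addn0 PS; ring.
have call n : claim n /\ claim n.+1.
  elim: n => [|n [IH1 IH2]]; first by split=> //; exact: cS.
  by split=> //; apply: cS.
case=> [|n]; last by have [_ [_ _ lo]] := call n; rewrite lo.
by rewrite J0 /cheb_moment /= mulr1.
Qed.

End TripleProduct.

Section QWeight.
Context {R : realType}.
Let mu := @lebesgue_measure R.
Context (q : R) (hq : -1 < q <= 1) (qlt1 : q < 1).

Let k := Num.sqrt (1 - q).
Let p0 : 0 < 1 - q. Proof. by rewrite subr_gt0. Qed.
Let k0 : 0 < k. Proof. by rewrite sqrtr_gt0. Qed.
Let kk : k ^+ 2 = 1 - q. Proof. by rewrite sqr_sqrtr// ltW. Qed.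
Let nq : `|q| < 1. Proof. by case/andP: hq => q1 _; rewrite ltr_norml q1. Qed.
Local Notation sc := (semicircle q).

(** The truncated products in the density. *)
Let P n (x : R) := \prod_(1 <= j < n.+1) ((1 + q ^+ j) ^+ 2 - (1 - q) * x ^+ 2 * q ^+ j).

Let K := qpoch_oo q q / (2 * pi).

Let f_ n x := K * (sc x * P n x).

Let sc_out x : x \notin qsupp q -> sc x = 0.
Proof.
rewrite (in_qsupp _ (ltW qlt1)) -ltNge => h; apply: ler0_sqrtr.
by rewrite pmulr_rle0// subr_le0 ltW.
Qed.

Let u (x : R) j : R := (1 + q ^+ j.+1) ^+ 2 - (1 - q) * x ^+ 2 * q ^+ j.+1 - 1.

Let PE n x : P n x = \prod_(j < n) (1 + u x j).
Proof.
rewrite /P big_add1 /= big_mkord; apply: eq_bigr => j _; rewrite /u; ring.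
Qed.

Let v j : R := 7 * `|q| ^+ j.+1.

Let v_cvg : cvgn (series v).
Proof.
rewrite /v seriesZE; apply: is_cvgZl_tmp.
apply: (@cvg_series_shiftV _ (fun j => `|q| ^+ j)).
rewrite (_ : (fun j => _) = geometric 1 `|q|); last first.
  by apply/funext => j; rewrite /geometric /= mul1r.
by apply: is_cvg_geometric_series; rewrite normr_id.
Qed.

Let uv x j : x \in qsupp q -> `|u x j| <= v j.
Proof.
rewrite (in_qsupp _ (ltW qlt1)) => xS; set z := q ^+ j.+1.
have z1 : `|z| <= 1 by rewrite normrX exprn_ile1// ltW.
have X0 : 0 <= (1 - q) * x ^+ 2 by rewrite mulr_ge0 ?sqr_ge0// ltW.
rewrite /u /v -normrX -/z (_ : _ - _ = z * (2 + z - (1 - q) * x ^+ 2)); last by ring.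
rewrite normrM mulrC ler_wpM2r// ler_norml.
by move: z1; rewrite ler_norml => /andP[z1 z2]; apply/andP; split; lra.
Qed.

Let Bd := expR (limn (series v)).

Let P_bound n x : x \in qsupp q -> `|P n x| <= Bd.
Proof. by move=> xS; rewrite PE; apply: norm_prod1D_le v_cvg => j; exact: uv. Qed.

Let P_cvg x : x \in qsupp q -> cvgn (fun n => P n x).
Proof.
move=> xS; rewrite (_ : (fun n => P n x) = (fun n => \prod_(j < n) (1 + u x j))).
  by apply: infinite_product_cvg; apply: abs_cvg_le v_cvg => j; exact: uv.
by apply/funext => n; exact: PE.
Qed.

Let P_ge0 n x : x \in qsupp q -> 0 <= P n x.
Proof.
rewrite (in_qsupp _ (ltW qlt1)) => xS; rewrite /P big_add1 /= big_mkord.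
apply: prodr_ge0 => j _; set z := q ^+ j.+1.
have X0 : 0 <= (1 - q) * x ^+ 2 by rewrite mulr_ge0 ?sqr_ge0// ltW.
have [z0|z0] := leP 0 z; last first.
  by have := sqr_ge0 (1 + z); nra.
by have := sqr_ge0 (1 - z); nra.
Qed.

Let Pinf_ge0 : 0 <= qpoch_oo q q.
Proof.
apply: limr_ge; first exact: qpoch_cvg.
near=> n; apply: prodr_ge0 => j _; rewrite subr_ge0 -exprS.
by apply: le_trans (ler_norm _) _; rewrite normrX exprn_ile1// ltW.
Unshelve. all: by end_near. Qed.

Let K0 : 0 <= K. Proof. by rewrite divr_ge0// mulr_ge0// pi_ge0. Qed.

Let weightE x : f_N_weight q x = K * (sc x * limn (fun n => P n x)).
Proof.
rewrite /f_N_weight; case: ifPn => xS; last by rewrite sc_out// mul0r mulr0.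
by rewrite /f_N lt_eqF// /K -/(sc x) -/(P _ _); ring.
Qed.

Let f_cvg x : (fun n => f_ n x) @ \oo --> f_N_weight q x.
Proof.
rewrite weightE; apply: cvgMl_tmp.
have [xS|xS] := boolP (x \in qsupp q); first by apply: cvgMl_tmp; exact: P_cvg.
rewrite sc_out// mul0r; under eq_fun do rewrite mul0r.
exact: cvg_cst.
Qed.

Let f_bound n x : `|f_ n x| <= K * (Bd * sc x).
Proof.
rewrite /f_ normrM (ger0_norm K0) ler_wpM2l//.
have [xS|xS] := boolP (x \in qsupp q); last by rewrite sc_out// mul0r normr0 mulr0.
by rewrite normrM ger0_norm ?sqrtr_ge0// mulrC ler_wpM2r ?sqrtr_ge0// P_bound.
Qed.

Let has_int_cheb_trunc n m :
  has_int mu (fun x => cheb m (k * x) * f_ n x)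
    (qpoch_oo q q * (if odd m then 0 else tpc q n m./2)).
Proof.
have h := has_intZ K (has_int_sum n.+1 (fun l => has_intZ (tpc q n l)
  (has_int_cheb_orthogonal qlt1 m l.*2))).
apply: has_int_eq h => [x|].
  rewrite /f_ /P.
  have -> : \prod_(1 <= j < n.+1) ((1 + q ^+ j) ^+ 2 - (1 - q) * x ^+ 2 * q ^+ j)
      = \sum_(l < n.+1) tpc q n l * cheb l.*2 (k * x).
    by rewrite -triple_product_finite//; apply: eq_bigr => j _; rewrite exprMn kk.
  rewrite [RHS]mulrCA; congr (K * _); rewrite !mulr_sumr; apply: eq_bigr => l _.
  by rewrite -/k; ring.
have -> : K = qpoch_oo q q * (2 * pi)^-1 by [].
have p2 : 2 * pi != 0 :> R by rewrite gt_eqF// mulr_gt0// pi_gt0.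
rewrite -mulrA; congr (_ * _).
rewrite (eq_bigr (fun l : 'I_n.+1 => (2 * pi) * (tpc q n l * (m == l.*2)%:R)));
  last by move=> l _; ring.
rewrite -mulr_sumr mulKf//; case: ifPn => om.
  apply: big1 => l _; case: eqP => [e|]; last by rewrite mulr0.
  by move: om; rewrite e odd_double.
have em : m = m./2.*2 by rewrite -[LHS]odd_double_half (negbTE om).
have [mn|nm] := leqP m./2 n.
  have mn' : (m./2 < n.+1)%N by [].
  rewrite (bigD1 (Ordinal mn'))//= -em eqxx mulr1 big1 ?addr0// => l ln.
  case: eqP => [e|]; last by rewrite mulr0.
  by move: ln; rewrite -val_eqE /= e doubleK eqxx.
rewrite tpc_small// big1// => l _; case: eqP => [e|]; last by rewrite mulr0.
by move: nm; rewrite e doubleK ltnNge -ltnS ltn_ord.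
Qed.

Let int_bound (g : R -> R) : continuous g ->
  exists e, has_int mu (fun x => `|g x| * (K * (Bd * sc x))) e.
Proof.
move=> cg.
have cg' : continuous (fun x => `|g x| * (K * Bd)).
  by move=> x; apply: cvgMr_tmp; apply: cvg_norm; exact: cg.
have [e he] := has_int_integrable (integrable_semicircle qlt1 cg').
by exists e; apply: has_int_eq he => // x; ring.
Qed.

Let cheb_continuous m : continuous (fun x => cheb m (k * x)).
Proof.
move=> x; apply: continuous_cvg; first exact: polyfun_continuous (polyfun_cheb m) _.
exact: cvgMl_tmp.
Qed.

Let has_int_cheb_weight m :
  has_int mu (fun x => cheb m (k * x) * f_N_weight q x) (cheb_moment q m).
Proof.
have [e he] := int_bound (@cheb_continuous m).
apply: (has_int_cvg (fun n => has_int_cheb_trunc n m) _ he) => [n x|x|].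
- by rewrite normrM ler_wpM2l.
- by apply: cvgMl_tmp; exact: f_cvg.
rewrite /cheb_moment; case: ifPn => om.
  by under eq_fun do rewrite mulr0; exact: cvg_cst.
apply: (@cvg_lim_eq _ _ (qpoch_oo q q *
  ((-1) ^+ m./2 * q ^+ 'C(m./2.+1, 2) / qpoch_oo q q))).
  by rewrite mulrCA mulfV ?mulr1// qpoch_oo_neq0.
by apply: cvgMl_tmp; exact: tpc_cvg.
Qed.

Let weight_measurable : measurable_fun setT (f_N_weight q : measurableTypeR R -> R).
Proof.
have := has_int_measurable (has_int_cheb_weight 0).
by rewrite (_ : (fun x => _) = f_N_weight q)//; apply/funext => x; rewrite cheb0 mul1r.
Qed.

Let weight_ge0 x : 0 <= f_N_weight q x.
Proof.
rewrite weightE mulr_ge0//.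
have [xS|xS] := boolP (x \in qsupp q); last by rewrite sc_out// mul0r.
rewrite mulr_ge0 ?sqrtr_ge0//; apply: limr_ge; first exact: P_cvg.
by near=> n; exact: P_ge0.
Unshelve. all: by end_near. Qed.

Let weight_le x : f_N_weight q x <= K * (Bd * sc x).
Proof.
rewrite -(cvg_lim (@Rhausdorff R) (f_cvg (x := x))).
apply: limr_le; first exact: cvgP (f_cvg (x := x)).
by near=> n; apply: le_trans (ler_norm _) _; exact: f_bound.
Unshelve. all: by end_near. Qed.

Let weight_poly (g : R -> R) : polyfun g ->
  exists c, has_int mu (fun x => g x * f_N_weight q x) c.
Proof.
move=> pg; have cg := polyfun_continuous pg.
have [e he] := int_bound cg.
have mg : measurable_fun setT (fun x : measurableTypeR R => g x * f_N_weight q x).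
  apply: measurable_funM; last exact: weight_measurable.
  exact: continuous_measurable_fun.
have [c hc _] : exists2 c, has_int mu (fun x => g x * f_N_weight q x) c & `|c| <= e.
  apply: has_int_dominated he => // x.
  by rewrite normrM (ger0_norm (weight_ge0 x)) ler_wpM2l ?weight_le.
by exists c.
Qed.

Theorem normalized_weight_lt1 : normalized_weight q.
Proof.
have poly (p : {poly R}) : exists c, has_int mu (fun x => p.[x] * f_N_weight q x) c.
  by apply: weight_poly; exists p.
split; first exact: weight_ge0.
  by move=> p; have [c []] := poly p.
pose h n x := k ^+ n * qHermite q n x.
have ex n m : exists c, has_int mu (fun x => h n x * cheb m (k * x) * f_N_weight q x) c.
  apply: weight_poly; apply: polyfunM.
    by apply: polyfunM; [exact: polyfun_cst|exact: polyfun_qHermite].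
  have [p Hp] := @polyfun_cheb R m.
  by exists (p \Po (k%:P * 'X)) => x; rewrite Hp horner_comp hornerM hornerC hornerX.
pose J n m := sval (cid (ex n m)).
have JP n m : has_int mu (fun x => h n x * cheb m (k * x) * f_N_weight q x) (J n m).
  by rewrite /J; case: cid.
have hS n x : h n.+1 x = k * x * h n x - (1 - q ^+ n) * h n.-1 x.
  rewrite /h qHermiteS -qint_geom -kk; case: n => [|n].
    by rewrite qint0 !expr0 expr1 !mulr0 !mul0r; ring.
  by rewrite !exprS /=; ring.
have J0 n : J n 0%N = (n == 0%N)%:R.
  move: n; apply: (moments_vanish hq qlt1).
  - move=> m; apply: has_int_unique (JP 0%N m) _.
    apply: has_int_eq (has_int_cheb_weight m) => // x.
    by rewrite /h expr0 qHermite0 !mul1r.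
  - move=> n m; apply: has_int_unique (JP n.+1 m) _.
    apply: has_int_eq (has_intB (has_intD (JP n m.+1)
      (has_intZ (0 < m)%N%:R (JP n m.-1))) (has_intZ (1 - q ^+ n) (JP n.-1 m))) => // x.
    by rewrite hS chebS; ring.
move=> n; have := JP n 0%N; rewrite J0 => H.
apply: has_int_eq (has_intZ (k ^+ n)^-1 H) => [x|].
  have kn : k ^+ n != 0 by rewrite expf_neq0// gt_eqF.
  by rewrite cheb0 /h mulr1 -mulrA mulKf.
by case: n {H} => [|n]; rewrite ?expr0 ?invr1 ?mulr1// mulr0.
Qed.

End QWeight.

Lemma normalized_weight_q {R : realType} (q : R) : -1 < q <= 1 -> normalized_weight q.
Proof.
move=> hq; have [->|q1] := eqVneq q 1; first exact: normalized_weight_q1.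
apply: normalized_weight_lt1 => //.
by case/andP: hq => _ q2; rewrite lt_neqAle q1.
Qed.

Theorem proposition2 (R : realType) (q rho : R)
    (hq : -1 < q <= 1) (hrho : `|rho| < 1) :
  (* (i), including q = 1 *)
  ((forall i j m k : nat, (i + j != m + k)%N ->
      has_integral2 q
        (fun x y => Q q rho i j x y * Q q rho m k x y * f_2D q rho x y) 0) /\
   (* The q-exponent inside the sum is s(s-1) + s(k-j), not s(s-1) + ns: the
      latter already fails for n = j = k = 1, q != 1, rho != 0. The powers
      q^binom2(k-j) and rho^(k-j) are kept inside the sum so that they are
      meaningful when k < j and q or rho is 0. *)
   (forall n j k : nat, (j <= n)%N -> (k <= n)%N ->
      has_integral2 q
        (fun x y => Q q rho (n - j) j x y * Q q rho (n - k) k x y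
                    * f_2D q rho x y)
        ((-1) ^ (k%:Z - j%:Z) * (qfact q j * qfact q (n - j))
         / qpoch (rho ^+ 2) q n
         * \sum_(s < j.+1)
             q ^ (binom2 (k%:Z - j%:Z) + s%:Z * (s%:Z - 1)
                  + s%:Z * (k%:Z - j%:Z))
             * qbinom q k (k%:Z - j%:Z + s%:Z) * qbinom q (n - j + s)%N s
             * rho ^ (k%:Z - j%:Z + 2 * s%:Z)
             * qpoch (rho ^+ 2 * q ^+ (n - j + s)) q (j - s)))) /\
  (* (ii), including q = 1 *)
  (forall x y t s : R, x \in qsupp q -> y \in qsupp q ->
     (1 - q) * t ^+ 2 < 1 -> (1 - q) * s ^+ 2 < 1 ->
     let u k := rho ^+ k / qfact q k * big_qHermite q t k x
                * big_qHermite q s k y in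
     cvgn (series u) /\
     has_double_sum
       (fun n m => t ^+ n * s ^+ m / (qfact q n * qfact q m) * Q q rho n m x y)
       (density_quotient q rho t s x y * limn (series u))) /\
  (* (iii) *)
  (q < 1 ->
   (forall (x y : R) (i j m : nat),
      Q q (rho * q ^+ m) i j x y
        * \prod_(l < m) omega_q q (rho * q ^+ l) x y =
      qpoch (rho ^+ 2) q (2 * m)
        * \sum_(k < m.+1) (-1) ^+ k * qbinom q m k * q ^+ 'C(k, 2)
            * (1 - q) ^+ k * rho ^+ k * Q q rho (i + k) (j + k) x y) /\
   (forall (x y : R) (n : nat),
      \prod_(j < n) omega_q q (rho * q ^+ j) x y =
      qpoch (rho ^+ 2) q (2 * n)
        * \sum_(k < n.+1) (-1) ^+ k * qbinom q n k * q ^+ 'C(k, 2)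
            * (1 - q) ^+ k * rho ^+ k * Q q rho k k x y) /\
   (forall (x y : R) (n : nat),
      q ^+ 'C(n, 2) * rho ^+ n * (1 - q) ^+ n * Q q rho n n x y =
      \sum_(k < n.+1) (-1) ^+ k * q ^+ 'C(n - k, 2) * qbinom q n k
        * (\prod_(j < k) omega_q q (rho * q ^+ j) x y)
        / qpoch (rho ^+ 2) q (2 * k))).
Proof.
have nw := normalized_weight_q hq.
split; [split|split].
- by move=> i j m k ne; exact: Q_orthogonal_degree.
- move=> n j k jn kn.
  have le : (n - k + k <= n - j + j)%N by rewrite !subnK.
  have := has_integral2_Q_le hq hrho nw le.
  by rewrite !subnK// eqxx Qtop_closed_form.
- move=> x y t s xS yS t1 s1 u.
  exact: Q_generating_function.
- move=> q1; split; [|split] => *; first exact: Q_qscale.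
  + exact: prod_omega_expand.
  + exact: Q_diag_expand.
Qed.
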